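(* Let $Y$ be a compact connected manifold without boundary and $G$ be a nontrivial compact connected Lie group. Assume that $Y$ admits a free action of $G$. Then for every minimal system $(X,T)$ there is a homeomorphism $S\colon Y\to Y$ isotopic to the identity such that the product $(X\times Y,T\times S)$ is minimal. Consequently, $Y$ is a homeo-product-minimal space.
   Context: Manifolds are topological manifolds and actions are continuous. A dynamical system $(X,T)$ is a metrizable (not necessarily compact) space $X$ with a continuous map $T\colon X\to X$; it is minimal if there is no proper nonempty closed $M\subsetneq X$ with $T(M)\subseteq M$. A homeomorphism $S$ of $Y$ is isotopic to the identity if there is a continuous map $F\colon[0,1]\times Y\to Y$ such that all $F_t=F(t,\cdot)$ are homeomorphisms of $Y$, $F_0=\mathrm{Id}_Y$ and $F_1=S$. A compact metrizable space $Y$ is homeo-product-minimal if for every minimal system $(X,T)$ with $X$ metrizable there is a homeomorphism $S\colon Y\to Y$ with $(X\times Y,T\times S)$ minimal. *)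

(* Defs.v *)
(* MathComp-Analysis; the real line is an arbitrary R : realType. *)
From HB Require Import structures.
From mathcomp Require Import all_boot all_order all_algebra.
From mathcomp Require Import all_classical all_reals all_analysis.
Set Implicit Arguments.
Unset Strict Implicit.
Unset Printing Implicit Defensive.
Import Order.TTheory GRing.Theory Num.Theory.
Import numFieldNormedType.Exports.
Local Open Scope classical_set_scope.
Local Open Scope ring_scope.

Definition homeomorphism (X Y : topologicalType) (f : X -> Y) : Prop :=
  continuous f /\
  exists g : Y -> X, [/\ continuous g, cancel f g & cancel g f].

Definition metrizable (R : realType) (X : topologicalType) : Prop :=
  exists (M : metricType R) (f : X -> M), homeomorphism f.

Definition minimal_system (R : realType) (X : topologicalType) (T : X -> X)
    : Prop :=
  [/\ metrizable R X, continuous T &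
      forall M : set X, closed M -> M !=set0 -> T @` M `<=` M -> M = setT].

Definition prod_map (X Y : Type) (T : X -> X) (S : Y -> Y) (p : X * Y) : X * Y :=
  (T p.1, S p.2).

Definition isotopic_to_id (R : realType) (Y : topologicalType) (S : Y -> Y)
    : Prop :=
  exists F : R * Y -> Y,
    [/\ {within `[0, 1]%classic `*` [set: Y], continuous F},
        forall t : R, 0 <= t <= 1 -> homeomorphism (fun y => F (t, y)),
        forall y, F (0, y) = y
      & forall y, F (1, y) = S y].

Definition homeo_product_minimal (R : realType) (Y : topologicalType) : Prop :=
  [/\ compact [set: Y], metrizable R Y &
      forall (X : topologicalType) (T : X -> X), minimal_system R T ->
        exists S : Y -> Y,
          homeomorphism S /\ minimal_system R (prod_map T S)].

(* [chart_inv] is a total function, but only its values on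
   [chart_map @` chart_dom] are constrained. *)
Record chart (R : realType) (n : nat) (M : topologicalType) := Chart {
  chart_dom : set M;
  chart_map : M -> 'rV[R]_n;
  chart_inv : 'rV[R]_n -> M;
  chart_dom_open : open chart_dom;
  chart_img_open : open (chart_map @` chart_dom);
  chart_map_continuous : {within chart_dom, continuous chart_map};
  chart_inv_continuous :
    {within chart_map @` chart_dom, continuous chart_inv};
  chart_mapK : forall x, chart_dom x -> chart_inv (chart_map x) = x
}.

Definition chart_img (R : realType) (n : nat) (M : topologicalType)
  (c : chart R n M) : set 'rV[R]_n := chart_map c @` chart_dom c.

(* Chart images are open in R^n, not in a half-space: no boundary. *)
Definition topological_manifold (R : realType) (n : nat) (M : topologicalType)
    : Prop :=
  [/\ hausdorff_space M, @second_countable M &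
      forall x : M, exists c : chart R n M, chart_dom c x].

(* Only used for U open and V finite-dimensional, where it is the usual C^k. *)
Fixpoint Ck_on (R : realType) (V W : normedModType R) (k : nat) (U : set V)
    (f : V -> W) : Prop :=
  match k with
  | 0 => forall x, U x -> {for x, continuous f}
  | k'.+1 => (forall x, U x -> differentiable f x) /\
             forall v : V, Ck_on k' U ('D_v f)
  end.

Definition smooth_on (R : realType) (V W : normedModType R) (U : set V)
  (f : V -> W) : Prop := forall k, Ck_on k U f.

Definition smooth_atlas (R : realType) (n : nat) (M : topologicalType)
    (A : set (chart R n M)) : Prop :=
  (forall x : M, exists2 c, A c & chart_dom c x) /\
  forall c c', A c -> A c' ->
    smooth_on (chart_map c @` (chart_dom c `&` chart_dom c'))
              (chart_map c' \o chart_inv c).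

HB.mixin Record Group_isTopologicalGroup G & Group G & Topological G := {
  mulg_continuous : continuous (fun p : G * G => (p.1 * p.2)%g);
  invg_continuous : continuous (fun g : G => (g^-1)%g)
}.

#[short(type="topologicalGroupType")]
HB.structure Definition TopologicalGroup :=
  {G of Group G & Topological G & Group_isTopologicalGroup G}.

Definition smooth_mulg (R : realType) (n : nat) (G : topologicalGroupType)
    (A : set (chart R n G)) : Prop :=
  forall c1 c2 c, A c1 -> A c2 -> A c ->
    smooth_on
      [set p : 'rV[R]_n * 'rV[R]_n |
        [/\ chart_img c1 p.1, chart_img c2 p.2 &
            chart_dom c (chart_inv c1 p.1 * chart_inv c2 p.2)%g]]
      (fun p => chart_map c (chart_inv c1 p.1 * chart_inv c2 p.2)%g).

Definition smooth_invg (R : realType) (n : nat) (G : topologicalGroupType)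
    (A : set (chart R n G)) : Prop :=
  forall c1 c, A c1 -> A c ->
    smooth_on
      [set u : 'rV[R]_n |
        chart_img c1 u /\ chart_dom c ((chart_inv c1 u)^-1)%g]
      (fun u => chart_map c ((chart_inv c1 u)^-1)%g).

Definition lie_group (R : realType) (n : nat) (G : topologicalGroupType)
    : Prop :=
  topological_manifold R n G /\
  exists A : set (chart R n G),
    [/\ smooth_atlas A, smooth_mulg A & smooth_invg A].

Definition free_action (G : topologicalGroupType) (Y : topologicalType)
    (a : G -> Y -> Y) : Prop :=
  [/\ continuous (fun p : G * Y => a p.1 p.2),
      forall y, a 1%g y = y,
      forall g h y, a (g * h)%g y = a g (a h y)
    & forall g y, a g y = y -> g = 1%g].

(* Main.v *)
Require Import Defs.
From HB Require Import structures.
From mathcomp Require Import all_boot all_order all_algebra.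
From mathcomp Require Import all_classical all_reals all_analysis.
From mathcomp Require Import ring lra zify.
Import Order.TTheory GRing.Theory Num.Theory.
Import numFieldNormedType.Exports.
Set Implicit Arguments.
Unset Strict Implicit.
Unset Printing Implicit Defensive.
Local Open Scope classical_set_scope.
Local Open Scope ring_scope.

(** Why the theorem holds.

    A nontrivial compact connected Lie group contains a circle, so that [Y]
    carries a free circle action [phi], seen as a flow of period 1
    ([circle_subgroup]). The homeomorphism [S] is a limit of conjugated rotations
    [h_k phi_(t_k) h_k^-1], following Anosov and Katok, Fathi and Herman: the
    angle [t_k = p_k / q_k] is rational, [h_(k+1) = h_k g_k], and [g_k] commutes
    with the rotation of angle [1 / q_k]. Then [h_(k+1)] and [h_k] conjugate the
    rotation of angle [t_k] to the same map, and the next conjugated rotation is as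
    close to the current one as desired provided that [t_(k+1)] is close enough
    to [t_k], however wild [g_k] is.

    The system [(X, T)] enters through sets of integers only. Since [Y] is
    compact, closed invariant sets of the product project onto closed invariant
    sets of [X]; so it suffices that, for one point [x0] and every [y] in [Y], the
    orbit of [(x0, y)] visits all boxes [U x V] ([product_minimal]). The times at
    which [x0] visits [U] form an infinite set, and countably many [U] and [V]
    suffice. The theorem thus reduces to [generic_homeomorphism]: given countably
    many pairs [(N, V)] of an infinite set of integers and a nonempty open set,
    some [S] isotopic to the identity takes every point into [V] at a time in
    [N], for each pair. Such a requirement survives small perturbations of [S]
    because [Y] is compact ([robust_hitting]), and it can be met at one stage
    ([refine_stage]): if [g_k] is such that every orbit of [phi] meets the
    preimage of [V] by [h_(k+1)], compactness leaves finitely many arcs of angles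
    to be hit, and since [N] is infinite there are [t] near [t_k] whose multiples
    by elements of [N] hit all of them ([simultaneous_hitting]). Two consecutive
    stages differ by the rotation of small angle [r = t_(k+1) - t_k], conjugated
    by [h_(k+1)]; it is joined to the identity by the rotations of angles [s r],
    conjugated in the same way. Composing these small paths gives isotopies that
    converge uniformly together with their inverses.

    The geometric heart is the existence of [g_k]
    ([conjugate_to_meet_orbits]). It suffices to find finitely many closed balls
    that meet every orbit and are disjoint from each other and from their
    translates by multiples of [1 / q_k] ([cells_meeting_orbits]): a
    homeomorphism commuting with the rotation of angle [1 / q_k] shrinks them and
    pushes them into the translates of [V] ([push_cells]). As the action is only
    continuous, its orbit space need not be a manifold, and the balls cannot be
    discs transverse to the orbits that have been thickened. There are
    nevertheless closed local slices with an exact local time along the orbits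
    ([equivariant_time], [flow_slices]). A slice is covered by small cubes of a
    grid in a chart, and the cubes are moved along the flow to become disjoint.
    Cubes are colored by their indices modulo 3, so that cubes of the same color
    are disjoint; cubes of different colors receive different heights. At most
    one height is excluded at a given point by each slice-like piece in which
    earlier cubes have been placed, and the number of these pieces is known
    before the size of the cubes is chosen: some height is free
    ([place_slice]).

    The circle in the Lie group comes from the strict differentiability of the
    product at the identity ([lie_group_chart]). Elements near the identity have
    small square roots, which are unique; iterating them yields a one-parameter
    subgroup through each element [c] near the identity, commuting with
    everything that commutes with [c] ([one_parameter_subgroups]). A
    one-parameter subgroup returns close to the identity after a time [T >= 1];
    divided by the short one-parameter subgroup through its value at [T], it
    becomes periodic ([periodic_one_parameter]). *)

(** * Continuity of combined maps *)

Section ContinuityTools.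
Variables (R : realType) (T : topologicalType).

Lemma cts_id : continuous (fun x : T => x).
Proof. by move=> x; exact: cvg_id. Qed.

Lemma cts_cst (U : topologicalType) (c : U) : continuous (fun _ : T => c).
Proof. exact: cst_continuous. Qed.

Lemma cts_comp (U V : topologicalType) (g : U -> V) (f : T -> U) :
  continuous g -> continuous f -> continuous (fun x => g (f x)).
Proof. by move=> cg cf x; apply: continuous_comp; [exact: cf|exact: cg]. Qed.

Lemma cts_pair (U V : topologicalType) (f : T -> U) (g : T -> V) :
  continuous f -> continuous g -> continuous (fun x => (f x, g x)).
Proof. by move=> cf cg x; apply: cvg_pair; [exact: cf|exact: cg]. Qed.

Lemma cts_fst (U V : topologicalType) (f : T -> U * V) :
  continuous f -> continuous (fun x => (f x).1).
Proof. by move=> cf; apply: cts_comp cf => -[a b]; exact: cvg_fst. Qed.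

Lemma cts_snd (U V : topologicalType) (f : T -> U * V) :
  continuous f -> continuous (fun x => (f x).2).
Proof. by move=> cf; apply: cts_comp cf => -[a b]; exact: cvg_snd. Qed.

Lemma ctsD (V : normedModType R) (f g : T -> V) :
  continuous f -> continuous g -> continuous (fun x => f x + g x).
Proof. by move=> cf cg x; apply: continuousD; [exact: cf|exact: cg]. Qed.

Lemma ctsN (V : normedModType R) (f : T -> V) :
  continuous f -> continuous (fun x => - f x).
Proof. by move=> cf x; apply: continuousN; exact: cf. Qed.

Lemma ctsB (V : normedModType R) (f g : T -> V) :
  continuous f -> continuous g -> continuous (fun x => f x - g x).
Proof. by move=> cf cg x; apply: continuousB; [exact: cf|exact: cg]. Qed.

Lemma ctsZ (V : normedModType R) (s : T -> R) (f : T -> V) :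
  continuous s -> continuous f -> continuous (fun x => s x *: f x).
Proof. by move=> cf cg x; apply: continuousZ; [exact: cf|exact: cg]. Qed.

Lemma ctsM (f g : T -> R) :
  continuous f -> continuous g -> continuous (fun x => f x * g x).
Proof. by move=> cf cg x; apply: continuousM; [exact: cf|exact: cg]. Qed.

Lemma ctsX (f : T -> R) n : continuous f -> continuous (fun x => f x ^+ n).
Proof. move=> cf; apply: (@cts_comp R R (fun r => r ^+ n)) cf; exact: exprn_continuous. Qed.

Lemma cts_norm (V : normedModType R) (f : T -> V) :
  continuous f -> continuous (fun x => `|f x|).
Proof.
move=> cf; apply: (@cts_comp V R (fun v => `|v|)) cf; exact: norm_continuous.
Qed.

Lemma cts_max (f g : T -> R) :
  continuous f -> continuous g -> continuous (fun x => Num.max (f x) (g x)).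
Proof.
by move=> cf cg x; apply: (@continuous_max R T f g x); [exact: cf|exact: cg].
Qed.

End ContinuityTools.

Lemma closed_le_fun (R : realType) (T : topologicalType) (f g : T -> R) :
  continuous f -> continuous g -> closed [set x | f x <= g x].
Proof.
move=> cf cg; have -> : [set x | f x <= g x] =
    (fun x => f x - g x) @^-1` [set r : R | r <= 0].
  by apply/seteqP; split=> x /=; rewrite subr_le0.
by apply: preimage_closed; [move=> x _; exact: (ctsB cf cg)|exact: closed_le].
Qed.

Lemma open_lt_fun (R : realType) (T : topologicalType) (f g : T -> R) :
  continuous f -> continuous g -> open [set x | f x < g x].
Proof.
move=> cf cg; have -> : [set x | f x < g x] =
    (fun x => f x - g x) @^-1` [set r : R | r < 0].
  by apply/seteqP; split=> x /=; rewrite subr_lt0.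
by apply: open_comp; [move=> x _; exact: (ctsB cf cg)|exact: open_lt].
Qed.

Lemma nbhs_preimage (X Y : topologicalType) (f : X -> Y) x (A : set Y) :
  continuous f -> nbhs (f x) A -> nbhs x (f @^-1` A).
Proof. by move=> cf /(cf x). Qed.

Lemma closed_eq_fun (X Y : topologicalType) (f g : X -> Y) :
  hausdorff_space Y -> continuous f -> continuous g -> closed [set x | f x = g x].
Proof.
rewrite open_hausdorff => hY cf cg x clx; apply: contrapT => /eqP ne.
have [[A B] /= [/set_mem fA /set_mem gB] [oA oB /eqP AB]] := hY _ _ ne.
have xA : nbhs x (f @^-1` A) by apply: nbhs_preimage => //; exact: open_nbhs_nbhs.
have xB : nbhs x (g @^-1` B) by apply: nbhs_preimage => //; exact: open_nbhs_nbhs.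
have [y [/= e [Ay By]]] := clx _ (filterI xA xB).
by move: By; rewrite /= -e => By; have : (A `&` B) (f y) by []; rewrite AB.
Qed.

Lemma continuous_at_dist (R : realType) (T : topologicalType)
    (V : normedModType R) (f : T -> V) (x : T) :
  (forall e : R, 0 < e -> nbhs x [set y | `|f x - f y| < e]) ->
  {for x, continuous f}.
Proof. by move=> H; apply/cvgrPdist_lt => e /H. Qed.

(** * Homeomorphisms of compact spaces *)

(** The filter of upper sets of finite sequences, ordered by inclusion, turns
    the near-covering form of compactness into a finite subcover. *)
Lemma finite_subcover (X : topologicalType) (K : set X) (B : X -> set X) :
  compact K -> (forall x, K x -> nbhs x (B x)) ->
  exists s : seq X, (forall x, x \in s -> K x) /\
    forall y, K y -> exists2 x, x \in s & B x y.
Proof.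
move=> cK KB.
pose F : set_system (seq X) := [set P : set (seq X) | exists2 s0 : seq X,
  (forall x, x \in s0 -> K x) & forall s : seq X, {subset s0 <= s} -> P s].
have FF : Filter F.
  constructor; first by exists [::].
  - move=> P Q [s0 s0K s0P] [s1 s1K s1Q]; exists (s0 ++ s1).
      by move=> x; rewrite mem_cat => /orP[/s0K|/s1K].
    move=> s sub; split; [apply: s0P|apply: s1Q] => x xs; apply: sub;
      by rewrite mem_cat xs ?orbT.
  - by move=> P Q PQ [s0 s0K s0P]; exists s0 => // s /s0P /PQ.
have H := (compact_near_coveringP K).1 cK (seq X) F
  (fun (s : seq X) y => exists2 x, x \in s & B x y) FF.
suff [s0 s0K s0P] : F [set s : seq X | K `<=` [set y | exists2 x, x \in s & B x y]].
  by exists s0; split=> // y Ky; exact: (s0P s0).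
apply: H => x Kx; exists (B x, [set s : seq X | x \in s]) => /=.
  split; first exact: KB.
  exists [:: x] => [y|s xs]; first by rewrite inE => /eqP ->.
  by apply: xs; rewrite inE.
by move=> [y s] /= [Bxy xs]; exists x.
Qed.

(** Closed subsets of [X] are compact, so [f] is a closed map. *)
Lemma compact_bijection_inverse (X Y : topologicalType) (f : X -> Y) (g : Y -> X) :
  compact [set: X] -> hausdorff_space Y -> continuous f ->
  cancel f g -> cancel g f -> continuous g.
Proof.
move=> cX hY cf fK gK; apply/continuous_closedP => C clC.
have -> : g @^-1` C = f @` C.
  apply/seteqP; split=> [y Cgy|_ [x Cx <-]]; last by rewrite /preimage /= fK.
  by exists (g y).
apply: compact_closed => //; apply: continuous_compact.
  exact: continuous_subspaceT.
exact: subclosed_compact clC cX _.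
Qed.

Lemma bijective_homeomorphism (Y : topologicalType) (f : Y -> Y) :
  compact [set: Y] -> hausdorff_space Y -> continuous f ->
  injective f -> (forall y, exists x, f x = y) -> homeomorphism f.
Proof.
move=> cY hY cf fi fs; split=> //; pose g y := projT1 (cid (fs y)).
have gK : cancel g f by move=> y; rewrite /g; case: cid.
have fK : cancel f g by move=> y; apply: fi; rewrite gK.
by exists g; split=> //; exact: compact_bijection_inverse fK gK.
Qed.

Lemma homeomorphism_id (Y : topologicalType) : homeomorphism (@id Y).
Proof. by split; [|exists id; split=> //] => x; exact: cvg_id. Qed.

Lemma homeomorphism_comp (X Y Z : topologicalType) (f : X -> Y) (g : Y -> Z) :
  homeomorphism f -> homeomorphism g -> homeomorphism (g \o f).
Proof.
move=> [cf [f' [cf' fK f'K]]] [cg [g' [cg' gK g'K]]]; split.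
  by move=> x; apply: continuous_comp; [exact: cf|exact: cg].
exists (f' \o g'); split.
- by move=> x; apply: continuous_comp; [exact: cg'|exact: cf'].
- by move=> x /=; rewrite gK fK.
- by move=> x /=; rewrite f'K g'K.
Qed.

(** * Cells and homeomorphisms supported in them *)

Section Cells.
Variables (R : realType) (m : nat).
Implicit Types (Y : topologicalType).
Local Notation rV := 'rV[R]_m.

(** A closed ball embedded in [Y] whose interior is open. The map is total and
    continuous everywhere, so that no subspace topology intervenes. The norm is
    the sup norm: the balls are cubes. *)
Definition cell Y (b : rV -> Y) := [/\ continuous b,
  forall x x', `|x| <= 1 -> `|x'| <= 1 -> b x = b x' -> x = x' &
  open (b @` [set x | `|x| < 1])].

Lemma compact_unit_ball : compact [set x : rV | `|x| <= 1].
Proof.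
apply: bounded_closed_compact.
  exists 1; split=> // M M1 x /= x1; exact: le_trans x1 (ltW M1).
have -> : [set x : rV | `|x| <= 1] = Num.norm @^-1` [set r : R | r <= 1] by [].
apply: preimage_closed; last exact: closed_le.
by move=> x _; exact: norm_continuous.
Qed.

Lemma cell_closed_image Y (b : rV -> Y) (C : set rV) : hausdorff_space Y ->
  continuous b -> closed C -> C `<=` [set x | `|x| <= 1] -> closed (b @` C).
Proof.
move=> hY cb clC sC; apply: compact_closed => //; apply: continuous_compact.
  exact: continuous_subspaceT.
exact: subclosed_compact clC compact_unit_ball sC.
Qed.

(** The image is the open cell minus the compact image of the part of the
    closed ball outside [U]. *)
Lemma cell_open_image Y (b : rV -> Y) (U : set rV) : hausdorff_space Y ->
  cell b -> open U -> U `<=` [set x | `|x| < 1] -> open (b @` U).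
Proof.
move=> hY [cb bi ob] oU sU.
have -> : b @` U = b @` [set x | `|x| < 1] `&`
    ~` (b @` ([set x | `|x| <= 1] `&` ~` U)).
  apply/seteqP; split=> [_ [x Ux <-]|_ [[x x1 <-] nU]].
    split; first by exists x => //; exact: sU.
    move=> [x' [x'1 nUx']] /bi; move=> /(_ x'1 (ltW (sU _ Ux))) ex.
    by apply: nUx'; rewrite ex.
  exists x => //; apply: contrapT => nUx; apply: nU; exists x => //; split=> //=.
  exact: ltW.
apply: openI => //; apply: closed_openC; apply: cell_closed_image => //.
  apply: closedI; last exact: open_closedC.
  apply: compact_closed; [exact: norm_hausdorff|exact: compact_unit_ball].
Qed.

Lemma cell_homeomorphism Y (f : Y -> Y) (b : rV -> Y) :
  homeomorphism f -> cell b -> cell (fun x => f (b x)).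
Proof.
move=> [cf [g [cg fK gK]]] [cb bi ob]; split.
- exact: cts_comp.
- by move=> x x' x1 x'1 /(can_inj fK); exact: bi.
- have -> : (fun x => f (b x)) @` [set x | `|x| < 1] =
      g @^-1` (b @` [set x | `|x| < 1]).
    apply/seteqP; split=> [_ [x x1 <-]|y [x x1 e]]; first by exists x => //; rewrite fK.
    by exists x => //; rewrite e gK.
  by apply: open_comp => // y _; exact: cg.
Qed.

Lemma subcell Y (b : rV -> Y) (c : rV) (r : R) : hausdorff_space Y -> 0 < r ->
  cell b -> (forall x, `|x - c| <= r -> `|x| < 1) ->
  cell (fun x => b (c + r *: x)).
Proof.
move=> hY r0 cellb sub; have [cb bi _] := cellb.
have nr x : `|x| <= 1 -> `|c + r *: x - c| <= r.
  by move=> x1; rewrite addrAC subrr add0r normrZ gtr0_norm // ler_piMr // ltW.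
split.
- apply: (cts_comp cb); apply: ctsD; first exact: cts_cst.
  by apply: ctsZ; [exact: cts_cst|exact: cts_id].
- move=> x x' x1 x'1 /bi; rewrite !(ltW (sub _ (nr _ _))) // => /(_ isT isT).
  by move/addrI/scalerI; apply; rewrite gt_eqF.
- have -> : (fun x => b (c + r *: x)) @` [set x | `|x| < 1] =
      b @` [set x | `|x - c| < r].
    apply/seteqP; split=> [_ [x /= x1 <-]|_ [x /= xr <-]].
      exists (c + r *: x) => //=.
      by rewrite addrAC subrr add0r normrZ gtr0_norm // gtr_pMr.
    exists (r^-1 *: (x - c)) => /=.
      by rewrite normrZ gtr0_norm ?invr_gt0 // mulrC ltr_pdivrMr // mul1r.
    by rewrite scalerA divff ?gt_eqF // scale1r addrC subrK.
  apply: cell_open_image => //; last by move=> x /= /ltW; exact: sub.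
  apply: open_lt_fun; last exact: cts_cst.
  by apply: cts_norm; apply: ctsB; [exact: cts_id|exact: cts_cst].
Qed.

(** The preimage of a closed set is the image of a compact part of the ball
    together with all, or nothing, of the complement of the open cell. *)
Lemma cell_extend Y (T : topologicalType) (b : rV -> Y) (v : rV -> T) (c : T) :
  hausdorff_space Y -> cell b -> continuous v -> (forall x, `|x| = 1 -> v x = c) ->
  exists F : Y -> T, [/\ continuous F, forall x, `|x| <= 1 -> F (b x) = v x &
    forall y, (forall x, `|x| <= 1 -> y <> b x) -> F y = c].
Proof.
move=> hY [cb bi ob] cv vc.
pose P y x := `|x| <= 1 /\ y = b x.
pose F y := match pselect (exists x, P y x) with
  | left e => v (projT1 (cid e)) | right _ => c end.
have FE x : `|x| <= 1 -> F (b x) = v x.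
  move=> x1; rewrite /F; case: pselect => [e|]; last by case; exists x.
  by case: cid => x' [/= x'1 e']; rewrite (bi _ _ x1 x'1 e').
have FN y : (forall x, `|x| <= 1 -> y <> b x) -> F y = c.
  by move=> nP; rewrite /F; case: pselect => // -[x [x1 e]]; case: (nP x x1).
exists F; split=> //; apply/continuous_closedP => C clC.
have -> : F @^-1` C = (b @` [set x | `|x| <= 1 /\ C (v x)]) `|`
    ([set _ | C c] `&` ~` (b @` [set x | `|x| < 1])).
  apply/seteqP; split=> [y /= Cy|y].
    have [[x [x1 e]]|N] := pselect (exists x, P y x).
      by left; exists x => //; split=> //; rewrite -FE // -e.
    have Ny x : `|x| <= 1 -> y <> b x by move=> x1 e; apply: N; exists x.
    right; split; first by rewrite /= -(FN y).
    by move=> [x /= x1 e]; apply: (Ny x (ltW x1)).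
  move=> [[x [x1 Cx] <-]|[Cc nB]]; first by rewrite /preimage /= FE.
  rewrite /preimage /=; have [[x [x1 e]]|N] := pselect (exists x, P y x).
    rewrite e FE // vc //; apply/eqP; rewrite eq_le x1 leNgt; apply/negP => xlt.
    by apply: nB; exists x.
  by rewrite FN // => x x1 e; apply: N; exists x.
apply: closedU.
  apply: cell_closed_image => //; last by move=> x [].
  have -> : [set x | `|x| <= 1 /\ C (v x)] = [set x | `|x| <= 1] `&` v @^-1` C by [].
  apply: closedI; last by apply: preimage_closed => // x _; exact: cv.
  apply: compact_closed; [exact: norm_hausdorff|exact: compact_unit_ball].
apply: closedI; last exact: open_closedC.
have [Cc|nCc] := pselect (C c).
  by rewrite (_ : [set _ | _] = setT) //; apply/seteqP; split.
by rewrite (_ : [set _ | _] = set0) //; [exact: closed0|apply/seteqP; split].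
Qed.

(** Homeomorphisms of the closed unit ball that fix the sphere. Bijectivity is
    asked on the ball alone; continuity of the inverse comes from compactness. *)
Definition ball_homeo (u : rV -> rV) := [/\ continuous u,
  forall x, `|x| <= 1 -> `|u x| <= 1,
  forall x x', `|x| <= 1 -> `|x'| <= 1 -> u x = u x' -> x = x',
  forall y, `|y| <= 1 -> exists2 x, `|x| <= 1 & u x = y &
  forall x, `|x| = 1 -> u x = x].

(** The homeomorphisms [u i] fix the spheres, so that they can be extended by
    the identity outside the cells. Continuity is read on preimages of closed
    sets, as in [cell_extend]. *)
Lemma cells_map Y (I : finType) (b : I -> rV -> Y) (u : I -> rV -> rV) :
  compact [set: Y] -> hausdorff_space Y ->
  (forall i, cell (b i)) -> (forall i, ball_homeo (u i)) ->
  (forall i j x x', `|x| <= 1 -> `|x'| <= 1 -> b i x = b j x' -> i = j) ->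
  exists g : Y -> Y, [/\ homeomorphism g,
    forall i x, `|x| <= 1 -> g (b i x) = b i (u i x) &
    forall y, (forall i x, `|x| <= 1 -> y <> b i x) -> g y = y].
Proof.
move=> cY hY cb hu dis.
pose P y (p : I * rV) := `|p.2| <= 1 /\ y = b p.1 p.2.
pose g y := match pselect (exists p, P y p) with
  | left e => let p := projT1 (cid e) in b p.1 (u p.1 p.2) | right _ => y end.
have gE i x : `|x| <= 1 -> g (b i x) = b i (u i x).
  move=> x1; rewrite /g; case: pselect => [e|]; last by case; exists (i, x).
  case: cid => -[j x'] [/= x'1 e'] /=.
  have ij := dis _ _ _ _ x1 x'1 e'; move: e'; rewrite -ij => e'.
  by have [_ bi _] := cb i; rewrite (bi _ _ x1 x'1 e').
have gN y : (forall i x, `|x| <= 1 -> y <> b i x) -> g y = y.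
  move=> nP; rewrite /g; case: pselect => // -[[i x] [/= x1 e]].
  by case: (nP i x x1).
have dec y : (exists i x, `|x| <= 1 /\ y = b i x) \/
    (forall i x, `|x| <= 1 -> y <> b i x).
  case: (pselect (exists i x, `|x| <= 1 /\ y = b i x)); first by left.
  by move=> N; right=> i x x1 e; apply: N; exists i, x.
exists g; split=> //; apply: bijective_homeomorphism => //.
- apply/continuous_closedP => C clC.
  have -> : g @^-1` C =
    (\bigcup_(i in [set: I]) b i @` [set x | `|x| <= 1 /\ C (b i (u i x))]) `|`
    (C `&` ~` \bigcup_(i in [set: I]) b i @` [set x | `|x| < 1]).
    apply/seteqP; split=> [y /= Cgy|y].
      case: (dec y) => [[i [x [x1 ey]]]|Ny].
        by left; exists i => //; exists x => //; split=> //; rewrite -gE // -ey.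
      right; split; first by rewrite -(gN y).
      by move=> [i _ [x /= x1 ey]]; apply: (Ny i x); rewrite ?ltW.
    move=> [[i _ [x [x1 Cx] <-]]|[Cy nB]]; first by rewrite /preimage /= gE.
    rewrite /preimage /=; case: (dec y) => [[i [x [x1 ey]]]|Ny]; last by rewrite gN.
    have x1' : `|x| = 1.
      apply/eqP; rewrite eq_le x1 leNgt; apply/negP => xlt.
      by apply: nB; exists i => //; exists x.
    by rewrite ey gE //; have [_ _ _ _ ->] := hu i => //; rewrite -ey.
  apply: closedU; last first.
    apply: closedI => //; apply: open_closedC; apply: bigcup_open => i _.
    by have [] := cb i.
  apply: closed_bigcup; first exact: finite_finset.
  move=> i _; have [cbi _ _] := cb i.
  apply: cell_closed_image => //; last by move=> x [].
  have [cu _ _ _ _] := hu i.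
  have -> : [set x | `|x| <= 1 /\ C (b i (u i x))] =
     [set x | `|x| <= 1] `&` (b i \o u i) @^-1` C by [].
  apply: closedI.
    apply: compact_closed; [exact: norm_hausdorff|exact: compact_unit_ball].
  apply: preimage_closed => // x _.
  by apply: continuous_comp; [exact: cu|exact: cbi].
- move=> y y'; case: (dec y) => [[i [x [x1 ->]]]|Ny];
    case: (dec y') => [[j [x' [x'1 ->]]]|Ny'].
  + rewrite !gE // => e.
    have [_ ub ui _ _] := hu i; have [_ ub' _ _ _] := hu j.
    have ij := dis _ _ _ _ (ub _ x1) (ub' _ x'1) e.
    rewrite -ij in e *; have [_ bi _] := cb i.
    have /= ub2 := ub x' x'1.
    by rewrite (ui x x') //; apply: bi => //; exact: ub.
  + rewrite gE // (gN _ Ny') => e; have [_ ub _ _ _] := hu i.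
    by case: (Ny' i (u i x)) => //; exact: ub.
  + rewrite (gN _ Ny) gE // => e; have [_ ub _ _ _] := hu j.
    by case: (Ny j (u j x')) => //; exact: ub.
  + by rewrite !gN.
- move=> y; case: (dec y) => [[i [x [x1 ->]]]|Ny]; last by exists y; rewrite gN.
  have [_ _ _ us _] := hu i; have [x' x'1 <-] := us x x1.
  by exists (b i x'); rewrite gE.
Qed.

(** The cone map that moves the apex of the cone over the sphere from 0 to [v]:
    [u x = x + (1 - |x|) v]. It differs from the identity by a map of Lipschitz
    constant [|v| < 1], which makes it injective; a preimage of [y] is found by
    the intermediate value theorem applied to the norm [s] of this preimage. *)
Lemma ball_homeo_push (v : rV) : `|v| < 1 ->
  exists u, [/\ ball_homeo u & u 0 = v].
Proof.
move=> v1; pose u (x : rV) := x + Num.max 0 (1 - `|x|) *: v.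
have uE x : `|x| <= 1 -> u x = x + (1 - `|x|) *: v.
  by move=> x1; rewrite /u max_r // subr_ge0.
exists u; split; last first.
  by rewrite uE normr0 ?ler01 // subr0 scale1r add0r.
split.
- apply: ctsD; first exact: cts_id.
  apply: ctsZ; last exact: cts_cst.
  apply: cts_max; first exact: cts_cst.
  by apply: ctsB; [exact: cts_cst|apply: cts_norm; exact: cts_id].
- move=> x x1; rewrite uE // (le_trans (ler_normD _ _)) // normrZ.
  have h : 0 <= 1 - `|x| by rewrite subr_ge0.
  rewrite (ger0_norm h); have := normr_ge0 v; nra.
- move=> x x' x1 x'1; rewrite !uE // => e.
  have e1 : x - x' = (`|x| - `|x'|) *: v.
    have : x - x' = (1 - `|x'|) *: v - (1 - `|x|) *: v.
      by apply/eqP; rewrite subr_eq addrAC eq_sym subr_eq addrC -e addrC.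
    by move=> ->; rewrite -scalerBl; congr (_ *: _); lra.
  have e2 : `|x - x'| <= `|x - x'| * `|v|.
    rewrite {1}e1 normrZ; apply: ler_wpM2r => //; exact: ler_dist_dist.
  have : `|x - x'| <= 0 by have := normr_ge0 (x - x'); nra.
  by rewrite normr_le0 subr_eq0 => /eqP.
- move=> y y1; pose f (s : R) := `|y - (1 - s) *: v| - s.
  have cf : {within `[0, 1], continuous f}.
    apply: continuous_subspaceT; apply: ctsB; last exact: cts_id.
    apply: cts_norm; apply: ctsB; first exact: cts_cst.
    apply: ctsZ; last exact: cts_cst.
    by apply: ctsB; [exact: cts_cst|exact: cts_id].
  have f0 : 0 <= f 0 by rewrite /f subr0.
  have f1 : f 1 <= 0 by rewrite /f subrr scale0r subr0 subr_le0.
  have [s] := @IVT R f 0 1 0 ler01 cf (ltac:(by rewrite ge_min le_max f0 f1 orbT)).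
  rewrite in_itv /= => /andP[s0 s1] /eqP; rewrite subr_eq0 => /eqP es.
  exists (y - (1 - s) *: v); first by rewrite es.
  by rewrite uE es // subrK.
- by move=> x x1; rewrite uE x1 // subrr scale0r addr0.
Qed.

(** The radial map [u x = |x|^k x] for large [k]. *)
Lemma ball_homeo_shrink (e : R) : 0 < e ->
  exists u, [/\ ball_homeo u, u 0 = 0 & forall x, `|x| <= 2^-1 -> `|u x| < e].
Proof.
move=> e0.
have [k ke] : exists k : nat, (2^-1 : R) ^+ k.+1 < e.
  have [k _ hk] := @cvg_expr R (2^-1) (ltac:(rewrite ger0_norm; lra)) _
    (nbhsx_ballx (0 : R) e e0).
  exists k; have := hk k.+1 (leqnSn k); rewrite /ball /= sub0r normrN ger0_norm //.
pose u (x : rV) := `|x| ^+ k *: x.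
have nu x : `|u x| = `|x| ^+ k.+1.
  by rewrite /u normrZ ger0_norm ?exprn_ge0 // exprSr.
exists u; split; last 1 first.
- move=> x xh; rewrite nu; apply: le_lt_trans ke.
  by rewrite lerXn2r // nnegrE.
- split.
  + by apply: ctsZ; [apply: ctsX; apply: cts_norm|]; exact: cts_id.
  + by move=> x x1; rewrite nu exprn_ile1.
  + move=> x x' x1 x'1 eu.
    have en : `|x| = `|x'|.
      have : `|u x| = `|u x'| by rewrite eu.
      rewrite !nu => /eqP; rewrite eqrXn2 // => /eqP //.
    move: eu; rewrite /u en; have [x'0|x'0] := eqVneq `|x'| 0.
      move: en; rewrite x'0 => /eqP; rewrite normr_eq0 => /eqP ->.
      by move/eqP: x'0; rewrite normr_eq0 => /eqP ->.
    by apply: scalerI; rewrite expf_neq0.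
  + move=> y y1; have [y0|y0] := eqVneq y 0.
      by exists 0; rewrite ?normr0 // /u scaler0 y0.
    have ny : 0 < `|y| by rewrite normr_gt0.
    have cf : {within `[0, 1], continuous (fun r : R => r ^+ k.+1)}.
      by apply: continuous_subspaceT => s; exact: exprn_continuous.
    have [] := @IVT R _ 0 1 `|y| ler01 cf.
      by rewrite ge_min le_max expr1n expr0n /= normr_ge0 y1 orbT.
    move=> r; rewrite in_itv /= => /andP[r0 r1] er.
    have r_gt0 : 0 < r.
      by rewrite lt_neqAle r0 andbT; apply/eqP => h; move: er ny;
        rewrite -h expr0n /= => <-; rewrite ltxx.
    have nx : `|(r / `|y|) *: y| = r.
      by rewrite normrZ ger0_norm ?divr_ge0 // divfK // gt_eqF.
    exists ((r / `|y|) *: y); first by rewrite nx.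
    rewrite /u nx scalerA mulrA -exprSr er divff ?scale1r //.
    by rewrite gt_eqF.
  + by move=> x x1; rewrite /u x1 expr1n scale1r.
- by rewrite /u scaler0.
Qed.

End Cells.

(** * Homeomorphisms commuting with a periodic map *)

Section Equivariant.
Variables (R : realType) (m : nat) (Y : topologicalType) (q : nat).
Variable rho : Y -> Y.
Hypotheses (cY : compact [set: Y]) (hY : hausdorff_space Y) (q_gt0 : (0 < q)%N).
Hypotheses (rho_cont : continuous rho) (rhoq : forall y, iter q rho y = y).
Hypothesis rho_free : forall k y, iter k rho y = y -> (q %| k)%N.
Local Notation rV := 'rV[R]_m.

Lemma iter_rho_mul k y : iter (k * q) rho y = y.
Proof. by elim: k => // k IH; rewrite mulSn iterD rhoq. Qed.

Lemma iter_rho_mod k y : iter k rho y = iter (k %% q) rho y.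
Proof. by rewrite {1}(divn_eq k q) addnC iterD iter_rho_mul. Qed.

Lemma iter_rho_cont k : continuous (iter k rho).
Proof.
elim: k => [|k IH]; first exact: cts_id.
exact: (@cts_comp _ _ _ rho (iter k rho)).
Qed.

Lemma iter_rho_unshift k y : iter (k * q.-1) rho (iter k rho y) = y.
Proof. by rewrite -iterD -{2}(muln1 k) -mulnDr addn1 prednK // iter_rho_mul. Qed.

Lemma homeomorphism_iter_rho k : homeomorphism (iter k rho).
Proof.
split; first exact: iter_rho_cont.
exists (iter (k * q.-1) rho); split; first exact: iter_rho_cont.
  exact: iter_rho_unshift.
by move=> y; rewrite -iterD addnC iterD iter_rho_unshift.
Qed.

Definition equivariant_homeo g :=
  homeomorphism g /\ forall y, g (rho y) = rho (g y).

Lemma equivariant_homeo_iter g k y : equivariant_homeo g ->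
  g (iter k rho y) = iter k rho (g y).
Proof. by move=> [_ gr]; elim: k => //= k IH; rewrite gr IH. Qed.

Lemma equivariant_homeo_id : equivariant_homeo id.
Proof. by split=> //; exact: homeomorphism_id. Qed.

Lemma equivariant_homeo_comp f g :
  equivariant_homeo f -> equivariant_homeo g -> equivariant_homeo (g \o f).
Proof.
move=> [hf fr] [hg gr]; split; first exact: homeomorphism_comp.
by move=> y /=; rewrite fr gr.
Qed.

Lemma equivariant_homeo_inverse g : equivariant_homeo g ->
  exists g', [/\ equivariant_homeo g', cancel g g' & cancel g' g].
Proof.
move=> [[cg [g' [cg' gK g'K]]] gr]; exists g'; split=> //; split.
  by split=> //; exists g.
by move=> y; rewrite -{1}(g'K y) -gr gK.
Qed.

(** The closed cells and all their translates by powers of [rho] are pairwise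
    disjoint; the case [i = j] separates the translates of a single cell. *)
Definition rho_disjoint (J : Type) (b : J -> rV -> Y) :=
  forall i j k x x', `|x| <= 1 -> `|x'| <= 1 ->
    iter k rho (b i x) = b j x' -> i = j /\ (q %| k)%N.

(** Using the same ball homeomorphism on all translates of a cell makes the
    homeomorphism of [cells_map] commute with [rho]. *)
Lemma equivariant_cells_map (J : finType) (b : J -> rV -> Y)
    (u : J -> rV -> rV) :
  (forall i, cell (b i)) -> (forall i, ball_homeo (u i)) -> rho_disjoint b ->
  exists g, [/\ equivariant_homeo g,
    forall i x, `|x| <= 1 -> g (b i x) = b i (u i x) &
    forall y, (forall i k x, `|x| <= 1 -> y <> iter k rho (b i x)) -> g y = y].
Proof.
move=> cb hu dis.
have dis' (i j : J * 'I_q) (x x' : rV) : `|x| <= 1 -> `|x'| <= 1 ->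
    iter i.2 rho (b i.1 x) = iter j.2 rho (b j.1 x') -> i = j.
  case: i j => [i k] [j l] /= x1 x'1 e.
  have : iter (q - l + k) rho (b i x) = b j x'.
    by rewrite iterD e -iterD subnK ?rhoq // ltnW.
  move=> /dis -/(_ x1 x'1) [-> qd]; congr pair; apply: val_inj => /=.
  have := ltn_ord k; have := ltn_ord l => lq kq.
  case/dvdnP: qd => c hc; have c1 : c = 1%N by nia.
  by move: hc; rewrite c1; lia.
have [g [hg gE gN]] := cells_map (b := fun i : J * 'I_q => fun x => iter i.2 rho (b i.1 x))
  (u := fun i => u i.1) cY hY 
  (fun i => cell_homeomorphism (homeomorphism_iter_rho i.2) (cb i.1)) (fun i => hu i.1) dis'.
have gE' i k x : `|x| <= 1 -> g (iter k rho (b i x)) = iter k rho (b i (u i x)).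
  move=> x1; rewrite (iter_rho_mod k) (iter_rho_mod k (b i (u i x))).
  exact: (gE (i, Ordinal (ltn_pmod k q_gt0)) x x1).
have gN' y : (forall i k x, `|x| <= 1 -> y <> iter k rho (b i x)) -> g y = y.
  by move=> Ny; apply: gN => -[i k] x x1; exact: Ny.
exists g; split=> //; last by move=> i x x1; exact: (gE' i 0 x x1).
split=> // y.
case: (pselect (exists i k x, `|x| <= 1 /\ y = iter k rho (b i x))).
  by move=> [i [k [x [x1 ->]]]]; rewrite -iterS !gE'.
move=> N; rewrite !gN' // => i k x x1 e.
- by apply: N; exists i, k, x.
- apply: N; exists i, (q.-1 + k)%N, x; split=> //.
  by rewrite iterD -e -iterSr prednK.
Qed.

(** For each of the finitely many exponents [k < q], the condition
    [iter k rho y <> y'] is open in [(y, y')]. *)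
Lemma rho_separated_nbhs (z : Y) : exists2 O, nbhs z O &
  forall y y' k, O y -> O y' -> iter k rho y = y' -> (q %| k)%N.
Proof.
have H : \forall p \near (z, z), forall k : 'I_q,
    iter k rho p.1 = p.2 -> (q %| k)%N.
  apply: (@filter_forall _ 'I_q
    (fun k : 'I_q => [set p : Y * Y | iter k rho p.1 = p.2 -> (q %| k)%N]) _ (nbhs_filter (z, z))) => k.
  have [e|ne] := pselect (iter k rho z = z).
    by apply: nearW => p _; exact: rho_free e.
  have : open (~` [set p : Y * Y | iter k rho p.1 = p.2]).
    apply: closed_openC; apply: closed_eq_fun => //.
      by apply: (cts_comp (@iter_rho_cont k)); apply: cts_fst; exact: cts_id.
    by apply: cts_snd; exact: cts_id.
  move=> oC; have := open_nbhs_nbhs (conj oC ne : open_nbhs (z, z) _).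
  by apply: filterS => p np e; case: (np e).
case: H => -[U V] /= [zU zV] UV; exists (U `&` V); first exact: filterI.
move=> y y' k [Uy _] [_ Vy']; rewrite iter_rho_mod => e.
by have := UV (y, y') (conj Uy Vy') (Ordinal (ltn_pmod k q_gt0)) e;
  rewrite /= /dvdn modn_mod.
Qed.

Hypothesis has_cells : forall (p : Y) (O : set Y), nbhs p O ->
  exists b : rV -> Y, [/\ cell b, b 0 = p & forall x, `|x| <= 1 -> O (b x)].

Definition rho_orbits (F : seq Y) : set Y :=
  [set y | exists2 f, f \in F & exists k, y = iter k rho f].

Lemma closed_rho_orbits F : closed (rho_orbits F).
Proof.
have -> : rho_orbits F =
    \bigcup_(p in [set p : Y * 'I_q | p.1 \in F]) [set iter p.2 rho p.1].
  apply/seteqP; split=> y.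
    move=> [f fF [k ->]]; exists (f, Ordinal (ltn_pmod k q_gt0)) => //=.
    by rewrite -iter_rho_mod.
  by move=> [[f k] /= fF ->]; exists f => //; exists k.
apply: closed_bigcup => [|p _].
  apply: (@sub_finite_set _ _ ([set` F] `*` [set: 'I_q])); first by move=> [f k].
  by apply: finite_setX; [exact: finite_seq|exact: finite_finset].
exact/accessible_closed_set1/hausdorff_accessible.
Qed.

(** A small cell centred at [z] is disjoint from its translates and from the
    orbits of [F]; a push inside this cell moves [z] to any point of the open
    cell. *)
Lemma local_move z F : ~ rho_orbits F z -> exists O, [/\ open O, O z,
  forall y, O y -> ~ rho_orbits F y &
  forall y, O y -> exists g g', [/\ equivariant_homeo g, equivariant_homeo g',
    forall f, f \in F -> g f = f /\ g' f = f & g z = y /\ g' y = z]].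
Proof.
move=> zF; have [W zW sep] := rho_separated_nbhs z.
have zF' : nbhs z (~` rho_orbits F).
  by apply: open_nbhs_nbhs; split=> //; apply: closed_openC; exact: closed_rho_orbits.
have [b [cb bz bO]] := has_cells (filterI zW zF').
exists (b @` [set x | `|x| < 1]); split.
- by have [] := cb.
- by exists 0; rewrite //= normr0.
- by move=> _ [x /= x1 <-]; have [_] := bO x (ltW x1).
move=> _ [v /= v1 <-]; have [u [hu u0]] := ball_homeo_push v1.
have dis : rho_disjoint (fun _ : unit => b).
  move=> [] [] k x x' x1 x'1 e; split=> //; apply: sep e.
    by have [] := bO _ x1.
  by have [] := bO _ x'1.
have [g [hg gE gN]] := equivariant_cells_map (fun _ => cb) (fun _ => hu) dis.
have [g' [hg' gK g'K]] := equivariant_homeo_inverse hg.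
have gb : g z = b v by rewrite -bz (gE tt) ?u0 // normr0.
have gF f : f \in F -> g f = f.
  move=> fF; apply: gN => _ k x x1 e; have [_] := bO x x1; apply.
  exists f => //; exists (k * q.-1)%N; by rewrite e iter_rho_unshift.
exists g, g'; split=> //; last by rewrite -gb gK.
by move=> f fF; split; [exact: gF|rewrite -{1}(gF f fF) gK].
Qed.

Hypothesis Y_connected : connected [set: Y].

(** By induction on the list. Once the points of [ps], already moved to [F],
    lie in [V], consider the points that can be brought into [V] while keeping
    [F] in [V]. Together with the orbits of [F], they form a set that is open and
    closed: away from the orbits of [F] by [local_move], and near these orbits
    because they already lie in [V]. So connectedness of [Y] concludes even in
    dimension one, where removing the orbits of [F] may disconnect [Y]. *)
Lemma move_points (V : set Y) (ps : seq Y) : open V -> V !=set0 ->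
  (forall y, V y -> V (rho y)) ->
  {in ps &, forall p p' k, iter k rho p = p' -> p = p'} ->
  exists2 g, equivariant_homeo g & forall p, p \in ps -> V (g p).
Proof.
move=> oV V0 rhoV; elim: ps => [|p ps IH] dis.
  by exists id => //; exact: equivariant_homeo_id.
have [|g0 hg0 g0V] := IH.
  by move=> a a' aps a'ps; apply: dis; rewrite inE ?aps ?a'ps orbT.
pose F := map g0 ps.
have FV f : f \in F -> V f by move=> /mapP[a aps ->]; exact: g0V.
have iV k y : V y -> V (iter k rho y) by elim: k => //= k IHk /IHk; exact: rhoV.
(* the points that can be brought into [V] while [F] stays in [V] *)
pose B := [set z | exists g, [/\ equivariant_homeo g,
  forall f, f \in F -> V (g f) & V (g z)]].
pose A := rho_orbits F `|` B.
have VB : V `<=` B by move=> z Vz; exists id; split=> //; exact: equivariant_homeo_id.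
have FV' : rho_orbits F `<=` V by move=> _ [f fF [k ->]]; exact/iV/FV.
have oA : open A.
  rewrite openE => z Az; have [zF|zF] := pselect (rho_orbits F z).
    apply: (filterS (P := V)); first by move=> y /VB; right.
    by apply: open_nbhs_nbhs; split=> //; exact: FV'.
  case: Az => // -[g [hg gF gz]]; have [W [oO Oz _ mv]] := local_move zF.
  apply: (filterS (P := W)); last exact: open_nbhs_nbhs.
  move=> y /mv [h [h' [_ hh' hF [_ h'y]]]]; right; exists (g \o h').
  split; first exact: equivariant_homeo_comp.
    by move=> f fF /=; have [_ ->] := hF f fF; exact: gF.
  by rewrite /= h'y.
have clA : closed A.
  move=> z clz; have [zF|zF] := pselect (rho_orbits F z); first by left.
  have [W [oO Oz OF mv]] := local_move zF; right.
  have [y [Ay Oy]] := clz W (open_nbhs_nbhs (conj oO Oz)).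
  case: Ay => [/(OF y Oy) //|[g [hg gF gy]]].
  have [h [h' [hh _ hF [hz _]]]] := mv y Oy; exists (g \o h).
  split; first exact: equivariant_homeo_comp.
    by move=> f fF /=; have [-> _] := hF f fF; exact: gF.
  by rewrite /= hz.
have AT : A = [set: Y].
  apply: Y_connected.
  - by have [y Vy] := V0; exists y; right; exact: VB.
  - by exists A => //; rewrite setTI.
  - by exists A => //; rewrite setTI.
have : A (g0 p) by rewrite AT.
case=> [[f /mapP[a aps ->] [k e]]|[g [hg gF gz]]].
  exists g0 => // p'; rewrite inE => /orP[/eqP ->|]; last exact: g0V.
  suff <- : a = p by exact: g0V.
  apply: (dis a p _ _ k); rewrite ?inE ?eqxx ?aps ?orbT //.
  have [g1 [_ g0K _]] := equivariant_homeo_inverse hg0.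
  by apply: (can_inj g0K); rewrite equivariant_homeo_iter.
exists (g \o g0); first exact: equivariant_homeo_comp.
by move=> p'; rewrite inE => /orP[/eqP -> //|p's]; apply: gF; apply: map_f.
Qed.

(** The centres are moved into [V] by [g2]; beforehand, the half cells are
    shrunk by [g1] so close to the centres that [g2] takes them into [V]. *)
Lemma push_cells (V : set Y) (J : finType) (b : J -> rV -> Y) :
  open V -> V !=set0 -> (forall y, V y -> V (rho y)) ->
  (forall j, cell (b j)) -> rho_disjoint b ->
  exists2 g, equivariant_homeo g & forall j x, `|x| <= 2^-1 -> V (g (b j x)).
Proof.
move=> oV V0 rhoV cb dis.
have [|g2 hg2 g2V] := @move_points V [seq b j 0 | j <- enum J] oV V0 rhoV.
  move=> _ _ /mapP[i _ ->] /mapP[j _ ->] k /dis; rewrite normr0.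
  by move=> /(_ ler01 ler01) [->].
have ex j : exists e : R, 0 < e /\ forall x, `|x| < e -> V (g2 (b j x)).
  have : nbhs (0 : rV) ((fun x => g2 (b j x)) @^-1` V).
    apply: nbhs_preimage.
      by apply: cts_comp; [have [[]] := hg2|have [] := cb j].
    apply: open_nbhs_nbhs; split=> //; apply: g2V; apply/mapP.
    by exists j => //; rewrite mem_enum.
  move=> /nbhs_normP [e /= e0 he]; exists e; split=> // x xe; apply: he.
  by rewrite /= sub0r normrN.
have exu j : exists u : rV -> rV, ball_homeo u /\
    forall x, `|x| <= 2^-1 -> V (g2 (b j (u x))).
  have [e [e0 he]] := ex j; have [u [hu _ ue]] := ball_homeo_shrink m e0.
  by exists u; split=> // x /ue; exact: he.
pose u j := projT1 (cid (exu j)).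
have hu j : ball_homeo (u j) by rewrite /u; case: cid => ? [].
have uV j x : `|x| <= 2^-1 -> V (g2 (b j (u j x))).
  move=> xh; rewrite /u; case: cid => v [_ hv] /=; exact: hv.
have [g1 [hg1 g1E _]] := equivariant_cells_map cb hu dis.
exists (g2 \o g1); first exact: equivariant_homeo_comp.
move=> j x xh /=; have x1 : `|x| <= 1 by apply: (le_trans xh); lra.
by rewrite g1E //; exact: uV.
Qed.

End Equivariant.

(** * Flows of period one and their local slices *)

(** A free action of the circle, seen as a flow with period 1: the stabilizers
    are exactly the integers. *)
Definition circle_flow (R : realType) (Y : topologicalType) (phi : R -> Y -> Y) :=
  [/\ continuous (fun p : R * Y => phi p.1 p.2),
    forall s t y, phi (s + t) y = phi s (phi t y),
    forall y, phi 1 y = y &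
    forall t y, phi t y = y -> exists k : int, t = k%:~R].

Section Flow.
Variables (R : realType) (Y : topologicalType) (phi : R -> Y -> Y).
Hypothesis flow : circle_flow phi.

Lemma flowD s t y : phi (s + t) y = phi s (phi t y).
Proof. by have [_ + _ _] := flow; apply. Qed.

Lemma flow0 y : phi 0 y = y.
Proof.
have [_ _ f1 _] := flow.
by rewrite -{1}(f1 y) -flowD add0r f1.
Qed.

Lemma flowNK t : cancel (phi (- t)) (phi t).
Proof. by move=> y; rewrite -flowD subrr flow0. Qed.

Lemma flowKN t : cancel (phi t) (phi (- t)).
Proof. by move=> y; rewrite -flowD addNr flow0. Qed.

Lemma flow_int (k : int) y : phi k%:~R y = y.
Proof.
have [_ _ f1 _] := flow.
have fn (n : nat) : phi n%:R y = y.
  by elim: n => [|n IH]; rewrite ?flow0 // -natr1 flowD f1.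
case: k => n; first exact: fn.
by rewrite NegzE mulrNz -{1}(fn n.+1) flowKN.
Qed.

Lemma flow_cont2 (T : topologicalType) (f : T -> R) (g : T -> Y) :
  continuous f -> continuous g -> continuous (fun x => phi (f x) (g x)).
Proof.
move=> cf cg; have [cphi _ _ _] := flow.
exact: (@cts_comp _ _ _ (fun p : R * Y => phi p.1 p.2) _ cphi (cts_pair cf cg)).
Qed.

Lemma flow_cont t : continuous (phi t).
Proof. by apply: flow_cont2; [exact: cts_cst|exact: cts_id]. Qed.

Lemma homeomorphism_flow t : homeomorphism (phi t).
Proof.
split; first exact: flow_cont.
by exists (phi (- t)); split; [exact: flow_cont|exact: flowKN|exact: flowNK].
Qed.

Lemma flow_inv (s : R) y : phi s y = y -> exists k : int, s = k%:~R.
Proof. by have [_ _ _ ff] := flow; exact: ff. Qed.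

Lemma flow_iter (r : R) k y : iter k (phi r) y = phi (r *+ k) y.
Proof.
by elim: k => [|k IH]; rewrite ?mulr0n ?flow0 //= IH -flowD -mulrS.
Qed.

(** No time in the compact interval [[e, 1 - e]] brings [y0] back to itself,
    hence none makes a small neighbourhood of [y0] meet itself. *)
Lemma flow_separated_nbhs (e : R) (y0 : Y) : hausdorff_space Y -> 0 < e -> e < 2^-1 ->
  exists2 U, nbhs y0 U & forall y v, U y -> U (phi v y) ->
    exists k : int, `|v - k%:~R| < e.
Proof.
move=> hY e0 e2.
have [] := (compact_near_coveringP _).1 (@segment_compact R e (1 - e)) (Y * Y)%type
  (nbhs (y0, y0)) (fun p v => phi v p.1 <> p.2) (nbhs_filter (y0, y0)).
  move=> v; rewrite /= in_itv /= => /andP[v1 v2].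
  have oC : open (~` [set p : R * (Y * Y) | phi p.1 p.2.1 = p.2.2]).
    apply: closed_openC; apply: closed_eq_fun => //.
      apply: flow_cont2; first by apply: cts_fst; exact: cts_id.
      by do 2 (apply: cts_fst || apply: cts_snd); exact: cts_id.
    by do 2 apply: cts_snd; exact: cts_id.
  have ne : (~` [set p : R * (Y * Y) | phi p.1 p.2.1 = p.2.2]) (v, (y0, y0)).
    move=> /= /flow_inv [k ek]; move: v1 v2; rewrite ek => v1 v2.
    have k0 : (0 < k%:~R :> R) by lra.
    have k1 : (k%:~R < 1 :> R) by lra.
    by move: k0 k1; rewrite ltr0z ltrz1; lia.
  exact: open_nbhs_nbhs (conj oC ne).
move=> [U V] /= [zU zV] UV; exists (U `&` V); first exact: filterI.
move=> y v [Uy _] [_ Vv].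
have v0 := ge_floor v; have v1 := floorD1_gt v.
set k := Num.floor v in v0 v1.
have [h|h] := ltP (v - k%:~R) e.
  by exists k; rewrite ger0_norm ?subr_ge0.
have [h'|h'] := ltP (1 - e) (v - k%:~R).
  by exists (k + 1); rewrite ltr0_norm ?subr_lt0 //; move: v1; rewrite intrD; lra.
exfalso; apply: (UV (y, phi v y) (conj Uy Vv) (v - k%:~R)) => /=.
  by rewrite in_itv /= h h'.
by rewrite addrC flowD -mulrNz -flowD addrC flowD flow_int.
Qed.

(** A thickened local slice: up to whole periods, two visits of an orbit to [Z]
    are less than [e] apart. *)
Definition thin (e : R) (Z : set Y) := closed Z /\ forall z s, Z z -> Z (phi s z) ->
  exists k : int, `|s - k%:~R| < e.

Variable m : nat.
Local Notation rV := 'rV[R]_m.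
Hypothesis hY : hausdorff_space Y.
Hypothesis has_cells : forall (p : Y) (O : set Y), nbhs p O ->
  exists b : rV -> Y, [/\ cell b, b 0 = p & forall x, `|x| <= 1 -> O (b x)].

(** Tropical averaging. With [M y] the maximum of [psi (phi v y) + v / 4] over
    [|v| <= 1 / 2], moving [y] by [s] shifts the window of the maximum by [s] and
    adds [- s / 4]. Since [psi] vanishes off a set that orbits visit only near
    integer times, while [psi y] is large, the ends of the window do not
    contribute to the maximum; hence [M (phi s y) = M y - s / 4] exactly, and
    [- 4 M] measures time along the orbits near the maximum of [psi]. *)
Lemma equivariant_time (psi : Y -> R) : continuous psi ->
  (forall y, 0 <= psi y) -> (forall y v, 0 < psi y -> 0 < psi (phi v y) ->
    exists k : int, `|v - k%:~R| < 8^-1) ->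
  exists tau : Y -> R, continuous tau /\ forall y s, 3 / 4 < psi y ->
    `|s| <= 4^-1 -> tau (phi s y) = tau y + s.
Proof.
move=> cpsi psi0 sep; pose g v y := psi (phi v y) + v / 4.
have cg : continuous (fun p : R * Y => g p.1 p.2).
  apply: ctsD.
    apply: (cts_comp cpsi); apply: flow_cont2; [apply: cts_fst|apply: cts_snd];
      exact: cts_id.
  by apply: ctsM; [apply: cts_fst; exact: cts_id|exact: cts_cst].
pose K : set R := `[- 2^-1, 2^-1]%classic.
have exM y : exists2 c, `|c| <= 2^-1 & forall v, `|v| <= 2^-1 -> g v y <= g c y.
  have [|||c] := @compact_EVT_max R R (fun v => g v y) K.
  - by exists 0; rewrite /K /= in_itv /=; lra.
  - exact: segment_compact.
  - apply: continuous_subspaceT.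
    apply: (@cts_comp _ _ _ (fun p : R * Y => g p.1 p.2) (fun v => (v, y)) cg).
    by apply: cts_pair; [exact: cts_id|exact: cts_cst].
  - rewrite inE /K /= in_itv /= -ler_norml => c1 cmax; exists c => // v v1.
    by apply: cmax; rewrite inE /K /= in_itv /= -ler_norml.
pose M y := g (projT1 (cid2 (exM y))) y.
have Mle v y : `|v| <= 2^-1 -> g v y <= M y.
  by rewrite /M; case: cid2 => c c1 /=; apply.
have Mex y : exists2 v, `|v| <= 2^-1 & M y = g v y.
  by rewrite /M; case: cid2 => c c1 /= _; exists c.
have cM : continuous M.
  move=> y; apply/cvgrPdist_lt => d d0.
  have : \forall y' \near y, K `<=` (fun v => `|g v y' - g v y| < d).
    apply: ((compact_near_coveringP _).1 (@segment_compact R (- 2^-1) (2^-1)) Y (nbhs y)).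
    move=> v _; pose G (p : R * Y) := `|g p.1 p.2 - g p.1 y|.
    have cG : continuous G.
      apply: cts_norm; apply: ctsB; first exact: cg.
      apply: (@cts_comp _ _ _ (fun p : R * Y => g p.1 p.2) (fun p => (p.1, y)) cg).
      by apply: cts_pair; [apply: cts_fst; exact: cts_id|exact: cts_cst].
    have oG : open [set p | G p < d] by apply: open_lt_fun => //; exact: cts_cst.
    apply: (open_nbhs_nbhs (conj oG _ : open_nbhs (v, y) _)).
    by rewrite /= /G /= subrr normr0.
  apply: filterS => y' Ky'.
  have KE v : `|v| <= 2^-1 -> `|g v y' - g v y| < d.
    by move=> v1; apply: Ky'; rewrite /K /= in_itv /= -ler_norml.
  have [v v1 ev] := Mex y; have [v' v'1 ev'] := Mex y'.
  have := Mle v y' v1; have := Mle v' y v'1; have := KE v v1; have := KE v' v'1.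
  by rewrite ev ev' !ltr_norml => /andP[? ?] /andP[? ?] ? ?; apply/andP; split; lra.
exists (fun y => - (4 * M y)); split.
  by apply: ctsN; apply: ctsM => //; exact: cts_cst.
move=> y s py s4.
(* at these times, which are far from the integers, the orbit of [y] is off the
   support of [psi] *)
have far v : 4^-1 < `|v| -> `|v| <= 3 / 4 -> psi (phi v y) = 0.
  move=> v1 v2; apply/eqP; rewrite eq_le psi0 andbT leNgt; apply/negP => pv.
  have h34 : (0 : R) < 3 / 4 by lra.
  have [k hk] := sep y v (lt_trans h34 py) pv.
  have ky : `|k%:~R : R| < 1.
    rewrite -[k%:~R](subrK v) (le_lt_trans (ler_normD _ _)) // distrC.
    by apply: le_lt_trans (lerD (ltW hk) v2) _; lra.
  have k0 : k = 0.
    by move: ky; rewrite -intr_norm -[1]/(1%:~R) ltr_int; lia.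
  by move: hk; rewrite k0 subr0; lra.
have g0 : 3 / 4 < M y.
  apply: lt_le_trans (Mle 0 y _); last by rewrite normr0; lra.
  by rewrite /g flow0 mul0r addr0.
have gs v : g v (phi s y) = g (v + s) y - s / 4.
  by rewrite /g -flowD; ring.
have E : M (phi s y) = M y - s / 4.
  apply/eqP; rewrite eq_le; apply/andP; split.
    have [v v1 ->] := Mex (phi s y); rewrite gs lerD2r.
    have [h|h] := leP `|v + s| (2^-1); first exact: Mle.
    have h2 : `|v + s| <= 3 / 4.
      by rewrite (le_trans (ler_normD _ _)) //; lra.
    apply: ltW; apply: le_lt_trans g0; rewrite /g far ?add0r; [|lra|exact: h2].
    by have := ler_norm (v + s); lra.
  have [v v1 ev] := Mex y.
  have [h|h] := leP `|v| (4^-1); last first.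
    have : M y <= v / 4 by rewrite ev /g far ?add0r //; lra.
    by have := ler_norm v; lra.
  have -> : M y - s / 4 = g (v - s) (phi s y) by rewrite gs subrK ev.
  by apply: Mle; rewrite (le_trans (ler_normB _ _)) //; lra.
by rewrite E; lra.
Qed.

(** The slice [D] is the level 0 of an equivariant time, and [Z] is this slice
    thickened. The neighbourhood [B] does not depend on [e]: a finite cover by
    such neighbourhoods can be chosen before the thickness. *)
Lemma flow_slices (y0 : Y) : exists b B, [/\ cell b, nbhs y0 B & forall e : R, 0 < e ->
  exists Z D, [/\ thin e Z, Z `<=` b @` [set x : rV | `|x| < 1], closed D,
    D `<=` Z° & forall y, B y -> exists s, D (phi s y)]].
Proof.
have [||U yU sep] := flow_separated_nbhs (e := 8^-1) y0 hY; [lra|lra|].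
have [b [cb by0 bU]] := has_cells yU.
have cnx : continuous (fun x : rV => 1 - `|x|).
  by apply: ctsB; [exact: cts_cst|apply: cts_norm; exact: cts_id].
have [|psi [cpsi psiE psiN]] := cell_extend (c := 0) hY cb cnx.
  by move=> x ->; rewrite subrr.
have psi0 y : 0 <= psi y.
  have [[x [x1 ->]]|N] := pselect (exists x, `|x| <= 1 /\ y = b x).
    by rewrite psiE // subr_ge0.
  by rewrite psiN // => x x1 e; apply: N; exists x.
have psiU y : 0 < psi y -> exists2 x, `|x| < 1 & y = b x.
  move=> py; have [[x [x1 e]]|N] := pselect (exists x, `|x| <= 1 /\ y = b x).
    by exists x => //; move: py; rewrite e psiE // subr_gt0.
  by move: py; rewrite psiN ?ltxx // => x x1 e; apply: N; exists x.
have psisep y v : 0 < psi y -> 0 < psi (phi v y) ->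
    exists k : int, `|v - k%:~R| < 8^-1.
  move=> /psiU [x x1 e] /psiU [x' x'1 e']; apply: (sep y).
    by rewrite e; apply/bU/ltW.
  by rewrite e'; apply/bU/ltW.
have [tau0 [ctau0 tau0E]] := equivariant_time cpsi psi0 psisep.
pose tau y := tau0 y - tau0 y0.
have ctau : continuous tau by apply: ctsB => //; exact: cts_cst.
have tauE y s : 3 / 4 < psi y -> `|s| <= 4^-1 -> tau (phi s y) = tau y + s.
  by move=> p1 s1; rewrite /tau tau0E //; ring.
have psiy0 : psi y0 = 1 by rewrite -by0 psiE normr0 ?ler01 // subr0.
pose B := [set y | [/\ 3 / 4 < psi y, `|tau y| < 4^-1 &
  15 / 16 < psi (phi (- tau y) y)]].
exists b, B; split=> //.
  have oB : open B.
    have -> : B = [set y | 3 / 4 < psi y] `&` [set y | `|tau y| < 4^-1] `&`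
        [set y | 15 / 16 < psi (phi (- tau y) y)].
      by apply/seteqP; split=> y; [move=> []|move=> [[]]].
    have cc := @cts_cst Y R.
    apply: openI; first apply: openI; apply: open_lt_fun => //.
      exact: cts_norm.
    by apply: (cts_comp cpsi); apply: flow_cont2; [exact: ctsN|exact: cts_id].
  apply: open_nbhs_nbhs; split=> //.
  have tau00 : tau y0 = 0 by rewrite /tau subrr.
  by rewrite /B /= tau00 normr0 oppr0 flow0 // psiy0; split; lra.
move=> e e0; pose d := Num.min (e / 4) (16^-1).
have d0 : 0 < d by rewrite lt_min; apply/andP; split; lra.
have de : d <= e / 4 by rewrite ge_min lexx.
exists ([set y | 7 / 8 <= psi y] `&` [set y | `|tau y| <= d]).
exists ([set y | 15 / 16 <= psi y] `&` [set y | `|tau y| <= 0]); split.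
- split.
    apply: closedI; apply: closed_le_fun => //; try exact: cts_cst.
    exact: cts_norm.
  move=> z s [/= z1 z2] [/= s1 s2].
  have [||k hk] := psisep z s; [lra|lra|exists k].
  have E1 : phi (s - k%:~R) z = phi s z by rewrite flowD // -mulrNz flow_int.
  have tE : tau (phi s z) = tau z + (s - k%:~R) by rewrite -E1 tauE //; lra.
  have -> : s - k%:~R = tau (phi s z) - tau z by rewrite tE; ring.
  by rewrite (le_lt_trans (ler_normB _ _)) //; lra.
- by move=> y [/= y1 _]; have [|x x1 ->] := psiU y; [lra|exists x].
- apply: closedI; apply: closed_le_fun => //; try exact: cts_cst.
  exact: cts_norm.
- move=> y [/= y1 y2]; rewrite interiorI; split.
    have oP : open [set y | 7 / 8 < psi y] by apply: open_lt_fun => //; exact: cts_cst.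
    apply: filterS (open_nbhs_nbhs (conj oP _ : open_nbhs y _)) => /=.
      by move=> ? /ltW.
    by lra.
  have oP : open [set y | `|tau y| < d].
    by apply: open_lt_fun; [exact: cts_norm|exact: cts_cst].
  apply: filterS (open_nbhs_nbhs (conj oP _ : open_nbhs y _)) => /=.
    by move=> ? /ltW.
  by lra.
- move=> y [y1 y2 y3]; exists (- tau y); split=> /=; first exact: ltW.
  have h : `|- tau y| <= 4^-1 by rewrite normrN ltW.
  by rewrite tauE // subrr normr0.
Qed.

End Flow.

Section Rotation.
Variables (R : realType) (Y : topologicalType) (phi : R -> Y -> Y) (q : nat).
Hypotheses (flow : circle_flow phi) (q_gt0 : (0 < q)%N).
Local Notation rho := (phi q%:R^-1).

Lemma iter_rotation k y : iter k rho y = phi (k%:R / q%:R) y.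
Proof. by rewrite flow_iter // -[_ *+ k]mulr_natl. Qed.

Lemma rotation_period y : iter q rho y = y.
Proof.
rewrite iter_rotation // divff ?pnatr_eq0 -?lt0n //.
by have [_ _ f1 _] := flow.
Qed.

Lemma rotation_free k y : iter k rho y = y -> (q %| k)%N.
Proof.
rewrite iter_rotation // => /(flow_inv flow) [l hl].
have q0 : (q%:R : R) != 0 by rewrite pnatr_eq0 -lt0n.
have : (k%:Z)%:~R = (l * q%:Z)%:~R :> R.
  by rewrite intrM -hl -!pmulrn divfK.
move=> /eqP; rewrite eqr_int => /eqP e.
have l0 : 0 <= l by nia.
by apply/dvdnP; exists `|l|%N; nia.
Qed.

End Rotation.

(** * Grids and free heights *)

Section Grids.
Variables (R : realType) (m : nat).
Local Notation rV := 'rV[R]_m.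

Lemma rV_norm_le (x : rV) (r : R) : 0 <= r ->
  (`|x| <= r) <-> (forall i, `|x 0 i| <= r).
Proof.
move=> r0; rewrite [`|x|]/Num.norm /= mx_normrE; split=> [/bigmax_leP[_ h] i|h].
  exact: (h (0, i)).
by apply/bigmax_leP; split=> // -[i j] _ /=; rewrite ord1.
Qed.

Section Grid.
Variable n : nat.
Hypothesis n_gt0 : (0 < n)%N.

Definition grid := {ffun 'I_m -> 'I_(n + n)}.

Definition grid_center (k : grid) : rV :=
  \row_i (((k i)%:R + 2^-1) / n%:R - 1).

(** Centers of distinct cubes of the same color are at least three steps apart
    in some direction, so that these cubes stay disjoint when their side is
    doubled; see [grid_color_inj]. *)
Definition grid_color (k : grid) : {ffun 'I_m -> 'I_3} :=
  [ffun i => inord (k i %% 3)].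

Lemma grid_cover (x : rV) : `|x| < 1 -> exists k, `|x - grid_center k| <= (2 * n%:R)^-1.
Proof.
move=> x1; have n0 : (0 : R) < n%:R by rewrite ltr0n.
have xi i : -1 < x 0 i < 1.
  rewrite -ltr_norml; apply: le_lt_trans x1.
  by have /rV_norm_le := lexx `|x|; apply.
have lt (i : 'I_m) : (Num.truncn (n%:R * (x 0 i + 1))%R < n + n)%N.
  have /andP[l u] := xi i.
  have g0 : 0 <= n%:R * (x 0 i + 1) by apply: mulr_ge0; [exact: ltW|lra].
  have /andP[t1 _] := truncn_itv g0.
  by rewrite -(ltr_nat R) (le_lt_trans t1) // natrD; nra.
exists [ffun i => Ordinal (lt i)]; apply/rV_norm_le; first by rewrite invr_ge0 mulr_ge0.
move=> i; rewrite !mxE ffunE /=; have /andP[l u] := xi i.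
have g0 : 0 <= n%:R * (x 0 i + 1) by apply: mulr_ge0; [exact: ltW|lra].
have := truncn_itv g0; set t := Num.truncn _ => /andP[t1]; rewrite -natr1 => t2.
have -> : x 0 i - ((t%:R + 2^-1) / n%:R - 1) =
   (n%:R * (x 0 i + 1) - t%:R - 2^-1) / n%:R by field; rewrite gt_eqF.
rewrite normrM normfV (gtr0_norm n0) ler_pdivrMr // invfM mulrAC -mulrA divff ?gt_eqF //.
by rewrite mulr1 ler_norml; apply/andP; split; lra.
Qed.

Lemma grid_color_inj k l : grid_color k = grid_color l ->
  `|grid_center k - grid_center l| <= 2 / n%:R -> k = l.
Proof.
have n0 : (0 : R) < n%:R by rewrite ltr0n.
move=> ec /rV_norm_le h; apply/ffunP => i; apply: val_inj => /=.
have := congr1 (fun f : {ffun 'I_m -> 'I_3} => val (f i)) ec.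
rewrite !ffunE /= !inordK ?ltn_mod // => em.
have := h (ltac:(by rewrite divr_ge0)) i; rewrite !mxE.
have -> : ((k i)%:R + 2^-1) / n%:R - 1 - (((l i)%:R + 2^-1) / n%:R - 1) =
  ((k i)%:Z - (l i)%:Z)%:~R / n%:R :> R.
  by rewrite intrD mulrNz -!pmulrn; field; rewrite gt_eqF.
rewrite normrM normfV (gtr0_norm n0) ler_pM2r ?invr_gt0 //.
rewrite -intr_norm -[2]/(2%:~R) ler_int; lia.
Qed.

End Grid.

End Grids.

(** There are [s + 1] slots congruent to [r] modulo [C] below [C * (s + 1)], one
    more than the slots in [F]. *)
Lemma pigeonhole_slot (N : nat) (F : {set 'I_N}) (s r C : nat) : (#|F| <= s)%N ->
  (r < C)%N -> (C * s.+1 <= N)%N ->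
  exists2 j, (r + C * j < C * s.+1)%N & forall a : 'I_N, a = r + C * j :> nat -> a \notin F.
Proof.
move=> Fs rC CN; apply: contrapT => no.
have lt (j : 'I_s.+1) : (r + C * j < C * s.+1)%N.
  by have := ltn_ord j; nia.
have ltN j := leq_trans (lt j) CN.
have inF (j : 'I_s.+1) : Ordinal (ltN j) \in F.
  apply: contrapT => nF; apply: no; exists (j : nat); first exact: lt.
  move=> a ea; apply/negP => aF; apply: nF.
  by rewrite (_ : Ordinal _ = a) //; apply: val_inj.
have finj : injective (fun j : 'I_s.+1 => Ordinal (ltN j)).
  move=> j j' [] e; apply: val_inj => /=; have C0 : (0 < C)%N by exact: leq_ltn_trans rC.
  by apply/eqP; rewrite -(eqn_pmul2l C0); apply/eqP; lia.
have cF : (s.+1 <= #|F|)%N.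
  rewrite -{1}(card_ord s.+1) -cardsT -(card_imset _ finj).
  by apply: subset_leq_card; apply/fintype.subsetP => a /imsetP[j _ ->].
by move: (leq_trans cF Fs); rewrite ltnn.
Qed.

Section Placement.
Variables (R : realType) (Y : topologicalType) (phi : R -> Y -> Y).
Variables (m q N : nat).
Hypotheses (flow : circle_flow phi) (hY : hausdorff_space Y).
Hypotheses (q_gt0 : (0 < q)%N) (N_gt0 : (0 < N)%N).
Local Notation rV := 'rV[R]_m.
Local Notation rho := (phi q%:R^-1).

(** The heights, along the orbits, at which cells are placed. They are spaced
    so that [N] of them fit in a period [1 / q]. *)
Definition slot (a : nat) : R := a%:R / (q * N)%:R.
Local Notation width := ((q * N)%:R^-1 : R).

(** Multiplied by [q N], the quantity in absolute value becomes an integer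
    smaller than 1 in absolute value. *)
Lemma slot_separated (a1 a2 : nat) (i k : int) : (a1 < N)%N -> (a2 < N)%N ->
  `|slot a2 - slot a1 + i%:~R / q%:R - k%:~R| < width ->
  a1 = a2 /\ i = q%:Z * k.
Proof.
move=> a1N a2N; set z : int := a2%:Z - a1%:Z + N%:Z * i - q%:Z * N%:Z * k.
have q0 : (q%:R : R) != 0 by rewrite pnatr_eq0 -lt0n.
have N0 : (N%:R : R) != 0 by rewrite pnatr_eq0 -lt0n.
have -> : slot a2 - slot a1 + i%:~R / q%:R - k%:~R = z%:~R * width.
  rewrite /slot /z !natrM !(intrD, mulrNz, intrM) -!pmulrn; field.
  by rewrite q0 N0.
have w0 : 0 < width by rewrite invr_gt0 ltr0n muln_gt0 q_gt0.
rewrite normrM (gtr0_norm w0) gtr_pMl // -intr_norm -[1]/(1%:~R) ltr_int => z1.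
have : z = 0 by lia.
rewrite /z => {}z1.
have c : a2%:Z - a1%:Z = N%:Z * (q%:Z * k - i) by rewrite -[LHS]subr0 -{1}z1; ring.
have d0 : q%:Z * k - i = 0 by nia.
by split; lia.
Qed.

(** Placed at height [slot a], a cell through [z], or one of its translates by
    multiples of [1 / q], would meet a piece of [Ps]. *)
Definition conflict (Ps : seq (set Y)) (a : nat) (z : Y) :=
  exists2 P, P \in Ps & exists k : 'I_q, P (phi (slot a + k%:R / q%:R) z).

(** Two conflicts of [z] with the same piece give two visits of the orbit of [z]
    to this piece, at times whose difference is an integer up to [width]; by
    [slot_separated] the two slots coincide. *)
Lemma conflict_bounded Ps z : (forall P, P \in Ps -> thin phi width P) ->
  exists F : {set 'I_N}, (#|F| <= size Ps)%N /\
    forall a : 'I_N, conflict Ps a z -> a \in F.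
Proof.
elim: Ps => [|P Ps IH] tP; first by exists finset.set0; rewrite cards0; split=> // a [].
have [|F [cF hF]] := IH; first by move=> Q QP; apply: tP; rewrite inE QP orbT.
have [[a0 [k0 h0]]|no] := pselect (exists (a : 'I_N) (k : 'I_q),
    P (phi (slot a + k%:R / q%:R) z)); last first.
  exists F; split; first exact: leqW.
  move=> a [Q]; rewrite inE => /orP[/eqP -> [k h]|QP h]; last first.
    by apply: hF; exists Q.
  by case: no; exists a, k.
exists (a0 |: F)%SET; split.
  by rewrite (leq_trans (leq_card_setU _ _)) // cards1 add1n.
move=> a [Q]; rewrite inE => /orP[/eqP -> [k h]|QP h]; last first.
  by rewrite in_setU1; apply/orP; right; apply: hF; exists Q.
rewrite in_setU1; apply/orP; left; apply/eqP.
have [_ tP'] := tP P (mem_head _ _).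
pose s := slot a - slot a0 + (k%:Z - k0%:Z)%:~R / q%:R.
have hs : P (phi s (phi (slot a0 + k0%:R / q%:R) z)).
  rewrite -flowD // (_ : s + _ = slot a + k%:R / q%:R) //.
  by rewrite /s intrD mulrNz -!pmulrn; ring.
have [l hl] := tP' _ _ h0 hs.
by apply: val_inj; have [] := slot_separated (ltn_ord a0) (ltn_ord a) hl.
Qed.

(** Pieces are closed, so conflicts do not appear under small moves of the
    point. *)
Lemma conflict_usc Ps z0 : (forall P, P \in Ps -> thin phi width P) ->
  \forall z \near z0, forall a : 'I_N, conflict Ps a z -> conflict Ps a z0.
Proof.
move=> tP; apply: (@filter_forall _ 'I_N
  (fun a : 'I_N => [set z | conflict Ps a z -> conflict Ps a z0]) _
  (nbhs_filter z0)) => a.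
have [h|nh] := pselect (conflict Ps a z0).
  by apply: filterS filterT => z _ _.
have cl : closed [set z | conflict Ps a z].
  have -> : [set z | conflict Ps a z] =
      \bigcup_(p in [set p : set Y * 'I_q | p.1 \in Ps])
        (phi (slot a + p.2%:R / q%:R) @^-1` p.1).
    apply/seteqP; split=> [z [P PP [k h']]|z [[P k] /= PP h']]; first by exists (P, k); [exact: PP|exact: h'].
    by exists P => //; exists k.
  apply: closed_bigcup => [|[P k] /= PP].
    apply: (@sub_finite_set _ _ ([set` Ps] `*` [set: 'I_q])); first by move=> [f k].
    by apply: finite_setX; [exact: finite_seq|exact: finite_finset].
  apply: preimage_closed; last by have [] := tP P PP.
  by move=> y _; exact: flow_cont.
have := open_nbhs_nbhs (conj (closed_openC cl) nh : open_nbhs z0 _).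
by apply: filterS => z nz /nz.
Qed.

(** The bound of [conflict_bounded] passes from points to small cubes by
    [conflict_usc]. Compactness of the slice makes the scale uniform. *)
Lemma fine_scale (Ps : seq (set Y)) (b : rV -> Y) (Z D : set Y) :
  (forall P, P \in Ps -> thin phi width P) -> cell b ->
  Z `<=` b @` [set x | `|x| < 1] -> closed D -> D `<=` Z° ->
  exists n : nat, (0 < n)%N /\ forall x, `|x| <= 1 -> D (b x) ->
    (forall x', `|x' - x| <= 2 / n%:R -> `|x'| < 1 /\ Z (b x')) /\
    exists F : {set 'I_N}, (#|F| <= size Ps)%N /\ forall x' (a : 'I_N),
      `|x' - x| <= 2 / n%:R -> conflict Ps a (b x') -> a \in F.
Proof.
move=> tP [cb bi ob] Zb clD DZ.
pose K := [set x : rV | `|x| <= 1] `&` b @^-1` D.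
have cK : compact K.
  apply: subclosed_compact (@compact_unit_ball R m) _ => [|x []//].
  apply: closedI; last by apply: preimage_closed => // x _; exact: cb.
  apply: closed_le_fun; last exact: cts_cst.
  by apply: cts_norm; exact: cts_id.
pose G (n : nat) (x : rV) :=
    (forall x', `|x' - x| <= 2 / n%:R -> `|x'| < 1 /\ Z (b x')) /\
    exists F : {set 'I_N}, (#|F| <= size Ps)%N /\ forall x' (a : 'I_N),
      `|x' - x| <= 2 / n%:R -> conflict Ps a (b x') -> a \in F.
have : \forall n \near \oo, K `<=` G n.
  apply: ((compact_near_coveringP _).1 cK) => x0 [/= x01 Dx0].
  have x0lt : `|x0| < 1.
    have [x x1 /esym/bi ->] : (b @` [set x | `|x| < 1]) (b x0).
      by apply: Zb; apply: nbhs_singleton; exact: DZ.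
    - exact: x1.
    - exact: x01.
    - exact: ltW.
  have [F [cF hF]] := conflict_bounded (b x0) tP.
  have nb : nbhs x0 [set x | `|x| < 1 /\ Z (b x) /\
      forall a : 'I_N, conflict Ps a (b x) -> a \in F].
    have n1 : nbhs x0 [set x : rV | `|x| < 1].
      apply: open_nbhs_nbhs; split=> //.
      apply: open_lt_fun; last exact: cts_cst.
      by apply: cts_norm; exact: cts_id.
    have n2 : nbhs x0 (b @^-1` Z) by apply: nbhs_preimage => //; exact: DZ.
    have n3 := nbhs_preimage cb (conflict_usc (b x0) tP).
    apply: filterS (filterI n1 (filterI n2 n3)) => x [h1 [h2 h3]].
    by split=> //; split=> // a /h3; exact: hF.
  have [d /= d0 hd] := (nbhs_normP _ _).1 nb.
  have hd' x : `|x - x0| < d -> [/\ `|x| < 1, Z (b x) &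
      forall a : 'I_N, conflict Ps a (b x) -> a \in F].
    by move=> xd; have [|? []] := hd x; rewrite //= distrC.
  exists ([set x | `|x - x0| < d / 2], [set n : nat | 2 / n%:R < d / 2]) => /=.
    split.
      apply: open_nbhs_nbhs; split; last by rewrite /= subrr normr0 divr_gt0.
      apply: open_lt_fun; last exact: cts_cst.
      by apply: cts_norm; apply: ctsB; [exact: cts_id|exact: cts_cst].
    exists (Num.truncn (4 / d)).+1 => // n /= hn.
    have n0 : (0 : R) < n%:R by rewrite ltr0n (leq_trans _ hn).
    have h4 : 4 / d < n%:R.
      by apply: (lt_le_trans (truncnS_gt _)); rewrite ler_nat.
    by rewrite ltr_pdivrMr //; move: h4; rewrite ltr_pdivrMr //; nra.
  move=> [x n] /= [xd nd].
  have near' x' : `|x' - x| <= 2 / n%:R -> `|x' - x0| < d.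
    move=> h; rewrite -(subrK x x') -addrA (le_lt_trans (ler_normD _ _)) //; lra.
  split; first by move=> x' /near' /hd' [].
  by exists F; split=> // x' a /near' /hd' [_ _]; apply.
case=> n0 _ hn0; exists n0.+1; split=> // x x1 Dx.
exact: (hn0 n0.+1 (leqnSn n0) x).
Qed.

End Placement.

(** * Disjoint cells meeting every orbit *)

Section PlacementStep.
Variables (R : realType) (Y : topologicalType) (phi : R -> Y -> Y).
Variables (m q N : nat).
Hypotheses (flow : circle_flow phi) (hY : hausdorff_space Y).
Hypotheses (q_gt0 : (0 < q)%N) (N_gt0 : (0 < N)%N).
Local Notation rV := 'rV[R]_m.
Local Notation rho := (phi q%:R^-1).
Local Notation width := ((q * N)%:R^-1 : R).
Local Notation slot := (@slot R q N).
Local Notation colors := #|{: {ffun 'I_m -> 'I_3}}|.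

(** The pieces [Ps] record where the cells lie. Their number is known before the
    size of the cells is chosen, and it is this number that bounds the
    conflicts to come. *)
Definition placed (Ps : seq (set Y)) (E : set Y) :=
  exists (J : finType) (b : J -> rV -> Y), [/\ forall j, cell (b j),
    rho_disjoint q rho b,
    forall j x, `|x| <= 1 -> exists2 P, P \in Ps & P (b j x) &
    forall y, E y -> exists t j x, `|x| <= 2^-1 /\ phi t y = b j x].

(** The cubes of a fine grid that meet [D] are moved along the flow to heights
    where they avoid the pieces of [Ps], each cube having few conflicts. The
    height of a cube is congruent to its color modulo the number of colors.
    Hence two new cubes at the same height have the same color and are disjoint,
    and two new cubes at different heights are disjoint since [Z] is thin. The
    copies of [Z] at the heights in use become new pieces. *)
Lemma place_slice (Ps : seq (set Y)) (E : set Y) (b : rV -> Y) (Z D : set Y) :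
  (forall P, P \in Ps -> thin phi width P) -> placed Ps E ->
  cell b -> thin phi width Z -> Z `<=` b @` [set x | `|x| < 1] ->
  closed D -> D `<=` Z° -> (colors * (size Ps).+1 <= N)%N ->
  exists Qs, [/\ size Qs = (size Ps + colors * (size Ps).+1)%N,
    forall P, P \in Qs -> thin phi width P & placed Qs (E `|` D)].
Proof.
move=> tP [J [b0 [cb0 dis0 b0P cov0]]] cb [clZ thZ] Zb clD DZ CN.
have [cbc bi _] := cb.
set M := (colors * (size Ps).+1)%N in CN *.
pose Qs := Ps ++ [seq phi (- slot a) @^-1` Z | a <- iota 0 M].
exists Qs; split.
- by rewrite size_cat size_map size_iota.
- move=> P; rewrite mem_cat => /orP[|/mapP[a _ ->]]; first exact: tP.
  split; first by apply: preimage_closed => // y _; exact: flow_cont.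
  by move=> z s Zz; rewrite /preimage /= -flowD // addrC flowD //; exact: thZ.
have [n [n0 fine]] := fine_scale flow q_gt0 N_gt0 tP cb Zb clD DZ.
have nR : (0 : R) < n%:R by rewrite ltr0n.
have rn : (0 : R) < n%:R^-1 by rewrite invr_gt0.
pose ctr := @grid_center R m n.
pose active (k : grid m n) := exists x, [/\ `|x| <= 1, D (b x) &
  `|x - ctr k| <= (2 * n%:R)^-1].
have closeP k x' : active k -> `|x' - ctr k| <= n%:R^-1 ->
    `|x'| < 1 /\ Z (b x').
  move=> [x [x1 Dx xk]] x'k; have [h _] := fine x x1 Dx; apply: h.
  rewrite -(subrK (ctr k) x') -addrA (le_trans (ler_normD _ _)) //.
  move: xk; rewrite distrC invfM; lra.
have exslot k : exists a : nat, active k -> [/\ (a < M)%N,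
    (a %% colors)%N = enum_rank (grid_color k) &
    forall x', `|x' - ctr k| <= n%:R^-1 -> ~ conflict phi q N Ps a (b x')].
  have [ak|] := pselect (active k); last by exists 0%N.
  have [x [x1 Dx xk]] := ak; have [_ [F [cF hF]]] := fine x x1 Dx.
  have lt_r : (enum_rank (grid_color k) < colors)%N by exact: ltn_ord.
  have [j jM jF] := pigeonhole_slot cF lt_r CN.
  exists (enum_rank (grid_color k) + colors * j)%N => _; split=> //.
    by rewrite addnC mulnC modnMDl modn_small.
  move=> x' x'k cf; have aN := leq_trans jM CN.
  have /negP := jF (Ordinal aN) erefl; apply; apply: (hF x' (Ordinal aN)) => //.
  rewrite -(subrK (ctr k) x') -addrA (le_trans (ler_normD _ _)) //.
  move: xk; rewrite distrC invfM; lra.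
pose J' := {k : grid m n | `[< active k >]}.
pose a (k : J') := projT1 (cid (exslot (val k))).
have act (k : J') : active (val k) by apply/asboolP; exact: (valP k).
have [aM acol afree] : [/\ forall k, (a k < M)%N,
   forall k, (a k %% colors)%N = enum_rank (grid_color (val k)) &
   forall k x', `|x' - ctr (val k)| <= n%:R^-1 -> ~ conflict phi q N Ps (a k) (b x')].
  by split=> k; rewrite /a; case: cid => v /= /(_ (act k)) [].
pose tile (k : J') x := b (ctr (val k) + n%:R^-1 *: x).
have near_ctr (k : J') (x : rV) : `|x| <= 1 ->
    `|ctr (val k) + n%:R^-1 *: x - ctr (val k)| <= n%:R^-1.
  by move=> x1; rewrite addrAC subrr add0r normrZ gtr0_norm // ler_piMr // ltW.
have tileZ k x : `|x| <= 1 -> Z (tile k x).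
  by move=> x1; have [] := closeP _ _ (act k) (near_ctr k x x1).
pose b' (k : J') x := phi (slot (a k)) (tile k x).
have cb' k : cell (b' k).
  apply: cell_homeomorphism; first exact: homeomorphism_flow.
  by apply: subcell => // x /(closeP _ _ (act k)) [].
pose bb (j : J + J') := match j with inl j => b0 j | inr k => b' k end.
(* [conflict] only involves rotations by [i / q] with [i < q]; the others differ
   from these by whole periods *)
have unconflict (k : J') j x x' (i : nat) : `|x| <= 1 -> `|x'| <= 1 ->
    phi (i%:R / q%:R) (b' k x) <> b0 j x'.
  move=> x1 x'1 e; have [P PP Pb] := b0P j x' x'1.
  apply: (afree k _ (near_ctr k x x1)); exists P => //.
  exists (Ordinal (ltn_pmod i q_gt0)) => /=; move: Pb.
  have E1 : i%:R / q%:R + slot (a k) =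
      (i %/ q)%:R + (slot (a k) + (i %% q)%:R / q%:R).
    rewrite {1}(divn_eq i q) natrD natrM mulrDl mulfK ?pnatr_eq0 -?lt0n //; ring.
  by rewrite -e /b' -flowD // E1 (flowD flow (i %/ q)%:R) pmulrn flow_int.
exists (J + J')%type, bb; split.
- by move=> [j|k]; [exact: cb0|exact: cb'].
- move=> [j|k] [j'|k'] i x x' x1 x'1 /= e.
  + by have [-> d] := dis0 _ _ _ _ _ x1 x'1 e.
  + have := unconflict k' j x' x (i * q.-1)%N x'1 x1; case.
    rewrite -e -iter_rotation // iter_rho_unshift //.
    exact: rotation_period.
  + by case: (unconflict k j' x x' i x1 x'1); rewrite -iter_rotation.
  + move: e; rewrite iter_rotation // /b' -flowD // => e.
    have zz : tile k' x' = phi (slot (a k) - slot (a k') + i%:R / q%:R) (tile k x).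
      apply: (can_inj (flowKN flow (slot (a k')))).
      by rewrite -e -flowD //; congr (phi _ _); ring.
    have Zz := tileZ k' x' x'1; rewrite zz in Zz.
    have [l hl] := thZ _ _ (tileZ k x x1) Zz.
    have lN j := leq_trans (aM j) CN.
    rewrite [i%:R]pmulrn in hl.
    have [ea ei] := slot_separated q_gt0 N_gt0 (lN k') (lN k) hl.
    have qi : (q %| i)%N.
      have l0 : 0 <= l by nia.
      by apply/dvdnP; exists `|l|%N; nia.
    split=> //; congr inr; apply: val_inj.
    have ec : grid_color (val k) = grid_color (val k').
      apply: enum_rank_inj; apply: val_inj; rewrite /= -[LHS]acol -[RHS]acol.
      by rewrite ea.
    apply: (grid_color_inj (R := R) n0 ec).
    have et : tile k' x' = tile k x.
      rewrite zz ea subrr add0r; have /dvdnP[c ->] := qi.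
      rewrite natrM mulfK ?pnatr_eq0 -?lt0n // pmulrn; exact: flow_int.
    have [h1 _] := closeP _ _ (act k) (near_ctr k x x1).
    have [h2 _] := closeP _ _ (act k') (near_ctr k' x' x'1).
    have := bi _ _ (ltW h2) (ltW h1) et => ex.
    have d1 := near_ctr k x x1; have d2 := near_ctr k' x' x'1.
    rewrite -/ctr in d1 d2 *; rewrite -(subrK (ctr (val k') + n%:R^-1 *: x') (ctr (val k))).
    rewrite -addrA (le_trans (ler_normD _ _)) // {1}ex distrC; lra.
- move=> [j|k] x x1 /=.
    by have [P PP Pb] := b0P j x x1; exists P => //; rewrite mem_cat PP.
  exists (phi (- slot (a k)) @^-1` Z); last by rewrite /preimage /= flowKN //; exact: tileZ.
  by rewrite mem_cat; apply/orP; right; apply/mapP; exists (a k); rewrite // mem_iota /= aM.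
- move=> y [/cov0 [t [j [x [xh e]]]]|Dy]; first by exists t, (inl j), x.
  have [x /= x1 ex] := Zb _ (nbhs_singleton (DZ _ Dy)).
  have [k xk] := grid_cover n0 x1.
  have ak : active k by exists x; split; rewrite ?ex // ltW.
  have ak' : `[< active k >] by apply/asboolP.
  exists (slot (a (exist _ k ak'))), (inr (exist _ k ak')), (n%:R *: (x - ctr k)).
  split; last first.
    by rewrite /= /b' /tile /= scalerA mulVf ?gt_eqF // scale1r addrC subrK ex.
  by rewrite normrZ gtr0_norm // mulrC -ler_pdivlMr // -invfM.
Qed.

End PlacementStep.

Section KeyLemma.
Variables (R : realType) (Y : topologicalType) (phi : R -> Y -> Y) (m : nat).
Hypotheses (flow : circle_flow phi) (hY : hausdorff_space Y).
Hypothesis cY : compact [set: Y].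
Local Notation rV := 'rV[R]_m.
Hypothesis has_cells : forall (p : Y) (O : set Y), nbhs p O ->
  exists b : rV -> Y, [/\ cell b, b 0 = p & forall x, `|x| <= 1 -> O (b x)].

(** Every slice multiplies [(size Ps).+1] by [C.+1], which tells how many heights
    [N], and therefore which thickness [w], the [size s] slices require. *)
Lemma cells_meeting_orbits (q : nat) : (0 < q)%N ->
  exists (J : finType) (b : J -> rV -> Y), [/\ forall j, cell (b j),
    rho_disjoint q (phi q%:R^-1) b &
    forall y, exists t j x, `|x| <= 2^-1 /\ phi t y = b j x].
Proof.
move=> q0.
have [bx hbx] := choice (flow_slices flow hY has_cells).
have [B hB] := choice hbx.
have [s [_ scov]] := finite_subcover cY (B := B) (fun y _ => let: And3 _ h _ := hB y in h).
pose C := #|{: {ffun 'I_m -> 'I_3}}|.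
pose N := (C.+1 ^ size s)%N.
have N0 : (0 < N)%N by rewrite expn_gt0.
pose w : R := (q * N)%:R^-1.
have w0 : 0 < w by rewrite invr_gt0 ltr0n muln_gt0 q0.
have H (l : seq Y) : (size l <= size s)%N -> exists Ps E,
   [/\ (size Ps).+1 = (C.+1 ^ size l)%N, forall P, P \in Ps -> thin phi w P,
     placed phi m q Ps E & forall x y, x \in l -> B x y -> exists t, E (phi t y)].
  elim: l => [_|x l IH szl].
    exists [::], set0; split=> //.
    by exists void, (fun (j : void) _ => match j with end); split=> // -[].
  have [Ps [E [szP tP pl cov]]] := IH (ltnW szl).
  have [cb _ /(_ w w0) [Z [D [tZ Zb clD DZ DB]]]] := hB x.
  have CN : (C * (size Ps).+1 <= N)%N.
    rewrite szP; apply: (@leq_trans (C.+1 ^ (size l).+1)).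
      by rewrite expnS leq_mul2r leqnSn orbT.
    by rewrite leq_pexp2l.
  have [Qs [szQ tQ plQ]] := place_slice flow hY q0 N0 tP pl cb tZ Zb clD DZ CN.
  exists Qs, (E `|` D); split=> //.
    by rewrite szQ -/C -addSn szP /= expnS mulSn.
  move=> x' y; rewrite inE => /orP[/eqP -> /DB [t Dt]|x'l /(cov x' y x'l) [t Et]].
    by exists t; right.
  by exists t; left.
have [Ps [E [_ _ [J [b [cb dis _ cov]]] covB]]] := H s (leqnn _).
exists J, b; split=> // y; have [x xs Bxy] := scov y I.
have [t /cov [t' [j [x' [xh e]]]]] := covB x y xs Bxy.
by exists (t' + t), j, x'; rewrite flowD.
Qed.

Hypothesis Y_connected : connected [set: Y].

(** Half cells meeting every orbit are pushed into the union [W] of the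
    rotations of [V]. A point of an orbit in [g^-1 W] becomes, after a rotation
    by a multiple of [1 / q], a point of the same orbit in [g^-1 V]. *)
Lemma conjugate_to_meet_orbits (q : nat) (V : set Y) : (0 < q)%N ->
  open V -> V !=set0 -> exists g, [/\ homeomorphism g,
    forall y, g (phi q%:R^-1 y) = phi q%:R^-1 (g y) &
    forall y, exists t, V (g (phi t y))].
Proof.
move=> q0 oV [v Vv]; have [J [b [cb dis cov]]] := cells_meeting_orbits q0.
pose rho := phi q%:R^-1; pose W := \bigcup_(k in [set: nat]) iter k rho @^-1` V.
have crho : continuous rho by exact: flow_cont.
have rq := rotation_period flow q0.
have [||y [k _ Vk]|g [hg gr] gW] := push_cells cY hY q0 crho rq
  (rotation_free flow q0) has_cells Y_connected (V := W) _ _ _ cb dis.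
- apply: bigcup_open => k _; apply: open_comp => // y _.
  exact: iter_rho_cont.
- by exists v, 0%N.
- exists (k + q.-1)%N => //.
  by rewrite /preimage /= -iterSr -addnS prednK // iterD rq.
exists g; split=> // y; have [t [j [x [xh e]]]] := cov y.
have [k _] := gW j x xh; rewrite /preimage /= -e => Vk.
exists (k%:R / q%:R + t); rewrite flowD // -iter_rotation //.
by rewrite (equivariant_homeo_iter _ _ (conj hg gr)).
Qed.

End KeyLemma.

(** * Charts of a Lie group at the identity *)

Lemma segment_mean_value (R : realType) (V : normedModType R) (g : V -> R)
    (p d : V) :
  (forall t : R, 0 <= t <= 1 -> differentiable g (p + t *: d)) ->
  exists2 t : R, 0 <= t <= 1 & g (p + d) - g p = 'D_d g (p + t *: d).
Proof.
move=> dg; pose h (t : R) := g (p + t *: d).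
have E (t : R) : (fun s : R => s^-1 *: ((h \o shift t) (s *: 1) - h t)) =
    (fun s : R => s^-1 *: ((g \o shift (p + t *: d)) (s *: d) - g (p + t *: d))).
  apply/funext => s; rewrite /h /= /shift /=; congr (_ *: (g _ - _)).
  by rewrite [s *: 1]mulr1 scalerDl addrCA.
have [|||c] := @MVT R h (fun t => 'D_d g (p + t *: d)) 0 1.
- exact: ltr01.
- move=> t; rewrite in_itv /= => /andP[t0 t1].
  have dt : derivable g (p + t *: d) d.
    by apply: diff_derivable; apply: dg; rewrite !ltW.
  split; last by rewrite /derive E.
  by rewrite /derivable E.
- apply: continuous_in_subspaceT => t; rewrite inE /= in_itv /= => t01.
  have cg := differentiable_continuous (dg t t01).
  apply: (@continuous_comp _ _ _ (fun t : R => p + t *: d) g) => //.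
  apply: ctsD; first exact: cts_cst.
  by apply: ctsZ; [exact: cts_id|exact: cts_cst].
- rewrite in_itv /= => /andP[c0 c1]; rewrite /h scale1r scale0r addr0 subr0 mulr1 => hE.
  by exists c; rewrite // !ltW.
Qed.

(** By the mean value theorem, each coordinate of [f p - f p'] is that of a
    derivative in the direction [p - p'] at a point near [x0]; and derivatives
    depend on the direction through the finitely many directions [e k], in which
    they are continuous. *)
Lemma strictly_differentiable (R : realType) (V : normedModType R) (m : nat)
    (f : V -> 'rV[R]_m) (S : set V) (x0 : V) (I : finType) (e : I -> V)
    (coef : I -> V -> R) :
  (forall v, v = \sum_k coef k v *: e k) ->
  (forall k v, `|coef k v| <= `|v|) ->
  nbhs x0 S -> (forall x, S x -> differentiable f x) ->
  (forall v x, S x -> {for x, continuous ('D_v f)}) ->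
  forall eps : R, 0 < eps -> exists2 r : R, 0 < r &
    forall p p', `|p - x0| < r -> `|p' - x0| < r ->
      `|f p - f p' - 'D_(p - p') f x0| <= eps * `|p - p'|.
Proof.
move=> dec cle nS df cD eps eps0.
pose M : R := #|I|.+1%:R; have M0 : 0 < M by rewrite ltr0n.
have e0 : 0 < eps / M by rewrite divr_gt0.
have nD : \forall x \near x0, S x /\ forall k,
    `|'D_(e k) f x - 'D_(e k) f x0| < eps / M.
  apply: filterI => //; apply: (@filter_forall _ I
    (fun k => [set x | `|'D_(e k) f x - 'D_(e k) f x0| < eps / M]) _ (nbhs_filter x0)) => k.
  have o : open [set w : 'rV[R]_m | `|w - 'D_(e k) f x0| < eps / M].
    apply: open_lt_fun; last exact: cts_cst.
    by apply: cts_norm; apply: ctsB; [exact: cts_id|exact: cts_cst].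
  have h0 : `|'D_(e k) f x0 - 'D_(e k) f x0| < eps / M by rewrite subrr normr0.
  exact: (cD (e k) x0 (nbhs_singleton nS) _ (open_nbhs_nbhs (conj o h0))).
have [r /= r0 hr] := (nbhs_normP _ _).1 nD.
have hr' x : `|x - x0| < r -> S x /\ forall k,
    `|'D_(e k) f x - 'D_(e k) f x0| < eps / M.
  by move=> xr; apply: hr; rewrite /= distrC.
exists r => // p p' pr p'r; set d := p - p'.
have Dlin x : S x -> 'D_d f x = \sum_k coef k d *: 'D_(e k) f x.
  move=> Sx; rewrite deriveE; last exact: df.
  rewrite {1}(dec d) linear_sum; apply: eq_bigr => k _.
  by rewrite linearZ deriveE //; exact: df.
have seg (t : R) : 0 <= t <= 1 -> `|p' + t *: d - x0| < r.
  move=> /andP[t0 t1].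
  have -> : p' + t *: d - x0 = t *: (p - x0) + (1 - t) *: (p' - x0).
    have -> : d = (p - x0) - (p' - x0) by rewrite opprB addrA subrK.
    by rewrite addrAC scalerBl scale1r [t *: (_ - (_ - _))]scalerBr addrCA.
  apply: (le_lt_trans (ler_normD _ _)); rewrite !normrZ ger0_norm //.
  rewrite ger0_norm ?subr_ge0 //.
  have [ab|/ltW ab] := leP `|p - x0| `|p' - x0|; nra.
apply/rV_norm_le; first by rewrite mulr_ge0 // ltW.
move=> j; pose g x := f x 0 j.
have dg x : S x -> differentiable g x.
  move=> Sx; apply: (@differentiable_comp _ _ _ _ f (fun N : 'rV[R]_m => N 0 j)).
    exact: df.
  exact: differentiable_coord.
have [t t01] := @segment_mean_value R V g p' d (fun t t01 => dg _ (hr' _ (seg t t01)).1).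
have -> : p' + d = p by rewrite /d addrC subrK.
move=> gE.
have [Sx hx] := hr' _ (seg t t01).
have Dg x : S x -> 'D_d g x = ('D_d f x) 0 j.
  by move=> /df/diff_derivable dx; rewrite derive_mx // mxE.
have -> : (f p - f p' - 'D_d f x0) 0 j =
    \sum_k coef k d * ('D_(e k) f (p' + t *: d) - 'D_(e k) f x0) 0 j.
  have coordB (u v w : 'rV[R]_m) : (u - v - w) 0 j = (u 0 j - v 0 j) - w 0 j.
    by rewrite !mxE.
  have coord_sum (F : I -> 'rV[R]_m) :
      (\sum_k coef k d *: F k) 0 j = \sum_k coef k d * F k 0 j.
    by rewrite summxE; apply: eq_bigr => k _; rewrite mxE.
  have Dsum x : S x -> ('D_d f x) 0 j = \sum_k coef k d * ('D_(e k) f x) 0 j.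
    by move=> /Dlin ->; exact: coord_sum.
  have fE := etrans gE (etrans (Dg _ Sx) (Dsum _ Sx)).
  apply: (etrans (coordB _ _ _)).
  apply: (etrans (congr2 (fun a b : R => a - b) fE (Dsum _ (nbhs_singleton nS)))).
  apply: (etrans (esym (sumrB _ _ _ _))); apply: eq_bigr => k _.
  by rewrite -mulrBr; congr (_ * _); rewrite [in RHS]mxE [in RHS]mxE.
apply: (le_trans (ler_norm_sum _ _ _)).
apply: (@le_trans _ _ (\sum_(k in I) `|d| * (eps / M))).
  apply: ler_sum => k _; rewrite normrM ler_pM //.
  apply: le_trans (ltW (hx k)).
  by have /rV_norm_le := lexx `|'D_(e k) f (p' + t *: d) - 'D_(e k) f x0|; apply.
rewrite sumr_const -[_ *+ _]mulr_natr [leRHS]mulrC -mulrA; apply: ler_wpM2l => //.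
rewrite mulrAC ler_pdivrMr // ler_pM2l // ler_nat; exact: leqnSn.
Qed.

Lemma derive_near_eq (R : realType) (V W : normedModType R) (f : V -> W)
    (a v : V) (d : W) :
  (\forall h \near (0 : R)^', h^-1 *: (f (h *: v + a) - f a) = d) ->
  'D_v f a = d.
Proof.
move=> H; apply: cvg_lim; first exact: norm_hausdorff.
apply: (@cvg_trans _ ((fun=> d) @ (0 : R)^')); last exact: cvg_cst.
by apply: near_eq_cvg; apply: filterS H => h ->.
Qed.

Section LieChart.
Variables (R : realType) (n : nat) (G : topologicalGroupType).
Local Notation rV := 'rV[R]_n.

Lemma pair_row_decomposition (v : rV * rV) :
  v = \sum_(k : 'I_n + 'I_n) (match k with inl i => v.1 0 i | inr i => v.2 0 i end) *:
    (match k with inl i => (delta_mx 0 i, 0) | inr i => (0, delta_mx 0 i) end : rV * rV).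
Proof.
rewrite big_sumType /=; case: v => v w /=.
have fstS (F : 'I_n -> rV * rV) : (\sum_i F i).1 = \sum_i (F i).1.
  by elim/big_rec2: _ => // i a b _ <-.
have sndS (F : 'I_n -> rV * rV) : (\sum_i F i).2 = \sum_i (F i).2.
  by elim/big_rec2: _ => // i a b _ <-.
apply: injective_projections; rewrite /= ?fstS ?sndS /=.
  rewrite [X in _ + X]big1 ?addr0; first by rewrite {1}(row_sum_delta v).
  by move=> i _; rewrite scaler0.
rewrite [X in X + _]big1 ?add0r; first by rewrite {1}(row_sum_delta w).
by move=> i _; rewrite scaler0.
Qed.

(** [X] and [E] are a chart at the identity, centered at 0, and its inverse.
    Because the identity is neutral, the derivative of the product at (1, 1) is
    the addition of tangent vectors; the last clause is the strict
    differentiability of the product in these coordinates. *)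
Lemma lie_group_chart : lie_group R n G -> exists (X : G -> rV) (E : rV -> G)
    (dom : set G) (r : R), [/\ 0 < r, E 0 = 1%g,
    forall v, `|v| < r -> dom (E v) /\ X (E v) = v,
    forall g, dom g -> E (X g) = g &
    [/\ forall W, nbhs (1%g : G) W -> exists2 d, 0 < d & forall v, `|v| < d -> W (E v),
    forall d, 0 < d -> nbhs (1%g : G) [set g | dom g /\ `|X g| < d],
    forall x y, `|x| < r -> `|y| < r -> dom (E x * E y)%g &
    forall x x' y y', `|x| < r -> `|x'| < r -> `|y| < r -> `|y'| < r ->
      `|X (E x * E y)%g - X (E x' * E y')%g - (x - x') - (y - y')| <=
        8^-1 * (`|x - x'| + `|y - y'|)]].
Proof.
move=> [_ [A [[Acov _] smA _]]].
have [c Ac c1] := Acov 1%g.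
pose a := chart_map c 1%g; pose X g := chart_map c g - a.
pose E v := chart_inv c (a + v).
have imgK u : chart_img c u -> chart_dom c (chart_inv c u) /\ chart_map c (chart_inv c u) = u.
  by move=> [x dx <-]; rewrite chart_mapK.
have oimg : open (chart_img c) := @chart_img_open R n G c.
have odom := @chart_dom_open R n G c.
have ia : chart_img c a by exists 1%g.
have inva : chart_inv c a = 1%g by exact: chart_mapK.
have cinv u : chart_img c u -> {for u, continuous (chart_inv c)}.
  move=> iu; have := @chart_inv_continuous R n G c; rewrite continuous_open_subspace //.
  by apply; rewrite inE.
have cmap g : chart_dom c g -> {for g, continuous (chart_map c)}.
  move=> dg; have := @chart_map_continuous R n G c; rewrite continuous_open_subspace //.
  by apply; rewrite inE.
pose S := [set p : rV * rV | [/\ chart_img c p.1, chart_img c p.2 &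
            chart_dom c (chart_inv c p.1 * chart_inv c p.2)%g]].
pose f (p : rV * rV) := chart_map c (chart_inv c p.1 * chart_inv c p.2)%g.
have nimg : nbhs a (chart_img c) by exact: open_nbhs_nbhs.
have ninv W : nbhs (1%g : G) W -> nbhs a (chart_inv c @^-1` W).
  by move=> W1; apply: (cinv a ia); rewrite inva.
have nS : nbhs (a, a) S.
  have := @mulg_continuous G (1%g, 1%g) (chart_dom c).
  rewrite /= mulg1 => /(_ (open_nbhs_nbhs (conj odom c1))) [[U V] /= [U1 V1] UV].
  exists (chart_img c `&` chart_inv c @^-1` U, chart_img c `&` chart_inv c @^-1` V).
    by split; apply: filterI => //; exact: ninv.
  by move=> [p1 p2] [[i1 U2] [i2 V2]]; split=> //; exact: (UV (_, _)).
have [df [df' df'']] : (forall x, S x -> differentiable f x) /\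
    ((forall v x, S x -> {for x, continuous ('D_v f)}) /\ True).
  by have [] := smA c c c Ac Ac Ac 1%N.
have D1 v : 'D_((v, 0)) f (a, a) = v.
  apply: derive_near_eq.
  have near_img : \forall h \near (0 : R)^', chart_img c (h *: v + a).
    apply: nbhs_dnbhs.
    have ch : continuous (fun h : R => h *: v + a).
      by apply: ctsD; [apply: ctsZ; [exact: cts_id|exact: cts_cst]|exact: cts_cst].
    by apply: (nbhs_preimage ch); rewrite scale0r add0r.
  have nz : \forall h \near (0 : R)^', h != 0 by exact: nbhs_dnbhs_neq.
  apply: filterS (filterI near_img nz) => h [/imgK [_ eh] h0].
  rewrite /f /= /shift /= scaler0 add0r inva !mulg1.
  by rewrite eh addrK scalerA mulVf // scale1r.
have D2 v : 'D_((0, v)) f (a, a) = v.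
  apply: derive_near_eq.
  have near_img : \forall h \near (0 : R)^', chart_img c (h *: v + a).
    apply: nbhs_dnbhs.
    have ch : continuous (fun h : R => h *: v + a).
      by apply: ctsD; [apply: ctsZ; [exact: cts_id|exact: cts_cst]|exact: cts_cst].
    by apply: (nbhs_preimage ch); rewrite scale0r add0r.
  have nz : \forall h \near (0 : R)^', h != 0 by exact: nbhs_dnbhs_neq.
  apply: filterS (filterI near_img nz) => h [/imgK [_ eh] h0].
  rewrite /f /= /shift /= scaler0 add0r inva !mul1g.
  by rewrite eh addrK scalerA mulVf // scale1r.
have dfa := df _ (nbhs_singleton nS).
have DE (v w : rV) : 'D_((v, w)) f (a, a) = v + w.
  rewrite deriveE // (_ : (v, w) = (v, 0) + (0, w)).
    by rewrite linearD -!deriveE // D1 D2.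
  by apply: injective_projections; rewrite /= ?addr0 ?add0r.
have cle (k : 'I_n + 'I_n) (v : rV * rV) :
    `|match k with inl i => v.1 0 i | inr i => v.2 0 i end| <= `|v|.
  rewrite prod_normE /= le_max; case: k => i; apply/orP; [left|right].
    by have /rV_norm_le := lexx `|v.1|; apply.
  by have /rV_norm_le := lexx `|v.2|; apply.
have e8 : (0 : R) < 8^-1 by lra.
have [r1 r10 hr1] := strictly_differentiable pair_row_decomposition cle nS df df' e8.
have [r2 /= r20 hr2] := (nbhs_normP _ _).1 nS.
pose r := Num.min r1 r2.
have r0 : 0 < r by rewrite lt_min r10 r20.
have near_aa (x y : rV) (s : R) : `|x| < s -> `|y| < s -> `|(a + x, a + y) - (a, a)| < s.
  by move=> xs ys; rewrite prod_normE /= ![a + _]addrC !addrK gt_max xs ys.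
have hS x y : `|x| < r -> `|y| < r -> S (a + x, a + y).
  move=> xr yr; apply: hr2; rewrite /= distrC; apply: near_aa.
    by apply: lt_le_trans xr _; rewrite ge_min lexx orbT.
  by apply: lt_le_trans yr _; rewrite ge_min lexx orbT.
have img v : `|v| < r -> chart_img c (a + v).
  by move=> vr; have [] := hS v 0 vr (ltac:(by rewrite normr0)).
exists X, E, (chart_dom c), r; split=> //.
- by rewrite /E addr0.
- move=> v vr; have [d e] := imgK _ (img v vr); split=> //.
  by rewrite /X /E e addrC addKr.
- by move=> g dg; rewrite /E /X addrC subrK chart_mapK.
split.
- move=> W /ninv /nbhs_normP [d /= d0 hd]; exists d => // v vd; apply: hd.
  by rewrite /= opprD addrA subrr add0r normrN.
- move=> d d0; apply: filterI; first exact: open_nbhs_nbhs.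
  have : nbhs a [set u | `|u - a| < d].
    apply: open_nbhs_nbhs; split; last by rewrite /= subrr normr0.
    apply: open_lt_fun; last exact: cts_cst.
    by apply: cts_norm; apply: ctsB; [exact: cts_id|exact: cts_cst].
  by move=> /(cmap 1%g c1).
- by move=> x y xr yr; have [] := hS x y xr yr.
- move=> x x' y y' xr x'r yr y'r.
  have sub (v w : rV) : `|v| < r -> `|w| < r -> `|(a + v, a + w) - (a, a)| < r1.
    move=> vr wr; apply: near_aa.
      by apply: lt_le_trans vr _; rewrite ge_min lexx.
    by apply: lt_le_trans wr _; rewrite ge_min lexx.
  have := hr1 _ _ (sub _ _ xr yr) (sub _ _ x'r y'r).
  have -> : (a + x, a + y) - (a + x', a + y') = (x - x', y - y').
    by apply: injective_projections; rewrite /= opprD addrACA subrr add0r.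
  rewrite DE opprD addrA => h.
  have -> : X (E x * E y)%g - X (E x' * E y')%g =
      f (a + x, a + y) - f (a + x', a + y').
    by rewrite /X opprD opprK addrACA addNr addr0.
  apply: le_trans h _; apply: ler_wpM2l; first exact: ltW.
  by rewrite prod_normE /= ge_max lerDl lerDr !normr_ge0.
Qed.

End LieChart.

(** * Square roots near the identity *)

Section LocalRoots.
Variables (R : realType) (n : nat) (G : topologicalGroupType).
Local Notation rV := 'rV[R]_n.
Variables (X : G -> rV) (E : rV -> G) (dom : set G) (r : R).
Hypotheses (r_gt0 : 0 < r) (E0 : E 0 = 1%g).
Hypothesis EK : forall v, `|v| < r -> dom (E v) /\ X (E v) = v.
Hypothesis XK : forall g, dom g -> E (X g) = g.
Hypothesis domM : forall x y, `|x| < r -> `|y| < r -> dom (E x * E y)%g.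
Hypothesis almost_additive : forall x x' y y',
  `|x| < r -> `|x'| < r -> `|y| < r -> `|y'| < r ->
  `|X (E x * E y)%g - X (E x' * E y')%g - (x - x') - (y - y')| <=
        8^-1 * (`|x - x'| + `|y - y'|).
Local Notation law x y := (X (E x * E y)%g).

Lemma norm0r : `|0 : rV| < r. Proof. by rewrite normr0. Qed.

(** Squaring is close to doubling, which is injective. *)
Lemma square_root_unique x x' : `|x| < r -> `|x'| < r ->
  (E x * E x = E x' * E x')%g -> x = x'.
Proof.
move=> xr x'r e; have := almost_additive xr x'r xr x'r.
rewrite e subrr sub0r -opprD normrN -mulr2n -scaler_nat normrZ normr_nat => h.
have : `|x - x'| <= 0 by have := normr_ge0 (x - x'); lra.
by rewrite normr_le0 subr_eq0 => /eqP.
Qed.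

(** The map [x + (c - x^2) / 2] contracts the ball [K] by a factor 8 and maps it
    to itself; on this compact ball, a minimum of the displacement is a fixed
    point, hence a square root of [c]. *)
Lemma square_root_exists (c : rV) : `|c| < r ->
  exists x, `|x| <= 2 / 3 * `|c| /\ (E x * E x = E c)%g.
Proof.
move=> cr; pose f x := x + 2^-1 *: (c - law x x).
pose K := [set x : rV | `|x| <= 2 / 3 * `|c|].
have c0 := normr_ge0 c.
have Kr x : K x -> `|x| < r by rewrite /K /=; lra.
have fE x x' : f x - f x' =
    - (2^-1 *: (law x x - law x' x' - (x - x') - (x - x'))).
  by apply/rowP => i; rewrite /f !mxE; lra.
have contr x x' : `|x| < r -> `|x'| < r -> `|f x - f x'| <= 8^-1 * `|x - x'|.
  move=> xr x'r; rewrite fE normrN normrZ ger0_norm //.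
  by have := almost_additive xr x'r xr x'r; lra.
have K0 : K 0 by rewrite /K /= normr0; lra.
have f0 : f 0 = 2^-1 *: c.
  by rewrite /f E0 mulg1 -E0 (EK norm0r).2 subr0 add0r.
have fK x : K x -> K (f x).
  move=> Kx; have := contr x 0 (Kr x Kx) norm0r; rewrite f0 subr0 => h.
  rewrite /K /= -(subrK (2^-1 *: c) (f x)) (le_trans (ler_normD _ _)) //.
  rewrite normrZ ger0_norm //; move: Kx; rewrite /K /=; lra.
have cf : {within K, continuous (fun x => `|f x - x|)}.
  apply: continuous_in_subspaceT => x; rewrite inE => /Kr xr.
  apply: continuous_at_dist => e e0.
  have oB : open ([set y : rV | `|y| < r] `&` [set y | `|x - y| < e / 2]).
    by apply: openI; apply: open_lt_fun; try exact: cts_cst; apply: cts_norm;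
      [exact: cts_id|apply: ctsB; [exact: cts_cst|exact: cts_id]].
  have xB : ([set y : rV | `|y| < r] `&` [set y | `|x - y| < e / 2]) x.
    by split; rewrite //= subrr normr0 divr_gt0.
  apply: filterS (open_nbhs_nbhs (conj oB xB)) => y [/= yr xy].
  apply: le_lt_trans (ler_dist_dist _ _) _.
  have -> : f x - x - (f y - y) = (f x - f y) - (x - y).
    by apply/rowP => i; rewrite !mxE; ring.
  apply: le_lt_trans (ler_normB _ _) _.
  have := contr x y xr yr; lra.
have cK : compact K.
  apply: bounded_closed_compact.
    exists (2 / 3 * `|c|); split; first exact: num_real.
    by move=> M M1 x /= x1; exact: le_trans x1 (ltW M1).
  by apply: closed_le_fun; [apply: cts_norm; exact: cts_id|exact: cts_cst].
have [x] := compact_EVT_min (ex_intro _ _ K0) cK cf.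
rewrite inE => Kx xmin; exists x; split=> //.
have fx : f x = x.
  have := xmin (f x); rewrite inE => /(_ (fK x Kx)) h1.
  have h2 := contr (f x) x (Kr _ (fK x Kx)) (Kr _ Kx).
  have : `|f x - x| <= 0 by lra.
  by rewrite normr_le0 subr_eq0 => /eqP.
have e : law x x = c.
  have /eqP : 2^-1 *: (c - law x x) = 0 by apply: (addrI x); rewrite addr0.
  by rewrite scaler_eq0 invr_eq0 pnatr_eq0 /= subr_eq0 => /eqP.
by rewrite -e XK //; apply: domM; exact: Kr.
Qed.

Definition root (c : rV) : rV :=
  match pselect (exists x, `|x| <= 2 / 3 * `|c| /\ (E x * E x = E c)%g) with
  | left e => projT1 (cid e) | right _ => 0 end.

Lemma rootP c : `|c| < r ->
  `|root c| <= 2 / 3 * `|c| /\ (E (root c) * E (root c) = E c)%g.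
Proof.
move=> cr; rewrite /root; case: pselect => [e|]; first by case: cid.
by move=> N; case: N; exact: square_root_exists.
Qed.

Definition iroot c k := iter k root c.

Lemma iroot_norm c k : `|c| < r -> `|iroot c k| <= (2 / 3) ^+ k * `|c|.
Proof.
move=> cr; elim: k => [|k IH]; first by rewrite expr0 mul1r.
have kr : `|iroot c k| < r.
  apply: le_lt_trans IH _; apply: le_lt_trans cr.
  by rewrite ler_piMl // exprn_ile1 //; lra.
have [h _] := rootP kr; apply: le_trans h _.
by rewrite exprS -[leRHS]mulrA; apply: ler_wpM2l => //; lra.
Qed.

Lemma iroot_lt c k : `|c| < r -> `|iroot c k| < r.
Proof.
move=> cr; apply: le_lt_trans (iroot_norm k cr) _; apply: le_lt_trans cr.
by rewrite ler_piMl // exprn_ile1 //; lra.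
Qed.

Lemma irootS c k : `|c| < r -> (E (iroot c k.+1) ^+ 2 = E (iroot c k))%g.
Proof. by move=> cr; have [_] := rootP (iroot_lt k cr). Qed.

Lemma iroot_pow c k l : `|c| < r -> (E (iroot c (k + l)) ^+ (2 ^ k) = E (iroot c l))%g.
Proof.
move=> cr; elim: k => [|k IH]; first by rewrite expn0 expg1.
by rewrite expnS expgnA irootS.
Qed.

(** With [j = 2 i + b], the power [j] of the root of order [k + 1] is the power
    [i] of the root of order [k], times at most one factor. This factor adds at
    most 9/8 of its norm, and the norms of the roots decrease like [(2 / 3)^k]:
    the constants are the partial sums of this geometric series. *)
Lemma iroot_powers_bound c k j : 8 * `|c| < r -> (j <= 2 ^ k)%N ->
  exists v, `|v| <= (27 / 8) * (1 - (2 / 3) ^+ k.+1) * `|c| /\ (E (iroot c k) ^+ j = E v)%g.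
Proof.
move=> c8; have c0 := normr_ge0 c; have cr : `|c| < r by lra.
elim: k j => [|k IH] j.
  rewrite expn0 expr1; case: j => [|[|//]] _.
    by exists 0; rewrite expg0 E0 normr0; split=> //; lra.
  by exists c; rewrite expg1; split=> //=; lra.
move=> jk; have [|v [vb ev]] := IH j./2.
  by move: jk; rewrite expnS -[X in (X <= _)%N]odd_double_half; lia.
set y := iroot c k.+1; have yb := iroot_norm k.+1 cr; rewrite -/y in yb.
have e23 : (0 : R) <= (2 / 3) ^+ k.+1 by rewrite exprn_ge0 //; lra.
have e23S : (2 / 3) ^+ k.+2 = 2 / 3 * (2 / 3) ^+ k.+1 :> R by rewrite exprS.
rewrite -[j]odd_double_half expgnDr -muln2 mulnC expgnA irootS // ev.
case: (odd j); last first.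
  rewrite expg0 mul1g; exists v; split=> //; apply: le_trans vb _.
  by rewrite ler_wpM2r // e23S; lra.
have vr : `|v| < r by apply: le_lt_trans vb _; nra.
have yr : `|y| < r by exact: iroot_lt.
rewrite expg1; exists (law y v); split; last by rewrite XK //; exact: domM.
have := almost_additive yr norm0r vr vr.
rewrite E0 mul1g (EK vr).2 subrr subr0 subr0 normr0 addr0 => h.
have -> : law y v = (law y v - v - y) + (v + y).
  by apply/rowP => i; rewrite !mxE; ring.
apply: le_trans (ler_normD _ _) _; apply: le_trans (lerD h (ler_normD _ _)) _.
rewrite e23S; nra.
Qed.

Lemma iroot_powers_small c k l j : 8 * `|c| < r -> (j <= 2 ^ k)%N ->
  exists v, `|v| <= 4 * ((2 / 3) ^+ l * `|c|) /\ (E (iroot c (k + l)) ^+ j = E v)%g.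
Proof.
move=> c8 jk; have c0 := normr_ge0 c; have cr : `|c| < r by lra.
have lb := iroot_norm l cr.
have l1 : (2 / 3) ^+ l <= 1 :> R by rewrite exprn_ile1 //; lra.
have [|v [vb ev]] := @iroot_powers_bound (iroot c l) k j _ jk; first by nra.
exists v; split; last by rewrite /iroot iterD.
have e23 : (0 : R) <= (2 / 3) ^+ k.+1 by rewrite exprn_ge0 //; lra.
apply: le_trans vb _; have := normr_ge0 (iroot c l); nra.
Qed.

(** Conjugation by [h] takes a small square root of an element that commutes
    with [h] to a small square root of the same element. *)
Lemma iroot_commute c h k : `|c| < r -> (h * E c = E c * h)%g ->
  (forall v, `|v| <= `|c| -> exists2 w, `|w| < r & (h * E v * h^-1 = E w)%g) ->
  (h * E (iroot c k) = E (iroot c k) * h)%g.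
Proof.
move=> cr hc conj; elim: k => // k IH.
have kb : `|iroot c k.+1| <= `|c|.
  apply: le_trans (iroot_norm k.+1 cr) _.
  by rewrite ler_piMl // exprn_ile1 //; lra.
have [w wr ew] := conj _ kb.
suff e : w = iroot c k.+1 by rewrite -[LHS](mulgVK h) ew e.
apply: square_root_unique => //; first exact: iroot_lt.
rewrite -ew -[RHS]expg2 irootS //.
rewrite !mulgA mulgVK -[(h * _ * _)%g]mulgA -[(_ * E _)%g]expg2 irootS //.
by rewrite IH mulgK.
Qed.

End LocalRoots.

(** * One-parameter subgroups as dyadic limits *)

Section IntPower.
Variable G : groupType.

Definition zexpg (g : G) (z : int) : G :=
  match z with Posz n => (g ^+ n)%g | Negz n => ((g ^+ n.+1)^-1)%g end.

Lemma zexpgB g (m n : nat) : zexpg g (m%:Z - n%:Z) = (g ^+ m * (g ^+ n)^-1)%g.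
Proof.
have [h|/ltnW h] := leqP n m; first by rewrite subzn //= expgnFr.
rewrite -opprB subzn //; case e : (n - m)%N => [|k].
  have -> : m = n by lia.
  by rewrite oppr0 /= mulgV.
by rewrite -NegzE /= -e expgnFr // invgF.
Qed.

Lemma zexpgD g a b : zexpg g (a + b) = (zexpg g a * zexpg g b)%g.
Proof.
have dec (z : int) : exists m n : nat, z = m%:Z - n%:Z.
  by case: z => k; [exists k, 0%N; rewrite subr0|exists 0%N, k.+1; rewrite NegzE sub0r].
have [m [n ->]] := dec a; have [m' [n' ->]] := dec b.
have cV i j : commute (g ^+ i) ((g ^+ j)^-1).
  by apply: commuteV; rewrite /commute -!expgnDr addnC.
rewrite addrACA -opprD -!PoszD !zexpgB !expgnDr invgM.
have -> : ((g ^+ n')^-1 * (g ^+ n)^-1 = (g ^+ n)^-1 * (g ^+ n')^-1)%g.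
  by rewrite -!invgM -!expgnDr addnC.
by rewrite !mulgA; congr (_ * _)%g; rewrite -!mulgA; congr (_ * _)%g; exact: cV.
Qed.

End IntPower.

Section DyadicLimit.
Variables (R : realType) (G : topologicalGroupType).
Hypotheses (cG : compact [set: G]) (hG : hausdorff_space G).

Lemma cvg_mulg (T : Type) (F : set_system T) (FF : Filter F) (f g : T -> G)
    (a b : G) :
  f @ F --> a -> g @ F --> b -> (fun x => f x * g x)%g @ F --> (a * b)%g.
Proof.
move=> fa gb; apply: (@continuous2_cvg T G G G F FF f g (fun x y => (x * y)%g)) fa gb.
exact: (@mulg_continuous G (a, b)).
Qed.

Lemma cts_mulg (T : topologicalType) (f g : T -> G) :
  continuous f -> continuous g -> continuous (fun x => f x * g x)%g.
Proof. by move=> cf cg x; apply: cvg_mulg; [exact: cf|exact: cg]. Qed.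

Lemma closed_nbhs_in (W : set G) (x : G) : nbhs x W -> exists C,
  [/\ closed C, nbhs x C & C `<=` W].
Proof.
move=> /(compact_regular hG cG (filterT : nbhs x setT)) [C Cx CW].
exists (closure C); split=> //; first exact: closed_closure.
exact: filterS (@subset_closure _ C) Cx.
Qed.

Lemma ultra_limit (U : set_system nat) (v : nat -> G) : UltraFilter U ->
  exists p : G, v @ U --> p.
Proof.
move=> UU; have [p [_ clp]] := @cG (v @ U) _ filterT.
exists p => W pW; have [//|nW] := in_ultra_setVsetC (v @^-1` W) UU.
by have [y [ny Wy]] := clp (~` W) W nW pW.
Qed.

Variable g : nat -> G.
Hypothesis g_root : forall k l, (g (k + l) ^+ (2 ^ k) = g l)%g.
Hypothesis g_small : forall W, nbhs (1%g : G) W ->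
  exists l, forall k j, (j <= 2 ^ k)%N -> W (g (k + l) ^+ j)%g.

(** [delta t] is the limit of [g k] to the power [floor (t * 2 ^ k)] along an
    ultrafilter, which selects limits for all [t] at once. The integer part is
    additive up to one unit, that is, up to one factor [g k], which tends to the
    identity. *)
Lemma dyadic_limit : exists delta : R -> G, [/\ continuous delta,
  forall s t, delta (s + t) = (delta s * delta t)%g,
  delta 1 = g 0%N,
  forall C, closed C -> (forall k j, (j <= 2 ^ k)%N -> C (g k ^+ j)%g) ->
    forall t, 0 <= t <= 1 -> C (delta t) &
  forall h, (forall k, h * g k = g k * h)%g -> forall t, (h * delta t = delta t * h)%g].
Proof.
have [U [UU oU]] := ultraFilterLemma (_ : ProperFilter (\oo : set_system nat)).
pose u (t : R) (k : nat) := zexpg (g k) (Num.floor (t * 2 ^+ k)).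
have [delta hd] := choice (fun t : R => ultra_limit (u t) UU).
have uniq (v w : nat -> G) (a b : G) : v @ U --> a -> w @ U --> b ->
    (\forall k \near U, v k = w k) -> a = b.
  move=> va wb vw; apply: (@cvg_unique G hG (v @ U) _ a b) => //=.
  apply: cvg_trans wb; apply: near_eq_cvg.
  by apply: filterS vw => k ->.
have two0 k : (0 : R) < 2 ^+ k by rewrite exprn_gt0.
have floor_pow l k (t : R) : 0 <= t -> t * 2 ^+ l <= 1 ->
    exists2 j, Num.floor (t * 2 ^+ (k + l)) = Posz j & (j <= 2 ^ k)%N.
  move=> t0 tl.
  have f0 : 0 <= Num.floor (t * 2 ^+ (k + l)) by rewrite floor_ge0 mulr_ge0 // ltW.
  case e : (Num.floor _) f0 => [j|//] _; exists j => //.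
  have := ge_floor (t * 2 ^+ (k + l)); rewrite e /= => h.
  rewrite -(ler_nat R) natrX; apply: le_trans h _.
  by rewrite exprD mulrCA; have := two0 k; nra.
have near_ge l (P : nat -> Prop) : (forall k, P (k + l)%N) -> \forall k \near U, P k.
  move=> HP; apply: oU; exists l => // k /= lk.
  by rewrite -(subnK lk).
have hom s t : delta (s + t) = (delta s * delta t)%g.
  (* the defect of additivity caused by integer parts: it is 1 or [g k] *)
  pose v k := ((u s k * u t k)^-1 * u (s + t) k)%g.
  have v1 : v @ U --> (1%g : G).
    move=> W W1; have [l hl] := g_small W1.
    apply: (near_ge l) => k.
    suff : W (v (k + l)%N) by [].
    have : v (k + l)%N = 1%g \/ v (k + l)%N = g (k + l)%N.
      rewrite /v /u; set K := (k + l)%N.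
      have f1 := ge_floor (s * 2 ^+ K); have f2 := floorD1_gt (s * 2 ^+ K).
      have f3 := ge_floor (t * 2 ^+ K); have f4 := floorD1_gt (t * 2 ^+ K).
      have f5 := ge_floor ((s + t) * 2 ^+ K).
      have f6 := floorD1_gt ((s + t) * 2 ^+ K).
      move: f1 f2 f3 f4 f5 f6; set a := Num.floor (s * _); set b := Num.floor (t * _).
      set c := Num.floor _; rewrite mulrDl !intrD => f1 f2 f3 f4 f5 f6.
      have h1 : (a + b)%:~R < (c + 1)%:~R :> R by rewrite !intrD; lra.
      have h2 : c%:~R < (a + b + 2)%:~R :> R by rewrite !intrD; lra.
      rewrite !ltr_int in h1 h2.
      have [e|e] : c = a + b \/ c = a + b + 1 by lia.
        by left; rewrite e zexpgD mulVg.
      by right; rewrite e !zexpgD mulKg.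
    case=> ->; first exact: nbhs_singleton.
    by have := hl k 1%N (expn_gt0 _ _); rewrite expg1.
  rewrite -[RHS]mulg1.
  apply: uniq (hd (s + t)) (cvg_mulg _ (cvg_mulg _ (hd s) (hd t)) v1) _.
  by apply: filterS filterT => k _; rewrite /v mulVKg.
have d0 : delta 0 = 1%g.
  by apply: (mulgI (delta 0)); rewrite -hom addr0 mulg1.
have dN t : delta (- t) = ((delta t)^-1)%g.
  by apply/esym/mulg1_eq; rewrite -hom subrr d0.
have c0 W : nbhs (1%g : G) W -> nbhs (0 : R) [set t | W (delta t)].
  move=> W1.
  have W1' : nbhs (1%g : G) ((fun x => x^-1)%g @^-1` W).
    by apply: (@invg_continuous G 1%g); rewrite invg1.
  have [C [clC C1 CW]] := closed_nbhs_in (filterI W1 W1').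
  have [l hl] := g_small C1.
  have pos t : 0 <= t -> t * 2 ^+ l <= 1 -> C (delta t).
    move=> t0 tl; apply: (closed_cvg _ clC _ _ (hd t)).
    apply: (near_ge l) => k; have [j ej jk] := floor_pow l k t t0 tl.
    by rewrite /u ej; exact: hl.
  have e0 : (0 : R) < (2 ^+ l)^-1 by rewrite invr_gt0.
  apply/nbhs_normP; exists (2 ^+ l)^-1 => // t; rewrite /= sub0r normrN => tl.
  have tl' : `|t| * 2 ^+ l <= 1 by rewrite -ler_pdivlMr // mul1r ltW.
  have [t0|t0] := leP 0 t.
    by have [] := CW _ (pos t t0 (ltac:(by rewrite ger0_norm in tl'))).
  rewrite ltr0_norm // in tl'.
  have [_] := CW _ (pos (- t) (ltac:(by rewrite oppr_ge0 ltW)) tl').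
  by rewrite /preimage /= dN invgK.
exists delta; split=> //.
- move=> s W sW.
  have : nbhs (1%g : G) [set x | W (x * delta s)%g].
    have cm : continuous (fun x : G => x * delta s)%g.
      by apply: cts_mulg; [exact: cts_id|exact: cts_cst].
    by apply: (nbhs_preimage cm); rewrite mul1g.
  move=> /c0; have ct : continuous (fun t : R => t - s).
    by apply: ctsB; [exact: cts_id|exact: cts_cst].
  move=> n0; have : nbhs s ((fun t : R => t - s) @^-1` [set t | W (delta t * delta s)%g]).
    by apply: nbhs_preimage => //; rewrite subrr.
  by apply: filterS => t /=; rewrite -hom subrK.
- apply: uniq (hd 1) (cvg_cst _) _; apply: filterS filterT => k _.
  rewrite /u mul1r (_ : 2 ^+ k = (2 ^ k)%:Z%:~R) ?intrKfloor /=.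
    by have := g_root k 0; rewrite addn0.
  by rewrite -pmulrn natrX.
- move=> C clC hC t /andP[t0 t1]; apply: (closed_cvg _ clC _ _ (hd t)).
  apply: (near_ge 0%N) => k.
  have [|j ej jk] := floor_pow 0%N k t t0; first by rewrite expr0 mulr1.
  by rewrite /u ej; apply: hC; rewrite addn0.
- move=> h hc t; apply: uniq (cvg_mulg _ (cvg_cst h) (hd t)) (cvg_mulg _ (hd t) (cvg_cst h)) _.
  apply: filterS filterT => k _; rewrite /u.
  have cx i : (h * g k ^+ i = g k ^+ i * h)%g by apply: commuteX; exact: hc.
  case: (Num.floor _) => i /=; first exact: cx.
  by apply: commuteV; exact: cx.
Qed.

End DyadicLimit.

(** * A circle in a compact connected Lie group *)

Section CircleSubgroup.
Variables (R : realType) (n : nat) (G : topologicalGroupType).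
Hypotheses (G_lie : lie_group R n G) (cG : compact [set: G]).
Local Notation rV := 'rV[R]_n.

Let hG : hausdorff_space G. Proof. by have [[]] := G_lie. Qed.

Definition one_parameter (d : R -> G) :=
  continuous d /\ forall s t, d (s + t) = (d s * d t)%g.

Lemma one_parameter0 d : one_parameter d -> d 0 = 1%g.
Proof. by move=> [_ dD]; apply: (mulgI (d 0)); rewrite -dD addr0 mulg1. Qed.

Lemma one_parameterN d t : one_parameter d -> d (- t) = ((d t)^-1)%g.
Proof.
move=> dd; have [_ dD] := dd.
by apply/esym/mulg1_eq; rewrite -dD subrr one_parameter0.
Qed.

Lemma cts_invg (T : topologicalType) (f : T -> G) :
  continuous f -> continuous (fun x => (f x)^-1)%g.
Proof. by move=> cf; apply: (@cts_comp _ _ _ (fun x : G => x^-1)%g _ (@invg_continuous G) cf). Qed.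

Lemma conjugation_small (W : set G) : nbhs (1%g : G) W ->
  \forall x \near (1%g : G), forall h, W (h * x * h^-1)%g.
Proof.
move=> W1; have : \forall x \near (1%g : G), [set: G] `<=` (fun h => W (h * x * h^-1)%g).
  apply: ((compact_near_coveringP _).1 cG) => h _.
  have cc : continuous (fun p : G * G => p.1 * p.2 * p.1^-1)%g.
    apply: cts_mulg; first apply: cts_mulg.
    - by apply: cts_fst; exact: cts_id.
    - by apply: cts_snd; exact: cts_id.
    - by apply: cts_invg; apply: cts_fst; exact: cts_id.
  have := nbhs_preimage (x := (h, 1%g)) (A := W) cc; rewrite /= mulg1 mulgV.
  by move=> /(_ W1) [[U V] /= UV sub]; exists (U, V).
by apply: filterS => x H h; exact: H.
Qed.

(** The iterated square roots of [c] provide the sequence of [dyadic_limit].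
    They commute with the centralizer of [c] if they are small enough for their
    conjugates to stay in the chart, which compactness allows uniformly. *)
Lemma one_parameter_subgroups (W : set G) : nbhs (1%g : G) W ->
  exists2 W', nbhs (1%g : G) W' & forall c, W' c -> exists d, [/\ one_parameter d,
    d 1 = c, forall t : R, 0 <= t <= 1 -> W (d t) &
    forall h, (h * c = c * h)%g -> forall t, (h * d t = d t * h)%g].
Proof.
move=> W1; have [X [E [dom [r [r0 E0 EK XK [Eb Xn domM aa]]]]]] := lie_group_chart G_lie.
have [C [clC C1 CW]] := closed_nbhs_in cG hG W1.
have [r1 r10 hr1] := Eb _ C1.
have [r2 r20 hr2] := Eb _ (conjugation_small (Xn r r0)).
pose e := Num.min (r / 8) (Num.min (r1 / 4) r2).
have e0 : 0 < e by rewrite !lt_min r20 !divr_gt0.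
have er : e <= r / 8 by rewrite ge_min lexx.
have er1 : e <= r1 / 4 by rewrite !ge_min lexx orbT.
have er2 : e <= r2 by rewrite !ge_min lexx !orbT.
exists [set g | dom g /\ `|X g| < e]; first exact: Xn.
move=> c [dc]; set v := X c => ve; have Ev : E v = c by exact: XK.
have v0 := normr_ge0 v.
have vr : `|v| < r by lra.
have v8 : 8 * `|v| < r by lra.
pose g k := E (iroot E v k).
have g_root k l : (g (k + l) ^+ (2 ^ k) = g l)%g.
  exact: (iroot_pow r0 E0 EK XK domM aa k l vr).
have g_small W2 : nbhs (1%g : G) W2 ->
    exists l, forall k j, (j <= 2 ^ k)%N -> W2 (g (k + l) ^+ j)%g.
  move=> /Eb [r3 r30 hr3].
  have e3 : 0 < r3 / (4 * r) by rewrite divr_gt0 // mulr_gt0.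
  have [l _ hl] := @cvg_expr R (2 / 3) (ltac:(rewrite ger0_norm; lra)) _
    (nbhsx_ballx (0 : R) _ e3).
  have l0 : (0 : R) <= (2 / 3) ^+ l by rewrite exprn_ge0 //; lra.
  have := hl l (leqnn l); rewrite /ball /= sub0r normrN ger0_norm // => l3.
  exists l => k j jk.
  have [w [wb ->]] := iroot_powers_small r0 E0 EK XK domM aa l v8 jk.
  apply: hr3; apply: le_lt_trans wb _.
  move: l3; rewrite ltr_pdivlMr; last by rewrite mulr_gt0.
  nra.
have [d [cd dD d1 dC dcomm]] := dyadic_limit R cG hG g_root g_small.
exists d; split=> //.
- by rewrite d1.
- move=> t t01; apply: CW; apply: dC => // k j jk.
  have [w [wb]] := iroot_powers_small r0 E0 EK XK domM aa 0 v8 jk.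
  rewrite addn0 => ->; apply: hr1; apply: le_lt_trans wb _.
  by rewrite expr0 mul1r; lra.
- move=> h hc; apply: dcomm => k.
  apply: (iroot_commute r0 E0 EK XK domM aa) => //; first by rewrite Ev.
  move=> w wv; have [] := hr2 w _ h; first by lra.
  by move=> dw Xw; exists (X (h * E w * h^-1)%g) => //; rewrite XK.
Qed.

Hypothesis G_connected : connected [set: G].
Hypothesis G_nontrivial : exists g : G, g <> 1%g.

(** Otherwise the identity would be an isolated point of a connected group. *)
Lemma nontrivial_near_1 (W : set G) : nbhs (1%g : G) W -> exists2 c, W c & c <> 1%g.
Proof.
move=> W1; apply: contrapT => no; have [g g1] := G_nontrivial.
have sub : W `<=` [set 1%g].
  by move=> c Wc; apply: contrapT => c1; apply: no; exists c.
have o1 : open [set (1%g : G)].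
  by rewrite openE => _ ->; exact: filterS sub W1.
have e : [set (1%g : G)] = [set: G].
  apply: G_connected; first by exists 1%g.
  - by exists [set 1%g] => //; rewrite setTI.
  - exists [set 1%g]; rewrite ?setTI //.
    exact/accessible_closed_set1/hausdorff_accessible.
by have : [set (1%g : G)] g by rewrite e.
Qed.

(** The values of [d] at integers accumulate at some point [p] of the compact
    group; two of them near [p] have a quotient near the identity. *)
Lemma one_parameter_recurrent d (W : set G) : one_parameter d ->
  nbhs (1%g : G) W -> exists2 T : R, 1 <= T & W (d T).
Proof.
move=> dd W1; have [cd dD] := dd.
have [p [_ clp]] := @cG ((fun k : nat => d k%:R) @ \oo) _ filterT.
have cq : continuous (fun q : G * G => q.1 * q.2^-1)%g.
  apply: cts_mulg; first by apply: cts_fst; exact: cts_id.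
  by apply: cts_invg; apply: cts_snd; exact: cts_id.
have [[U V] /= [Up Vp] UV] : nbhs (p, p) ((fun q : G * G => q.1 * q.2^-1)%g @^-1` W).
  by apply: (nbhs_preimage cq); rewrite /= mulgV.
have ge k : ((fun k : nat => d k%:R) @ \oo) [set d j%:R | j in [set j | (k <= j)%N]].
  by exists k => // j /= kj; exists j.
have [_ [[i _ <-] Vi]] := clp _ V (ge 0%N) Vp.
have [_ [[j /= ij <-] Uj]] := clp _ U (ge i.+1) Up.
exists (j - i)%:R; first by rewrite ler1n subn_gt0.
have := UV (d j%:R, d i%:R) (conj Uj Vi).
by rewrite /preimage /= -one_parameterN // -dD natrB // ltnW.
Qed.

(** Take a one-parameter subgroup [gam] with [gam 1 <> 1], a time [T] at which it
    is very close to the identity, and the short one-parameter subgroup [del]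
    that joins the identity to [gam T]. They commute, so that
    [gam (s T) (del s)^-1] is a one-parameter subgroup, which is trivial at
    [s = 1]; it is not constant because [del] stays too close to the identity to
    follow [gam]. *)
Lemma periodic_one_parameter : exists s : R -> G, [/\ one_parameter s,
  s 1 = 1%g & exists t, s t <> 1%g].
Proof.
have [W0 W01 h0] := one_parameter_subgroups (filterT : nbhs (1%g : G) setT).
have [c W0c c1] := nontrivial_near_1 W01.
have [gam [hgam gam1 _ _]] := h0 c W0c.
have nc : nbhs (1%g : G) (~` [set c]).
  apply: open_nbhs_nbhs; split; last by move=> e; apply: c1.
  by apply: closed_openC; exact/accessible_closed_set1/hausdorff_accessible.
have [W' W'1 h'] := one_parameter_subgroups nc.
have [T T1 W'T] := one_parameter_recurrent hgam W'1.
have [del [hdel del1 delc comm]] := h' _ W'T.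
have [cg gD] := hgam; have [cd dD] := hdel.
have T0 : 0 < T by lra.
have gcomm s t : (gam s * del t = del t * gam s)%g.
  by apply: comm; rewrite -!gD addrC.
exists (fun s : R => gam (s * T)%R * del (- s)%R)%g; split.
- split.
    apply: cts_mulg; [apply: (cts_comp cg)|apply: (cts_comp cd)].
      by apply: ctsM; [exact: cts_id|exact: cts_cst].
    by apply: ctsN; exact: cts_id.
  move=> s t; rewrite mulrDl opprD gD dD !mulgA; congr (_ * _)%g.
  by rewrite -!mulgA gcomm.
- by rewrite mul1r one_parameterN // del1 mulgV.
- exists T^-1; rewrite mulVf ?gt_eqF // one_parameterN // gam1 => e.
  have Tb : 0 <= T^-1 <= 1 by rewrite invr_ge0 ltW // invf_le1.
  have := delc _ Tb; apply => /=.
  by rewrite -[RHS](mulgVK (del T^-1)) e mul1g.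
Qed.

(** The kernel of a nonconstant one-parameter subgroup is a proper closed
    subgroup of the line; if it contains 1, it is generated by its least positive
    element [p], and rescaling time by [p] gives the kernel of integers. *)
Lemma circle_subgroup : exists s : R -> G, one_parameter s /\
  forall t, s t = 1%g <-> exists k : int, t = k%:~R.
Proof.
have [s [hs s1 [t0 st0]]] := periodic_one_parameter.
have [cs sD] := hs.
pose H := [set t | s t = 1%g].
have clH : closed H.
  by apply: closed_eq_fun => //; exact: cts_cst.
have HD a b : H a -> H b -> H (a + b) by rewrite /H /= sD => -> ->; rewrite mulg1.
have HN a : H a -> H (- a) by rewrite /H /= one_parameterN // => ->; rewrite invg1.
have Hz (z : int) a : H a -> H (z%:~R * a).
  move=> Ha; have Hn (k : nat) : H (k%:R * a).
    elim: k => [|k IH]; first by rewrite mul0r /H /= one_parameter0.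
    by rewrite -natr1 mulrDl mul1r; exact: HD.
  case: z => k; first exact: Hn.
  by rewrite NegzE mulrNz mulNr; apply: HN; exact: Hn.
(* the least positive period is the infimum of the positive periods *)
pose P := H `&` [set t | 0 < t].
have P1 : P 1 by split=> //=.
have lbP : lbound P 0 by move=> t [_ /= /ltW].
have hiP : has_inf P by split; [exists 1|exists 0].
pose p := inf P.
have p0 : 0 <= p by apply: lb_le_inf => //; exists 1.
have adh e : 0 < e -> exists2 t, P t & t < p + e by move=> e0; exact: inf_adherent.
have Hfloor a b : 0 < a -> H a -> 0 <= b - (Num.floor (b / a))%:~R * a < a.
  move=> a0 _; have f1 := ge_floor (b / a); have f2 := floorD1_gt (b / a).
  move: f1 f2; rewrite intrD ler_pdivlMr // ltr_pdivrMr // => f1 f2.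
  by apply/andP; split; lra.
have p_gt0 : 0 < p.
  rewrite lt_neqAle p0 andbT; apply/eqP => pe.
  suff : H t0 by [].
  apply: clH => B /nbhs_normP [e /= e0 hB].
  have [a [Ha a0]] := adh e e0; rewrite -pe add0r => ae.
  have /andP[b1 b2] := Hfloor a t0 a0 Ha.
  exists ((Num.floor (t0 / a))%:~R * a); split; first exact: Hz.
  by apply: hB; rewrite /= ger0_norm //; exact: lt_trans b2 ae.
have Hp : H p.
  apply: clH => B /nbhs_normP [e /= e0 hB].
  have [a Pa ae] := adh e e0; exists a; split; first by case: Pa.
  apply: hB; rewrite /= distrC ger0_norm; first by lra.
  by rewrite subr_ge0; apply: ge_inf => //; exists 0.
exists (fun t => s (t * p)); split.
  split; last by move=> a b; rewrite mulrDl sD.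
  by apply: (cts_comp cs); apply: ctsM; [exact: cts_id|exact: cts_cst].
move=> t; split=> [st|[k ->]]; last exact: Hz.
have /andP[b1 b2] := Hfloor p (t * p) p_gt0 Hp.
rewrite mulfK ?gt_eqF // in b1 b2; exists (Num.floor t).
apply: (mulIf (lt0r_neq0 p_gt0)); apply/eqP; rewrite -subr_eq0.
have Hb : H (t * p - (Num.floor t)%:~R * p).
  by apply: HD => //; apply: HN; exact: Hz.
rewrite eq_le b1 andbT leNgt; apply/negP => bp.
have : p <= t * p - (Num.floor t)%:~R * p by apply: ge_inf => //; exists 0.
lra.
Qed.

End CircleSubgroup.

(** * Angles whose multiples hit prescribed arcs *)

Section NumberTheory.
Variable R : realType.

Definition infinitely_often (N : nat -> Prop) := forall k, exists2 n, (k <= n)%N & N n.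

(** The arcs [(p.1, p.2)], given by center and half-width, are treated one by
    one. If [n] is large, the multiples [n t] run around the circle while [t] is in
    the current interval, so that some smaller interval of [t] is sent inside the
    arc by [n]. *)
Lemma simultaneous_hitting (N : nat -> Prop) (l : seq (R * R)) (a b : R) :
  infinitely_often N -> (forall p, p \in l -> 0 < p.2) -> a < b ->
  exists a' b', [/\ a <= a', a' < b', b' <= b &
    forall t, a' < t < b' -> forall p, p \in l ->
      exists2 n, N n & exists k : int, `|n%:R * t - k%:~R - p.1| < p.2].
Proof.
move=> iN; elim: l a b => [|[th et] l IH] a b pos ab.
  by exists a, b; split=> // t _ p; rewrite in_nil.
have et0 : 0 < et by exact: (pos (th, et) (mem_head _ _)).
have [n nk Nn] := iN (Num.truncn (2 / (b - a))).+1.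
have ba : 0 < b - a by rewrite subr_gt0.
have nb : 2 < n%:R * (b - a).
  rewrite -ltr_pdivrMr //; apply: lt_le_trans (truncnS_gt _) _.
  by rewrite ler_nat.
have n0 : (0 : R) < n%:R.
  by have := ler0n R n; nra.
(* [c] is the first solution of [n c = th] modulo 1 beyond [a]; it lies before
   [b] because [n * (b - a) > 2] *)
pose k := Num.floor (n%:R * a - th) + 1.
pose c := (th + k%:~R) / n%:R.
have f1 := ge_floor (n%:R * a - th); have f2 := floorD1_gt (n%:R * a - th).
have cn : n%:R * c = th + k%:~R by rewrite /c mulrCA divff ?mulr1 ?gt_eqF.
have ca : a < c.
  by rewrite /c ltr_pdivlMr // mulrC /k; move: f2; lra.
have cb : c < b.
  rewrite /c ltr_pdivrMr // mulrC /k intrD; move: f1; lra.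
pose d := Num.min (et / n%:R) (Num.min (c - a) (b - c)).
have d0 : 0 < d by rewrite !lt_min !subr_gt0 ca cb divr_gt0.
have de : d * n%:R <= et by rewrite -ler_pdivlMr // ge_min lexx.
have da : d <= c - a by rewrite !ge_min lexx orbT.
have db : d <= b - c by rewrite !ge_min lexx !orbT.
have [|a' [b' [h1 h2 h3 h4]]] := IH (c - d) (c + d) _ (ltac:(lra)).
  by move=> p pl; apply: pos; rewrite inE pl orbT.
exists a', b'; split=> //; try lra.
move=> t tab p; rewrite inE => /orP[/eqP ->|pl]; last exact: h4.
exists n => //; exists k => /=.
have -> : n%:R * t - k%:~R - th = n%:R * (t - c) by rewrite mulrBr cn; ring.
rewrite normrM gtr0_norm //; apply: lt_le_trans de.
rewrite mulrC ltr_pM2r // ltr_norml; move/andP: tab => [? ?]; apply/andP; split; lra.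
Qed.

Lemma rational_between (a b : R) : 0 <= a -> a < b ->
  exists p q : nat, [/\ (0 < q)%N, a < p%:R / q%:R & p%:R / q%:R < b].
Proof.
move=> a0 ab; have ba : 0 < b - a by rewrite subr_gt0.
pose q := (Num.truncn (b - a)^-1).+1.
have q0 : (0 : R) < q%:R by rewrite ltr0n.
have qb : 1 < q%:R * (b - a).
  by rewrite -ltr_pdivrMr // mul1r; exact: truncnS_gt.
have g0 : 0 <= a * q%:R by rewrite mulr_ge0.
have /andP[t1 t2] := truncn_itv g0.
exists (Num.truncn (a * q%:R)).+1, q; split=> //.
  by rewrite ltr_pdivlMr.
by rewrite ltr_pdivrMr //; move: t1 t2; rewrite -natr1; nra.
Qed.

End NumberTheory.

(** * Perturbations and limits of maps of a compact space *)

Section Dynamics.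
Variables (R : realType) (Y : topologicalType) (W : normedModType R).
Variable Phi : Y -> W.
Hypotheses (cY : compact [set: Y]) (cPhi : continuous Phi) (iPhi : injective Phi).
Local Notation dist y z := (`|Phi y - Phi z|).

Lemma embedding_base (y : Y) (V : set Y) : nbhs y V ->
  exists2 e : R, 0 < e & forall z, dist z y < e -> V z.
Proof.
move=> yV; pose K := ~` V°.
have cK : compact K.
  apply: subclosed_compact _ cY _ => //; apply: open_closedC; exact: open_interior.
have [K0|nK] := pselect (K !=set0); last first.
  exists 1 => // z _; apply: interior_subset; apply: contrapT => nz.
  by apply: nK; exists z.
have cf : continuous (fun z => dist z y).
  by apply: cts_norm; apply: ctsB => //; exact: cts_cst.
have [c] := compact_EVT_min K0 cK (continuous_subspaceT cf).
rewrite inE => Kc cmin; exists (dist c y).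
  rewrite normr_gt0 subr_eq0; apply/eqP => /iPhi e.
  by apply: Kc; rewrite e; exact: nbhs_singleton (nbhs_interior yV).
move=> z zc; apply: interior_subset; apply: contrapT => nz.
by have := cmin z; rewrite inE => /(_ nz); rewrite leNgt zc.
Qed.

(** For one point [y0], a time [n] with [iter n S y0] in [V] works for all nearby
    points and all maps close to [S]; compactness of [Y] makes this uniform. *)
Lemma robust_hitting (S : Y -> Y) (N : nat -> Prop) (V : set Y) :
  continuous S -> open V -> (forall y, exists2 n, N n & V (iter n S y)) ->
  exists2 e : R, 0 < e & forall S' : Y -> Y, (forall y, dist (S' y) (S y) <= e) ->
    forall y, exists2 n, N n & V (iter n S' y).
Proof.
move=> cS oV hit.
have loc n y0 (V0 : set Y) : nbhs (iter n S y0) V0 -> exists e : R, exists2 U : set Y,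
    nbhs y0 U & 0 < e /\ forall (S' : Y -> Y) y, (forall y, dist (S' y) (S y) <= e) ->
      U y -> V0 (iter n S' y).
  elim: n V0 => [|n IH] V0 nV0.
    by exists 1; exists V0 => //; split.
  have [e e0 he] := embedding_base nV0.
  have [|e1 [U yU [e10 hU]]] := IH [set z | dist (S z) (iter n.+1 S y0) < e / 2].
    apply: open_nbhs_nbhs; split; last by rewrite /= subrr normr0 divr_gt0.
    apply: open_lt_fun; last exact: cts_cst.
    by apply: cts_norm; apply: ctsB; [exact: cts_comp|exact: cts_cst].
  exists (Num.min e1 (e / 3)); exists U => //; split.
    by rewrite lt_min e10 divr_gt0.
  move=> S' y S'S Uy; apply: he => /=.
  have h1 z : dist (S' z) (S z) <= e1 by apply: le_trans (S'S z) _; rewrite ge_min lexx.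
  have h2 z : dist (S' z) (S z) <= e / 3.
    by apply: le_trans (S'S z) _; rewrite ge_min lexx orbT.
  have := hU S' y h1 Uy; have := h2 (iter n S' y) => /= h3 h4.
  rewrite -(subrK (Phi (S (iter n S' y))) (Phi (S' _))) -addrA.
  by rewrite (le_lt_trans (ler_normD _ _)) //; lra.
have ex (y0 : Y) : exists p : R * set Y, [/\ 0 < p.1, nbhs y0 p.2 &
    forall S' : Y -> Y, (forall y, dist (S' y) (S y) <= p.1) ->
      forall y, p.2 y -> exists2 n, N n & V (iter n S' y)].
  have [n Nn Vn] := hit y0.
  have [e [U yU [e0 hU]]] := loc n y0 V (open_nbhs_nbhs (conj oV Vn)).
  by exists (e, U); split=> //= S' S'S y Uy; exists n => //; exact: hU.
have [p hp] := choice ex.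
have [s [_ scov]] := finite_subcover cY (B := fun y => (p y).2)
  (fun y _ => let: And3 _ h _ := hp y in h).
have [e e0 he] : exists2 e : R, 0 < e & forall y, y \in s -> e <= (p y).1.
  elim: s {scov} => [|y s [e e0 IH]]; first by exists 1.
  have [py _ _] := hp y; exists (Num.min e (p y).1); first by rewrite lt_min e0.
  move=> z; rewrite inE => /orP[/eqP ->|zs]; first by rewrite ge_min lexx orbT.
  by rewrite ge_min IH.
exists e => // S' S'S y; have [z zs zy] := scov y I.
have [_ _ hz] := hp z; apply: hz zy => w; exact: le_trans (S'S w) (he z zs).
Qed.

Lemma uniform_limit (T : topologicalType) (u : nat -> T -> Y) (e : nat -> R) :
  (forall k, continuous (u k)) -> (forall d : R, 0 < d -> exists k, e k < d) ->
  (forall k l z, (k <= l)%N -> dist (u l z) (u k z) <= e k) ->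
  exists v : T -> Y, continuous v /\ forall k z, dist (v z) (u k z) <= e k.
Proof.
move=> cu e0 ule.
have cd w : continuous (fun y => dist y w).
  by apply: cts_norm; apply: ctsB => //; exact: cts_cst.
have ex z : exists y, forall k, dist y (u k z) <= e k.
  have [y [_ cly]] := @cY ((fun k => u k z) @ \oo) _ filterT.
  exists y => k; rewrite leNgt; apply/negP => h.
  have o : open [set y | e k < dist y (u k z)].
    by apply: open_lt_fun; [exact: cts_cst|exact: cd].
  have [_ [[l /= kl <-] /=]] := cly [set u l z | l in [set l | (k <= l)%N]] _
    (ltac:(by exists k => // l kl; exists l)) (open_nbhs_nbhs (conj o h)).
  by rewrite ltNge ule.
have [v hv] := choice ex; exists v; split=> // z V nV.
have [d d0 hd] := embedding_base nV.
have [|k ek] := e0 (d / 3); first by rewrite divr_gt0.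
have o : open [set z' | dist (u k z') (u k z) < d / 3].
  by apply: open_lt_fun; [exact: (cts_comp (cd _) (cu k))|exact: cts_cst].
have h0 : dist (u k z) (u k z) < d / 3 by rewrite subrr normr0 divr_gt0.
apply: filterS (open_nbhs_nbhs (conj o h0)) => z' /= hz'; apply: hd.
have h1 := hv z' k; have h2 := hv z k.
have -> : Phi (v z') - Phi (v z) = (Phi (v z') - Phi (u k z')) +
    (Phi (u k z') - Phi (u k z)) - (Phi (v z) - Phi (u k z)).
  by rewrite addrA subrK opprB addrA subrK.
apply: le_lt_trans (ler_normB _ _) _.
by have := ler_normD (Phi (v z') - Phi (u k z')) (Phi (u k z') - Phi (u k z)); lra.
Qed.

(** [A'] is close to [A k] at the point [B k y], where [A k] takes the value [y];
    and [A' (B k y)] tends to [A' (B' y)] because [A'] is continuous. *)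
Lemma limit_cancel (A B : nat -> Y -> Y) (A' B' : Y -> Y) (e : nat -> R) :
  (forall d : R, 0 < d -> exists k, e k < d) ->
  (forall k, cancel (B k) (A k)) -> continuous A' ->
  (forall k y, dist (A' y) (A k y) <= e k) ->
  (forall k y, dist (B' y) (B k y) <= e k) -> cancel B' A'.
Proof.
move=> e0 BK cA hA hB y; apply: iPhi; apply/eqP; rewrite -subr_eq0 -normr_le0.
apply/ler_addgt0Pl => d d0; rewrite addr0.
have o : open [set z | dist (A' z) (A' (B' y)) < d / 2].
  apply: open_lt_fun; last exact: cts_cst.
  by apply: cts_norm; apply: ctsB; [exact: cts_comp|exact: cts_cst].
have h0 : dist (A' (B' y)) (A' (B' y)) < d / 2 by rewrite subrr normr0 divr_gt0.
have [d' d'0 hd'] := embedding_base (open_nbhs_nbhs (conj o h0)).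
have [|k] := e0 (Num.min d' (d / 2)); first by rewrite lt_min d'0 divr_gt0.
rewrite lt_min => /andP[k1 k2].
have /= h1 : dist (A' (B k y)) (A' (B' y)) < d / 2.
  by apply: hd'; rewrite distrC; exact: le_lt_trans (hB k y) k1.
have h2 := hA k (B k y); rewrite BK in h2.
rewrite -(subrK (Phi (A' (B k y))) (Phi (A' (B' y)))) -addrA.
by rewrite (le_trans (ler_normD _ _)) // distrC; lra.
Qed.

End Dynamics.

(** * Successive conjugations of rotations *)

Section FastConjugation.
Variables (R : realType) (Y : topologicalType) (W : normedModType R).
Variables (Phi : Y -> W) (phi : R -> Y -> Y).
Hypotheses (cY : compact [set: Y]) (cPhi : continuous Phi) (iPhi : injective Phi).
Hypothesis flow : circle_flow phi.
Hypothesis conj_meets : forall (q : nat) (V : set Y), (0 < q)%N ->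
  open V -> V !=set0 -> exists g, [/\ homeomorphism g,
    forall y, g (phi q%:R^-1 y) = phi q%:R^-1 (g y) &
    forall y, exists t, V (g (phi t y))].
Local Notation dist y z := (`|Phi y - Phi z|).

(** One step of the construction: the conjugacy [h] and its inverse, the angle
    [num / den], an isotopy from the identity to the conjugated rotation with the
    inverse isotopy, and the distance within which all later steps must remain
    for the requirements met so far to survive. *)
Record stage := Stage {
  conjug : Y -> Y;
  conjugV : Y -> Y;
  num : nat;
  den : nat;
  isot : R -> Y -> Y;
  isotV : R -> Y -> Y;
  tol : R
}.

Record good_stage (x : stage) : Prop := GoodStage {
  conjug_cont : continuous (conjug x);
  conjugV_cont : continuous (conjugV x);
  conjugK : cancel (conjug x) (conjugV x);
  conjugVK : cancel (conjugV x) (conjug x);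
  den_gt0 : (0 < den x)%N;
  isot_cont : continuous (fun p : R * Y => isot x p.1 p.2);
  isotV_cont : continuous (fun p : R * Y => isotV x p.1 p.2);
  isotK : forall s, cancel (isot x s) (isotV x s);
  isotVK : forall s, cancel (isotV x s) (isot x s);
  isot0 : forall y, isot x 0 y = y;
  isot1 : forall y, isot x 1 y = conjug x (phi ((num x)%:R / (den x)%:R) (conjugV x y));
  tol_gt0 : 0 < tol x
}.

Lemma uniformly_small (H : R -> R -> Y -> R) (e : R) :
  continuous (fun p : R * (R * Y) => H p.1 p.2.1 p.2.2) ->
  (forall s y, H 0 s y = 0) -> 0 < e ->
  exists2 d : R, 0 < d & forall r s y, `|r| < d -> 0 <= s <= 1 -> H r s y < e.
Proof.
move=> cH H0 e0; have cK := compact_setX (@segment_compact R 0 1) cY.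
have : \forall r \near (0 : R), `[0%R, 1%R]%classic `*` [set: Y] `<=`
    (fun p => H r p.1 p.2 < e).
  apply: ((compact_near_coveringP _).1 cK R (nbhs (0 : R))
    (fun r p => H r p.1 p.2 < e) (nbhs_filter _)) => -[s y] _.
  have o : open [set p : (R * Y) * R | H p.2 p.1.1 p.1.2 < e].
    apply: open_lt_fun; last exact: cts_cst.
    apply: (@cts_comp _ _ _ (fun p : R * (R * Y) => H p.1 p.2.1 p.2.2)
      (fun p : (R * Y) * R => (p.2, p.1)) cH).
    by apply: cts_pair; [apply: cts_snd|apply: cts_fst]; exact: cts_id.
  have h0 : H 0 s y < e by rewrite H0.
  have := open_nbhs_nbhs (conj o h0 : open_nbhs ((s, y), 0) _).
  by move=> [[U V] /= UV sub]; exists (U, V).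
move=> /nbhs_normP [d /= d0 hd]; exists d => // r s y rd s01.
by have := hd r; rewrite /= sub0r normrN => /(_ rd (s, y)); apply; split.
Qed.

(** The new conjugacy is [k = h g], where [g] commutes with the current rotation
    of angle [t] and every orbit of the flow meets the preimage of [V] by [k].
    Since [k] conjugates the rotation of angle [t] to the same map as [h], the
    rotation of angle [t1] conjugated by [k] tends to the current map as [t1]
    tends to [t], however wild [g] is. By compactness, an orbit is in the
    preimage of [V] for an angle in one of finitely many arcs, and
    [simultaneous_hitting] gives rational [t1] near [t] whose multiples by
    elements of [N] hit all these arcs. The new isotopy is the old one composed
    with the rotations of angle [s (t1 - t)] conjugated by [k]. *)
Lemma refine_stage (x : stage) (N : nat -> Prop) (V : set Y) :
  good_stage x -> infinitely_often N -> open V -> V !=set0 ->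
  exists x', [/\ good_stage x', tol x' <= tol x / 2,
    forall s y, 0 <= s <= 1 -> dist (isot x' s y) (isot x s y) <= tol x / 2,
    forall s y, 0 <= s <= 1 -> dist (isotV x' s y) (isotV x s y) <= tol x / 2 &
    forall S' : Y -> Y, (forall y, dist (S' y) (isot x' 1 y) <= tol x') ->
      forall y, exists2 n, N n & V (iter n S' y)].
Proof.
case: x => h h' p q F F' e [/= ch ch' hK h'K q0 cF cF' FK F'K F0 F1 e0] iN oV V0.
pose t : R := p%:R / q%:R.
have oV2 : open (h @^-1` V) by apply: open_comp => // y _; exact: ch.
have V20 : h @^-1` V !=set0 by have [v Vv] := V0; exists (h' v); rewrite /preimage /= h'K.
have [g [[cg [g' [cg' gK g'K]]] gq gV]] := conj_meets q0 oV2 V20.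
have gt y : g (phi t y) = phi t (g y).
  rewrite -[phi t y]iter_rotation // -[phi t (g y)]iter_rotation //.
  by elim: (p) => //= k IH; rewrite gq IH.
have gt' y : g' (phi t y) = phi t (g' y) by rewrite -{1}(g'K y) -gt gK.
pose k y := h (g y); pose k' y := g' (h' y).
have ck : continuous k by exact: cts_comp.
have ck' : continuous k' by exact: cts_comp.
have kK : cancel k k' by move=> y; rewrite /k' /k hK gK.
have k'K : cancel k' k by move=> y; rewrite /k' /k g'K h'K.
have kt y : k (phi t (k' y)) = h (phi t (h' y)).
  by rewrite /k /k' gt g'K.
(* around each point, an arc of angles that send the neighbours of this point
   into the preimage of [V] *)
have exw (y0 : Y) : exists w : (R * R) * set Y, [/\ 0 < w.1.2, nbhs y0 w.2 &
    forall y s, w.2 y -> `|s - w.1.1| < w.1.2 -> V (k (phi s y))].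
  have [th Vth] := gV y0.
  have cs : continuous (fun a : R * Y => k (phi a.1 a.2)).
    apply: (cts_comp ck); apply: flow_cont2 => //; [apply: cts_fst|apply: cts_snd];
      exact: cts_id.
  have nV : nbhs (k (phi (th, y0).1 (th, y0).2)) V by exact: open_nbhs_nbhs.
  have [[A B] /= [thA yB] AB] := nbhs_preimage cs nV.
  have [d /= d0 hd] := (nbhs_normP _ _).1 thA.
  exists ((th, d), B); split=> //= y s By sd.
  by apply: (AB (s, y)); split=> //; apply: hd; rewrite /= distrC.
have [w hw] := choice exw.
have [pts [_ cov]] := finite_subcover cY (B := fun y => (w y).2)
  (fun y _ => let: And3 _ u _ := hw y in u).
pose l := [seq (w y).1 | y <- pts].
have lpos a : a \in l -> 0 < a.2 by move=> /mapP[y _ ->]; have [] := hw y.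
(* [P r s] is the conjugated rotation of angle [s * r], which is uniformly close
   to the identity for small [r]; [t1] is chosen so that [t1 - t] is that small *)
pose P (r s : R) y := k (phi (s * r) (k' y)).
have P0 s y : P 0 s y = y by rewrite /P mulr0 flow0 // k'K.
have cP (T : topologicalType) (a b : T -> R) (c : T -> Y) : continuous a ->
    continuous b -> continuous c -> continuous (fun z => P (a z) (b z) (c z)).
  move=> ca cb cc; apply: (cts_comp ck); apply: flow_cont2 => //.
    exact: ctsM.
  exact: cts_comp.
have cid1 : continuous (fun a : R * (R * Y) => a.1) by apply: cts_fst; exact: cts_id.
have cid2 : continuous (fun a : R * (R * Y) => a.2.1).
  by apply: cts_fst; apply: cts_snd; exact: cts_id.
have cid3 : continuous (fun a : R * (R * Y) => a.2.2).
  by apply: cts_snd; apply: cts_snd; exact: cts_id.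
have cF2 (T : topologicalType) (b : T -> R) (c : T -> Y) : continuous b ->
    continuous c -> continuous (fun z => F (b z) (c z)).
  by move=> cb cc; exact: (@cts_comp _ _ _ (fun p : R * Y => F p.1 p.2) _ cF (cts_pair cb cc)).
have cF2' (T : topologicalType) (b : T -> R) (c : T -> Y) : continuous b ->
    continuous c -> continuous (fun z => F' (b z) (c z)).
  by move=> cb cc; exact: (@cts_comp _ _ _ (fun p : R * Y => F' p.1 p.2) _ cF' (cts_pair cb cc)).
have e2 : 0 < e / 2 by rewrite divr_gt0.
have [|||d1 d10 hd1] := @uniformly_small (fun r s y => dist (F s (P r s y)) (F s y)) (e / 2).
- apply: cts_norm; apply: ctsB; apply: (cts_comp cPhi); apply: cF2 => //.
  exact: cP.
- by move=> s y; rewrite P0 subrr normr0.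
- by [].
have [|||d2 d20 hd2] := @uniformly_small
    (fun r s y => dist (P (- r) s (F' s y)) (F' s y)) (e / 2).
- apply: cts_norm; apply: ctsB; apply: (cts_comp cPhi); last exact: cF2'.
  by apply: cP => //; [exact: ctsN|exact: cF2'].
- by move=> s y; rewrite oppr0 P0 subrr normr0.
- by [].
have dmin : t < t + Num.min d1 d2 by rewrite ltrDl lt_min d10.
have [a [b [ta ab bd hit]]] := simultaneous_hitting iN lpos dmin.
have t0 : 0 <= t by rewrite divr_ge0.
have [p1 [q1 [q10 at1 t1b]]] := rational_between (le_trans t0 ta) ab.
pose t1 : R := p1%:R / q1%:R; pose r := t1 - t.
have rd : r < Num.min d1 d2 by rewrite /r /t1; lra.
have r0 : 0 < r by rewrite /r /t1; lra.
have rd1 : `|r| < d1 by rewrite gtr0_norm // (lt_le_trans rd) // ge_min lexx.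
have rd2 : `|r| < d2 by rewrite gtr0_norm // (lt_le_trans rd) // ge_min lexx orbT.
pose G s y := F s (P r s y); pose G' s y := P (- r) s (F' s y).
have PK s : cancel (P r s) (P (- r) s).
  by move=> y; rewrite /P kK -flowD // mulrN addNr flow0 // k'K.
have PNK s : cancel (P (- r) s) (P r s).
  by move=> y; rewrite /P kK -flowD // mulrN subrr flow0 // k'K.
have G1 y : G 1 y = k (phi t1 (k' y)).
  rewrite /G F1 /= -/t -kt /P kK -flowD // mul1r /r; congr (k (phi _ _)); ring.
have iterG1 n y : iter n (G 1) y = k (phi (n%:R * t1) (k' y)).
  elim: n => [|n IH]; first by rewrite mul0r flow0 // k'K.
  by rewrite iterS IH G1 kK -flowD // -natr1; congr (k (phi _ _)); ring.
have cG1 : continuous (G 1).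
  have -> : G 1 = (fun y => k (phi t1 (k' y))) by apply/funext; exact: G1.
  exact: (@cts_comp _ _ _ k _ ck (@cts_comp _ _ _ (phi t1) k' (@flow_cont R Y phi flow t1) ck')).
have hitG y : exists2 n, N n & V (iter n (G 1) y).
  have [z zs wz] := cov (k' y) I; have [_ _ hz] := hw z.
  have t1ab : a < t1 < b by rewrite at1 t1b.
  have [n Nn [m hm]] := hit t1 t1ab _ (map_f (fun y => (w y).1) zs).
  exists n => //; rewrite iterG1.
  have -> : phi (n%:R * t1) (k' y) = phi (n%:R * t1 - m%:~R) (k' y).
    by rewrite flowD // -mulrNz flow_int.
  exact: hz.
have [e1 e10 robust] := robust_hitting cY cPhi iPhi cG1 oV hitG.
exists (Stage k k' p1 q1 G G' (Num.min e1 (e / 2))); split => /=.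
- split=> //=.
  + by apply: cF2; [|apply: cP] => //; try (apply: cts_fst || apply: cts_snd);
      exact: cts_id || exact: cts_cst.
  + apply: cP; first exact: cts_cst.
      by apply: cts_fst; exact: cts_id.
    by apply: cF2'; [apply: cts_fst|apply: cts_snd]; exact: cts_id.
  + by move=> s y; rewrite /G /G' FK PK.
  + by move=> s y; rewrite /G /G' PNK F'K.
  + by move=> y; rewrite /G F0 /P mul0r flow0 // k'K.
  + by rewrite lt_min e10.
- by rewrite ge_min lexx orbT.
- by move=> s y s01; apply: ltW; exact: hd1.
- by move=> s y s01; apply: ltW; exact: hd2.
- move=> S' hS'; apply: robust => y; apply: le_trans (hS' y) _.
  by rewrite ge_min lexx.
Qed.

(** The isotopies converge uniformly for times in [[0, 1]]; precomposing with the
    retraction on this interval gives limits for all times. *)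
Definition clamp (s : R) : R := Num.max 0 (1 - Num.max 0 (1 - s)).

Lemma clamp_itv s : 0 <= clamp s <= 1.
Proof.
rewrite /clamp le_max lexx /= ge_max ler01 /=.
by rewrite lerBlDr lerDl le_max lexx.
Qed.

Lemma clamp_id s : 0 <= s <= 1 -> clamp s = s.
Proof.
move=> /andP[s0 s1]; rewrite /clamp (max_r (x := 0) (y := 1 - s)) ?subr_ge0 //.
by rewrite opprB addrC subrK max_r.
Qed.

Lemma cts_clamp : continuous clamp.
Proof.
apply: cts_max; first exact: cts_cst.
apply: ctsB; first exact: cts_cst.
apply: cts_max; first exact: cts_cst.
by apply: ctsB; [exact: cts_cst|exact: cts_id].
Qed.

(** At stage [k] the requirement [(N k, V k)] is met, with a tolerance at most
    half of the previous one; hence the stages converge uniformly, with their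
    inverses, and the limit is within every tolerance. *)
Lemma generic_homeomorphism (N : nat -> nat -> Prop) (V : nat -> set Y) :
  (forall k, infinitely_often (N k)) -> (forall k, open (V k)) ->
  (forall k, V k !=set0) ->
  exists S : Y -> Y, [/\ homeomorphism S, isotopic_to_id R S &
    forall k y, exists2 n, N k n & V k (iter n S y)].
Proof.
move=> iN oV V0.
pose T := {x : stage | good_stage x}.
pose next (k : nat) (x x' : stage) := [/\ tol x' <= tol x / 2,
    forall s y, 0 <= s <= 1 -> dist (isot x' s y) (isot x s y) <= tol x / 2,
    forall s y, 0 <= s <= 1 -> dist (isotV x' s y) (isotV x s y) <= tol x / 2 &
    forall S' : Y -> Y, (forall y, dist (S' y) (isot x' 1 y) <= tol x') ->
      forall y, exists2 n, N k n & V k (iter n S' y)].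
have ex (a : nat * T) : exists x' : T, next a.1 (sval a.2) (sval x').
  case: a => k [x gx]; have [x' [gx' h1 h2 h3 h4]] := refine_stage gx (iN k) (oV k) (V0 k).
  by exists (exist _ x' gx').
have [f hf] := choice ex.
have cid2 : continuous (fun p : R * Y => p.2) by apply: cts_snd; exact: cts_id.
have g0 : good_stage (Stage id id 0 1 (fun _ => id) (fun _ => id) 1).
  by split=> //=; try exact: cts_id; move=> y; rewrite mul0r flow0.
pose x := fix x k : T := if k is k'.+1 then f (k', x k') else exist _ _ g0.
pose st k := sval (x k).
have gst k : good_stage (st k) by exact: (svalP (x k)).
have hst k : next k (st k) (st k.+1) by exact: (hf (k, x k)).
pose e k := tol (st k).
have e_gt0 k : 0 < e k by exact: tol_gt0.
have eS k : e k.+1 <= e k / 2 by have [] := hst k.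
have e_small (d : R) : 0 < d -> exists k, e k < d.
  move=> d0; have [k _ hk] := @cvg_expr R (2^-1) (ltac:(rewrite ger0_norm; lra)) _
    (nbhsx_ballx (0 : R) d d0).
  exists k; have := hk k (leqnn k).
  rewrite /ball /= sub0r normrN ger0_norm ?exprn_ge0 //; apply: le_lt_trans.
  elim: (k) => [|j IH]; first by rewrite expr0.
  by rewrite exprS; have := eS j; lra.
(* tolerances are at least halved at each stage, so that [e k - e l] bounds the
   distance between the stages [k] and [l] *)
have tele (A : nat -> R -> Y -> Y) :
    (forall k s y, 0 <= s <= 1 -> dist (A k.+1 s y) (A k s y) <= e k / 2) ->
    forall k l (z : R * Y), (k <= l)%N ->
      dist (A l (clamp z.1) z.2) (A k (clamp z.1) z.2) <= e k.
  move=> hA k l z kl; rewrite -(subnK kl).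
  apply: (@le_trans _ _ (e k - e (l - k + k)%N)); last by have := e_gt0 (l - k + k)%N; lra.
  elim: (l - k)%N => [|j IH]; first by rewrite add0n !subrr normr0.
  rewrite addSn; have h1 := hA (j + k)%N _ z.2 (clamp_itv z.1).
  have h2 := eS (j + k)%N.
  rewrite -(subrK (Phi (A (j + k)%N (clamp z.1) z.2)) (Phi (A _ _ _))) -addrA.
  rewrite (le_trans (ler_normD _ _)) //; lra.
have cl1 : continuous (fun z : R * Y => clamp z.1).
  by apply: (cts_comp cts_clamp); apply: cts_fst; exact: cts_id.
have cA (A : R -> Y -> Y) : continuous (fun p : R * Y => A p.1 p.2) ->
    continuous (fun z : R * Y => A (clamp z.1) z.2).
  by move=> c; exact: (@cts_comp _ _ _ (fun p : R * Y => A p.1 p.2) _ c (cts_pair cl1 cid2)).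
have [F [cF hF]] := uniform_limit cY cPhi iPhi
  (u := fun k z => isot (st k) (clamp z.1) z.2)
  (fun k => cA _ (isot_cont (gst k))) e_small
  (tele _ (fun k => let: And4 _ h _ _ := hst k in h)).
have [F' [cF' hF']] := uniform_limit cY cPhi iPhi
  (u := fun k z => isotV (st k) (clamp z.1) z.2)
  (fun k => cA _ (isotV_cont (gst k))) e_small
  (tele _ (fun k => let: And4 _ _ h _ := hst k in h)).
have slice (H : R * Y -> Y) s : continuous H -> continuous (fun y => H (s, y)).
  by move=> cH; apply: (cts_comp cH); apply: cts_pair; [exact: cts_cst|exact: cts_id].
have FF' s : cancel (fun y => F' (s, y)) (fun y => F (s, y)).
  apply: (@limit_cancel _ _ _ _ cY cPhi iPhi (fun k => isot (st k) (clamp s))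
    (fun k => isotV (st k) (clamp s)) _ _ e e_small
    (fun k => isotVK (gst k) _) (slice F s cF)) => k y.
    exact: (hF k (s, y)).
  exact: (hF' k (s, y)).
have F'F s : cancel (fun y => F (s, y)) (fun y => F' (s, y)).
  apply: (@limit_cancel _ _ _ _ cY cPhi iPhi (fun k => isotV (st k) (clamp s))
    (fun k => isot (st k) (clamp s)) _ _ e e_small
    (fun k => isotK (gst k) _) (slice F' s cF')) => k y.
    exact: (hF' k (s, y)).
  exact: (hF k (s, y)).
have hom s : homeomorphism (fun y => F (s, y)).
  split; first exact: slice.
  by exists (fun y => F' (s, y)); split=> //; exact: slice.
exists (fun y => F (1, y)); split=> //.
  exists F; split=> //; first exact: continuous_subspaceT.
  move=> y; apply: iPhi; apply/eqP; rewrite -subr_eq0 -normr_le0.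
  apply/ler_addgt0Pl => d /e_small [k ek]; rewrite addr0.
  have := hF k (0, y); rewrite /= clamp_id ?lexx ?ler01 // isot0 //.
  by move=> h; apply: le_trans h (ltW ek).
move=> k; have [_ _ _ h] := hst k; apply: h => y.
by have := hF k.+1 (1, y); rewrite /= clamp_id ?lexx ?ler01.
Qed.

End FastConjugation.

(** * Cells in manifolds, and an embedding *)

Section ManifoldCells.
Variables (R : realType) (m : nat) (Y : topologicalType).
Local Notation rV := 'rV[R]_m.

Lemma chart_cell (c : chart R m Y) (p : Y) (O : set Y) : chart_dom c p ->
  nbhs p O ->
  exists b : rV -> Y, [/\ cell b, b 0 = p & forall x, `|x| <= 1 -> O (b x)].
Proof.
move=> dp pO; pose a := chart_map c p.
have oimg := @chart_img_open R m Y c.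
have odom := @chart_dom_open R m Y c.
have ia : chart_img c a by exists p.
have inva : chart_inv c a = p by exact: chart_mapK.
have cinv u : chart_img c u -> {for u, continuous (chart_inv c)}.
  move=> iu; have := @chart_inv_continuous R m Y c; rewrite continuous_open_subspace //.
  by apply; rewrite inE.
have cmap y : chart_dom c y -> {for y, continuous (chart_map c)}.
  move=> dy; have := @chart_map_continuous R m Y c; rewrite continuous_open_subspace //.
  by apply; rewrite inE.
have : nbhs a (chart_img c `&` chart_inv c @^-1` O).
  apply: filterI; first exact: open_nbhs_nbhs.
  by apply: (cinv a ia); rewrite inva.
move=> /nbhs_normP [d /= d0 hd].
pose e := d / 2; have e0 : 0 < e by rewrite divr_gt0.
have hd' x : `|x| <= 1 -> chart_img c (a + e *: x) /\ O (chart_inv c (a + e *: x)).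
  move=> x1; apply: hd; rewrite /= opprD addrA subrr add0r normrN normrZ gtr0_norm //.
  by apply: (@le_lt_trans _ _ e); [rewrite ler_piMr // ltW|rewrite /e; lra].
(* precomposing with the radial retraction makes the cell globally continuous *)
pose ret (x : rV) := (Num.max 1 `|x|)^-1 *: x.
have m1 x : 0 < Num.max 1 `|x : rV| by rewrite lt_max ltr01.
have ret1 x : `|ret x| <= 1.
  rewrite normrZ normfV gtr0_norm // mulrC ler_pdivrMr // mul1r le_max lexx.
  by rewrite orbT.
have retE x : `|x| <= 1 -> ret x = x by move=> x1; rewrite /ret max_l // invr1 scale1r.
have cret : continuous ret.
  apply: ctsZ; last exact: cts_id.
  move=> x; apply: (@continuousV R rV (fun x => Num.max 1 `|x|)).
    by rewrite gt_eqF.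
  by apply: cts_max; [exact: cts_cst|apply: cts_norm; exact: cts_id].
pose b x := chart_inv c (a + e *: ret x).
have bmap x : chart_map c (b x) = a + e *: ret x.
  by have [[z dz hz] _] := hd' _ (ret1 x); rewrite /b -hz chart_mapK.
exists b; split; last 1 first.
- by move=> x x1; have [] := hd' _ (ret1 x).
- split.
  + move=> x; apply: (@continuous_comp _ _ _ (fun x => a + e *: ret x) (chart_inv c)).
      apply: ctsD; first exact: cts_cst.
      by apply: ctsZ; [exact: cts_cst|exact: cret].
    by apply: cinv; have [] := hd' _ (ret1 x).
  + move=> x x' x1 x'1 /(congr1 (chart_map c)); rewrite !bmap !retE //.
    by move/addrI/scalerI; apply; rewrite gt_eqF.
  + have -> : b @` [set x | `|x| < 1] =
        chart_dom c `&` [set y | `|chart_map c y - a| < e].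
      apply/seteqP; split=> [_ [x /= x1 <-]|y [dy /= ye]].
        split; last first.
          rewrite /= bmap retE ?ltW // addrAC subrr add0r normrZ gtr0_norm //.
          by rewrite gtr_pMr.
        have [[y dy ey] _] := hd' _ (ret1 x).
        by rewrite /b -ey chart_mapK.
      have n1 : `|e^-1 *: (chart_map c y - a)| < 1.
        by rewrite normrZ gtr0_norm ?invr_gt0 // mulrC ltr_pdivrMr // mul1r.
      exists (e^-1 *: (chart_map c y - a)) => //.
      rewrite /b retE; last exact: ltW.
      by rewrite scalerA divff ?gt_eqF // scale1r addrC subrK chart_mapK.
    rewrite openE => y [dy ye]; apply: filterI; first exact: open_nbhs_nbhs.
    have ou : open [set u : rV | `|u - a| < e].
      apply: open_lt_fun; last exact: cts_cst.
      by apply: cts_norm; apply: ctsB; [exact: cts_id|exact: cts_cst].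
    exact: (cmap y dy _ (open_nbhs_nbhs (conj ou ye : open_nbhs (chart_map c y) _))).
- by rewrite /b retE ?normr0 ?ler01 // scaler0 addr0.
Qed.

Lemma manifold_cells (p : Y) (O : set Y) : topological_manifold R m Y -> nbhs p O ->
  exists b : rV -> Y, [/\ cell b, b 0 = p & forall x, `|x| <= 1 -> O (b x)].
Proof. by move=> [_ _ /(_ p)[c cp]]; exact: chart_cell cp. Qed.

(** For each cell, the map [(1 - |x|, (1 - |x|) x)], extended by 0, separates the
    points of the open cell from each other and from the other points; finitely
    many open cells cover the manifold. *)
Lemma compact_manifold_embedding : topological_manifold R m Y ->
  compact [set: Y] ->
  exists (W : normedModType R) (Phi : Y -> W), continuous Phi /\ injective Phi.
Proof.
move=> Ym cY; have [hY _ _] := Ym.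
have ex (p : Y) : exists bF : (rV -> Y) * (Y -> (R * rV)%type),
    [/\ cell bF.1, bF.1 0 = p, continuous bF.2,
      forall x, `|x| <= 1 -> bF.2 (bF.1 x) = (1 - `|x|, (1 - `|x|) *: x) &
      forall y, (forall x, `|x| <= 1 -> y <> bF.1 x) -> bF.2 y = (0, 0)].
  have [b [cb bp _]] := manifold_cells Ym (filterT : nbhs p setT).
  pose v (x : rV) : (R * rV)%type := (1 - `|x|, (1 - `|x|) *: x).
  have cv : continuous v.
    have c1 : continuous (fun x : rV => 1 - `|x|).
      by apply: ctsB; [exact: cts_cst|apply: cts_norm; exact: cts_id].
    by apply: cts_pair => //; apply: ctsZ => //; exact: cts_id.
  have v1 x : `|x| = 1 -> v x = (0, 0) by rewrite /v => ->; rewrite subrr scale0r.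
  have [F [cF FE FN]] := @cell_extend R m Y (R * rV)%type b v (0, 0) hY cb cv v1.
  by exists (b, F).
have [bF hbF] := choice ex.
have nB p : nbhs p ((bF p).1 @` [set x | `|x| < 1]).
  have [[_ _ ob] bp _ _ _] := hbF p; apply: open_nbhs_nbhs; split=> //.
  by exists 0; rewrite //= normr0.
have [s [_ cov]] := finite_subcover cY (fun p _ => nB p).
have [W [Phi [cPhi sep]]] : exists (W : normedModType R) (Phi : Y -> W),
    continuous Phi /\ forall y z, Phi y = Phi z ->
      forall p, p \in s -> (bF p).2 y = (bF p).2 z.
  elim: s {cov} => [|p s [W [Phi [cPhi sep]]]].
    by exists R^o, (fun=> 0); split=> //; exact: cts_cst.
  exists ((R * rV) * W)%type, (fun y => ((bF p).2 y, Phi y)); split.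
    by apply: cts_pair => //; have [] := hbF p.
  move=> y z [e1 e2] p'; rewrite inE => /orP[/eqP -> //|].
  exact: sep.
exists W, Phi; split=> // y z /sep e.
have [p ps [x /= x1 ex']] := cov y I.
have [_ _ _ FE FN] := hbF p; have := e p ps; rewrite -ex' FE; last exact: ltW.
have [[x' [x'1 ez]]|no] := pselect (exists x', `|x'| <= 1 /\ z = (bF p).1 x').
  rewrite ez FE // => -[e1]; have -> : `|x'| = `|x| by lra.
  by move/scalerI => -> //; rewrite subr_eq0 gt_eqF.
rewrite FN; first by move=> [h] _; exfalso; lra.
by move=> x' x'1 e'; apply: no; exists x'.
Qed.

End ManifoldCells.

(** * Metrizability by distances *)

Section Metrization.
Variable R : realType.

Definition distance (T : Type) (d : T -> T -> R) := [/\ forall x, d x x = 0,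
  forall x y, d x y = 0 -> x = y, forall x y, d x y = d y x &
  forall y x z, d x z <= d x y + d y z].

Definition induces (T : topologicalType) (d : T -> T -> R) := forall x A,
  nbhs x A <-> exists2 e : R, 0 < e & forall y, d x y < e -> A y.

(** A copy of [T], meant to carry the topology of the distance. *)
Definition remetrized (T : choiceType) (d : T -> T -> R) (_ : distance d) : Type := T.

HB.instance Definition _ T d (hd : distance d) := Choice.on (@remetrized T d hd).

Section Remetrized.
Variables (T : choiceType) (d : T -> T -> R) (hd : distance d).
Local Notation M := (remetrized hd).

Let d0 (x : M) : d x x = 0. Proof. by have [+ _ _ _] := hd; apply. Qed.
Let dpos (x y : M) : d x y = 0 -> x = y. Proof. by have [_ + _ _] := hd; apply. Qed.
Let dsym (x y : M) : d x y = d y x. Proof. by have [_ _ + _] := hd; apply. Qed.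
Let dtri (y x z : M) : d x z <= d x y + d y z.
Proof. by have [_ _ _ +] := hd; apply. Qed.

HB.instance Definition _ := @isMetric.Build R M d d0 dpos dsym dtri.

End Remetrized.

Lemma remetrized_nbhs (T : choiceType) (d : T -> T -> R) (hd : distance d)
    (x : remetrized hd) (A : set (remetrized hd)) :
  nbhs x A <-> exists2 e : R, 0 < e & forall y, d x y < e -> A y.
Proof.
rewrite -metricType_numDomainType.filter_from_mdist_nbhs.
by split=> -[e e0 h]; exists e.
Qed.

Lemma metrizable_distance (T : topologicalType) : metrizable R T <->
  exists d : T -> T -> R, distance d /\ induces d.
Proof.
split=> [[M [f [cf [g [cg fK gK]]]]]|[d [hd id_]]].
  exists (fun x y => mdist (f x) (f y)); split.
    split; [by move=> x; exact: mdistxx|by move=> x y /mdist_positivity /(can_inj fK)|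
      by move=> x y; exact: metric_sym|by move=> *; exact: metric_triangle].
  move=> x A; split=> [xA|[e e0 h]].
    have : nbhs (f x) (g @^-1` A) by apply: nbhs_preimage => //; rewrite fK.
    rewrite -metricType_numDomainType.filter_from_mdist_nbhs => -[e e0 h].
    by exists e => // y /h; rewrite /preimage /= fK.
  have : nbhs (f x) [set z | mdist (f x) z < e].
    by rewrite -metricType_numDomainType.filter_from_mdist_nbhs; exists e.
  by move=> n0; have := nbhs_preimage cf n0; apply: filterS => y; exact: h.
exists (remetrized hd), id; split; first by move=> x A /remetrized_nbhs /id_.
by exists id; split=> // x A /id_ /remetrized_nbhs.
Qed.

End Metrization.

(** * Minimality of products *)

Section ProductMinimality.
Variables (R : realType) (X Y : topologicalType) (T : X -> X) (S : Y -> Y).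
Hypothesis cY : compact [set: Y].

Lemma metrizable_prod : metrizable R X -> metrizable R Y -> metrizable R (X * Y)%type.
Proof.
move=> /metrizable_distance [d [[d0 dp ds dt] dn]].
move=> /metrizable_distance [d' [[d'0 d'p d's d't] d'n]]; apply/metrizable_distance.
have dge x y : 0 <= d x y.
  by have := dt y x x; rewrite d0 (ds y x) -mulr2n pmulrn_lge0.
have d'ge x y : 0 <= d' x y.
  by have := d't y x x; rewrite d'0 (d's y x) -mulr2n pmulrn_lge0.
exists (fun p p' => d p.1 p'.1 + d' p.2 p'.2); split.
  split.
  - by move=> p; rewrite d0 d'0 addr0.
  - move=> [x y] [x' y'] /= e.
    have := dge x x'; have := d'ge y y' => h h'.
    by congr pair; [apply: dp|apply: d'p]; lra.
  - by move=> p p'; rewrite ds d's.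
  - by move=> q p r; have := dt q.1 p.1 r.1; have := d't q.2 p.2 r.2; lra.
move=> [x y] A; split.
  move=> [[U V] /= [/dn [e e0 hU] /d'n [e' e'0 hV]] UV].
  exists (Num.min e e'); first by rewrite lt_min e0.
  move=> [x' y'] /=; rewrite lt_min => /andP[h h'].
  apply: (UV (x', y')); split; [apply: hU|apply: hV] => /=.
    by have := d'ge y y'; lra.
  by have := dge x x'; lra.
move=> [e e0 h]; have e2 : 0 < e / 2 by rewrite divr_gt0.
exists ([set x' | d x x' < e / 2], [set y' | d' y y' < e / 2]) => /=.
  by split; [apply/dn|apply/d'n]; exists (e / 2).
by move=> [x' y'] /= [h1 h2]; apply: h => /=; lra.
Qed.

Lemma iter_prod_map n p : iter n (prod_map T S) p = (iter n T p.1, iter n S p.2).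
Proof. by elim: n => [|n IH] /=; [case: p|rewrite IH]. Qed.

(** The projection along a compact factor is a closed map. *)
Lemma projection_closed (M : set (X * Y)) : closed M ->
  closed [set x | exists y, M (x, y)].
Proof.
move=> clM x clx; apply: contrapT => nx.
have : \forall x' \near x, [set: Y] `<=` (fun y => ~ M (x', y)).
  apply: ((compact_near_coveringP _).1 cY X (nbhs x) (fun x' y => ~ M (x', y))
    (nbhs_filter x)) => y _.
  have nM : (~` M) (x, y) by move=> Mxy; apply: nx; exists y.
  have [[U V] /= [Ux Vy] UV] := open_nbhs_nbhs (conj (closed_openC clM) nM).
  by exists (V, U) => // -[y' x'] /= [Vy' Ux']; exact: (UV (x', y')).
by move=> /clx [x' [[y Mxy] /(_ y I)]].
Qed.

(** The closure of the orbit from time [j] on is invariant, hence everything. *)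
Lemma minimal_infinitely_often (x0 : X) (U : set X) (k : nat) : minimal_system R T ->
  nbhs (iter k T x0) U -> infinitely_often (fun n => U (iter n T x0)).
Proof.
move=> [_ cT minT] nU j.
pose A := [set iter n T x0 | n in [set n | (j <= n)%N]].
have AT : closure A = setT.
  apply: minT; first exact: closed_closure.
    by exists (iter j T x0); apply: subset_closure; exists j => //=.
  move=> _ [x clx <-] B nB.
  have [_ [[n /= jn <-] Bn]] := clx _ (nbhs_preimage cT nB).
  by exists (iter n.+1 T x0); split=> //; exists n.+1 => //=; exact: leqW.
have clk : closure A (iter k T x0) by rewrite AT.
have [_ [[n /= jn <-] Un]] := clk _ nU.
by exists n.
Qed.

(** A closed invariant nonempty set projects onto a closed invariant nonempty
    subset of [X], that is, onto [X]; so it contains a point [(x0, y0)], and the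
    orbit of this point visits every box. *)
Lemma product_minimal (x0 : X) : minimal_system R T -> metrizable R Y ->
  continuous S ->
  (forall k (U : set X) (V : set Y) (y y0 : Y), nbhs (iter k T x0) U -> nbhs y V ->
     exists2 n, U (iter n T x0) & V (iter n S y0)) ->
  minimal_system R (prod_map T S).
Proof.
move=> minXT mY cS visit; have [mX cT minT] := minXT.
split; first exact: metrizable_prod.
  by apply: cts_pair; [apply: (cts_comp cT)|apply: (cts_comp cS)];
    [apply: cts_fst|apply: cts_snd]; exact: cts_id.
move=> M clM [[x1 y1] M1] MT.
have Minv n p : M p -> M (iter n T p.1, iter n S p.2).
  rewrite -iter_prod_map => Mp; elim: n => //= n IH; apply: MT.
  by exists (iter n (prod_map T S) p).
have [y0 M0] : exists y0, M (x0, y0).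
  have projT : [set x | exists y, M (x, y)] = setT.
    apply: minT; [exact: projection_closed|by exists x1, y1|].
    by move=> _ [x [y Mxy] <-]; exists (S y); apply: MT; exists (x, y).
  by have : [set x | exists y, M (x, y)] x0 by rewrite projT.
have orbT : closure [set iter n T x0 | n in [set: nat]] = setT.
  apply: minT; first exact: closed_closure.
    by exists x0; apply: subset_closure; exists 0%N.
  move=> _ [x clx <-] B nB.
  have [_ [[n _ <-] Bn]] := clx _ (nbhs_preimage cT nB).
  by exists (iter n.+1 T x0); split=> //; exists n.+1.
apply/seteqP; split=> // -[x y] _; apply: clM => A [[U V] /= [Ux Vy] UV].
have clx : closure [set iter n T x0 | n in [set: nat]] x by rewrite orbT.
have [_ [[k _ <-] Uk]] := clx _ (nbhs_interior Ux).
have [n Un Vn] := visit k U V y y0 Uk Vy.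
exists (iter n T x0, iter n S y0); split; first exact: (Minv n (x0, y0)).
exact: (UV (_, _)).
Qed.

End ProductMinimality.

(** * Free actions of compact connected Lie groups *)

Section Conclusion.
Variables (R : realType) (m n : nat) (Y : topologicalType).
Variable G : topologicalGroupType.
Hypotheses (Y_manifold : topological_manifold R m Y) (cY : compact [set: Y]).
Hypothesis Y_connected : connected [set: Y].
Hypotheses (G_lie : lie_group R n G) (cG : compact [set: G]).
Hypotheses (G_connected : connected [set: G]) (G_nontrivial : exists g : G, g <> 1%g).

Lemma circle_flow_of_free_action (a : G -> Y -> Y) : free_action a ->
  exists phi : R -> Y -> Y, circle_flow phi.
Proof.
move=> [ca a1 aM afree].
have [s [[cs sD] sker]] := circle_subgroup G_lie cG G_connected G_nontrivial.
exists (fun t y => a (s t) y); split.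
- apply: (@cts_comp _ _ _ (fun p : G * Y => a p.1 p.2)
    (fun p : R * Y => (s p.1, p.2)) ca).
  apply: cts_pair; last by apply: cts_snd; exact: cts_id.
  by apply: (cts_comp cs); apply: cts_fst; exact: cts_id.
- by move=> t u y; rewrite sD aM.
- move=> y; have -> : s 1 = 1%g by apply/sker; exists 1.
  exact: a1.
- by move=> t y /afree /sker.
Qed.

Lemma compact_manifold_metrizable : metrizable R Y.
Proof.
have [W [Phi [cPhi iPhi]]] := compact_manifold_embedding Y_manifold cY.
apply/metrizable_distance; exists (fun y z => `|Phi y - Phi z|); split.
  split.
  - by move=> x; rewrite subrr normr0.
  - by move=> x y /normr0_eq0/eqP; rewrite subr_eq0 => /eqP/iPhi.
  - by move=> x y; rewrite distrC.
  - by move=> y x z; exact: ler_distD.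
move=> y A; split=> [yA|[e e0 h]].
  have [e e0 h] := embedding_base cY cPhi iPhi yA.
  by exists e => // z; rewrite distrC; exact: h.
have o : open [set z | `|Phi y - Phi z| < e].
  apply: open_lt_fun; last exact: cts_cst.
  by apply: cts_norm; apply: ctsB => //; exact: cts_cst.
have h0 : `|Phi y - Phi y| < e by rewrite subrr normr0.
exact: filterS h (open_nbhs_nbhs (conj o h0)).
Qed.

(** The requirements on [S] are indexed by triples [(k, j, l)]: a time in the set
    of visits of [x0] to the ball of radius [1 / (j + 1)] around [iter k T x0], at
    which every point of [Y] must be in the open set of index [l] of a countable
    base. *)
Lemma free_action_product_minimal (a : G -> Y -> Y) (X : topologicalType)
    (T : X -> X) : free_action a -> minimal_system R T ->
  exists S : Y -> Y, [/\ homeomorphism S, isotopic_to_id R S &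
    minimal_system R (prod_map T S)].
Proof.
move=> fa minXT; have [hY [B cB [Bo Bbase]] _] := Y_manifold.
have mY := compact_manifold_metrizable.
have [mX cT minT] := minXT.
(* if X x Y is empty, the identity of Y will do *)
have [[[x0 yy] _]|no] := pselect (exists p : X * Y, True); last first.
  exists id; split; first exact: homeomorphism_id.
    exists (fun p => p.2); split=> //; last by move=> t _; exact: homeomorphism_id.
    by apply: continuous_subspaceT; apply: cts_snd; exact: cts_id.
  split; first exact: metrizable_prod.
    by apply: cts_pair; [apply: (cts_comp cT)|]; [apply: cts_fst|apply: cts_snd];
      exact: cts_id.
  by move=> M _ [p _]; case: no; exists p.
have [phi flow] := circle_flow_of_free_action fa.
have [W [Phi [cPhi iPhi]]] := compact_manifold_embedding Y_manifold cY.
have [d [[d0 _ _ dt] dn]] := (metrizable_distance R X).1 mX.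
have [f finj] := countable_injP B cB.
pose isB i U := [/\ B U, f U = i & U !=set0].
pose V i := match pselect (exists U, isB i U) with
  | left e => projT1 (cid e) | right _ => setT end.
have VB U : B U -> U !=set0 -> V (f U) = U.
  move=> BU U0; rewrite /V; case: pselect => [e|]; last by case; exists U.
  by case: cid => U' [BU' fU' _] /=; apply: finj => //; apply/mem_set.
have oV i : open (V i).
  rewrite /V; case: pselect => [e|_]; last exact: openT.
  by case: cid => U [BU _ _] /=; exact: Bo.
have V0 i : V i !=set0.
  by rewrite /V; case: pselect => [e|_]; [case: cid => U []|exists yy].
pose code i : nat * nat * nat := odflt (0, 0, 0)%N (unpickle i).
pose N i k := d (iter (code i).1.1 T x0) (iter k T x0) < ((code i).1.2.+1%:R)^-1.
have iN i : infinitely_often (N i).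
  apply: (minimal_infinitely_often (k := (code i).1.1)
    (U := [set x | d (iter (code i).1.1 T x0) x < ((code i).1.2.+1%:R)^-1]) minXT).
  by apply/dn; exists ((code i).1.2.+1%:R)^-1; rewrite ?invr_gt0.
have meets := conjugate_to_meet_orbits flow hY cY
  (fun p O => @manifold_cells R m Y p O Y_manifold) Y_connected.
have [S [hS iS visit]] := generic_homeomorphism cY cPhi iPhi flow meets
  iN (fun i => oV (code i).2) (fun i => V0 (code i).2).
exists S; split=> //; apply: (product_minimal cY (x0 := x0)) => //.
  by case: hS.
move=> k U A y y0 /dn [e e0 hU] /Bbase [C [BC Cy] CA].
pose j := Num.truncn e^-1.
have je : (j.+1%:R)^-1 < e :> R.
  by rewrite invf_plt ?posrE // ; exact: truncnS_gt.
have [l Nl Vl] := visit (pickle (k, j, f C)) y0.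
move: Nl Vl; rewrite /N /code pickleK /= => Nl.
rewrite VB //; last by exists y.
by move=> Cl; exists l; [apply: hU; exact: lt_trans Nl je|exact: CA].
Qed.

End Conclusion.

Theorem theorem50 (R : realType) (m n : nat)
  (Y : topologicalType) (G : topologicalGroupType)
  (Y_manifold : topological_manifold R m Y)
  (Y_compact : compact [set: Y])
  (Y_connected : connected [set: Y])
  (G_lie : lie_group R n G)
  (G_compact : compact [set: G])
  (G_connected : connected [set: G])
  (G_nontrivial : exists g : G, g <> 1%g)
  (Y_free_action : exists a : G -> Y -> Y, free_action a) :
  (forall (X : topologicalType) (T : X -> X), minimal_system R T ->
     exists S : Y -> Y,
       [/\ homeomorphism S, isotopic_to_id R S &
           minimal_system R (prod_map T S)])
  /\ homeo_product_minimal R Y.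
Proof.
have [a fa] := Y_free_action.
have H (X : topologicalType) (T : X -> X) : minimal_system R T ->
    exists S : Y -> Y, [/\ homeomorphism S, isotopic_to_id R S &
      minimal_system R (prod_map T S)].
  exact: (free_action_product_minimal Y_manifold Y_compact Y_connected G_lie
    G_compact G_connected G_nontrivial fa).
split=> //; split=> //.
  exact: (compact_manifold_metrizable Y_manifold Y_compact).
by move=> X T /H [S [hS _ mS]]; exists S.
Qed.
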